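(* Let $V(x,y)=q(x,y)=\sum_{j\ne0}q_j(x)e^{2\pi i\lambda_jy}$ satisfy Hypotheses (V) with $q_{\rm av}\equiv0$ and $q\not\equiv0$; let $q_\epsilon(x)=q(x,x/\epsilon)$ and $\Lambda_{\rm eff}(x)=\frac1{4\pi^2}\sum_{j\ne0}\frac{|q_j(x)|^2}{\lambda_j^2}$. If $\epsilon>0$ is sufficiently small, then the transmission coefficient $t^{q_\epsilon}(k)$ has a pole in the upper half plane at $$k_\epsilon=i\,\frac{\epsilon^2}{2}\left(\int_{\mathbb{R}}\Lambda_{\rm eff}\right)+\mathcal{O}(\epsilon^3),\qquad\epsilon\to0,$$ and therefore the operator $H_{q_\epsilon}=-\partial_x^2+q_\epsilon(x)$ on $L^2(\mathbb{R})$ has a simple eigenvalue $E_\epsilon$ with eigenfunction $u_{E_{q_\epsilon}}$ satisfying $$E_\epsilon=k_\epsilon^2=-\frac{\epsilon^4}{4}\left(\int_{\mathbb{R}}\Lambda_{\rm eff}\right)^2+\mathcal{O}(\epsilon^5),\qquad\epsilon\to0,$$ $$u_{E_{q_\epsilon}}(x)=\mathcal{O}\big(e^{-\sqrt{|E_\epsilon|}\,|x|}\big),\qquad|x|\gg1.$$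
   Context: Function spaces: for $\beta>0$, $L^\infty_\beta$ is the space of measurable $g:\mathbb{R}\to\mathbb{C}$ with $|g|_{L^\infty_\beta}=\operatorname{ess\,sup}_x e^{\beta|x|}|g(x)|<\infty$, and $|g|_{W^{n,\infty}_\beta}=\sum_{l=0}^n|\partial_x^l g|_{L^\infty_\beta}$. Hypotheses (V) (with $q_{\rm av}\equiv 0$): $V(x,y)=\sum_{j\in\mathbb{Z}\setminus\{0\}}q_j(x)e^{2\pi i\lambda_jy}$ is real-valued, $\overline{q_j}=q_{-j}$, $\lambda_{-j}=-\lambda_j$; there are $\theta,\beta>0$ with $\inf_{j\ne k}|\lambda_j-\lambda_k|\ge\theta$ and $\inf_{j\neq 0}|\lambda_j|\ge\theta$ ($\lambda_j$ real); and $\sum_{j\ne0}|q_j|_{W^{3,\infty}_\beta}<\infty$. Jost solutions and transmission coefficient: for real-valued $U\in L^\infty_\beta$ and $|\Im k|<\beta/2$, $f^U_\pm(x;k)$ are the unique solutions of $f^U_+(x;k)=e^{ikx}+\int_x^\infty\frac{\sin(k(y-x))}{k}U(y)f^U_+(y;k)\,dy$, $f^U_-(x;k)=e^{-ikx}-\int_{-\infty}^x\frac{\sin(k(y-x))}{k}U(y)f^U_-(y;k)\,dy$ (with $\sin(kz)/k=z$ at $k=0$). With $\mathcal{W}[h_1,h_2]=h_1h_2'-h_2h_1'$, the meromorphic function $t^U$ is defined by $\mathcal{W}[f^U_+,f^U_-](k)=-2ik/t^U(k)$. *)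

(* Defs.v *)
From HB Require Import structures.
From mathcomp Require Import all_boot all_order all_algebra.
From mathcomp Require Import complex.
From mathcomp Require Import all_classical all_reals all_analysis.
From mathcomp Require Import ess_sup_inf.

Set Implicit Arguments.
Unset Strict Implicit.
Unset Printing Implicit Defensive.

Import Order.TTheory GRing.Theory Num.Theory.
Import numFieldNormedType.Exports.

Local Open Scope classical_set_scope.
Local Open Scope complex_scope.
Local Open Scope ring_scope.

Local Notation mu := (@lebesgue_measure _).
Local Notation Re := complex.Re.
Local Notation Im := complex.Im.
Local Notation normc := Normc.normc.

Definition cexp (R : realType) (z : R[i]) : R[i] :=
  (expR (Re z) * cos (Im z)) +i* (expR (Re z) * sin (Im z)).

Definition csin (R : realType) (z : R[i]) : R[i] :=
  (cexp ('i%C * z) - cexp (- ('i%C * z))) / (2 * 'i%C).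

(* The mathcomp-analysis integral is for (extended) real functions and its
   derivative is for functions into a normed module over their domain, whereas
   [R[i]] is a normed module over [R[i]] only; hence the componentwise
   definitions. *)
Definition cintegrable (R : realType) (D : set R) (f : R -> R[i]) : Prop :=
  mu.-integrable D (fun x => (Re (f x))%:E) /\
  mu.-integrable D (fun x => (Im (f x))%:E).

Definition cintegral (R : realType) (D : set R) (f : R -> R[i]) : R[i] :=
  (\int[mu]_(x in D) Re (f x)) +i* (\int[mu]_(x in D) Im (f x)).

Definition cderive1 (R : realType) (f : R -> R[i]) (x : R) : R[i] :=
  derive1 (fun y => Re (f y)) x +i* derive1 (fun y => Im (f y)) x.

Definition cmeasurable (R : realType) (f : R -> R[i]) : Prop :=
  measurable_fun setT (fun x => Re (f x)) /\
  measurable_fun setT (fun x => Im (f x)).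

(** Sobolev spaces *)

Definition test_function (R : realType) (phi : R -> R) : Prop :=
  (forall (n : nat) (x : R), derivable (derive1n n phi) x 1) /\
  exists M : R, forall x, M < `|x| -> phi x = 0.

(* [h] is the derivative of [g] in the sense of distributions. *)
Definition weak_derivative (R : realType) (g h : R -> R[i]) : Prop :=
  [/\ locally_integrable setT (fun x => Re (g x)) /\
      locally_integrable setT (fun x => Im (g x)),
      locally_integrable setT (fun x => Re (h x)) /\
      locally_integrable setT (fun x => Im (h x)) &
      forall phi : R -> R, test_function phi ->
        cintegral setT (fun x => g x * (derive1 phi x)%:C) =
        - cintegral setT (fun x => h x * (phi x)%:C)].

Definition Linf_norm (R : realType) (beta : R) (g : R -> R[i]) : \bar R :=
  ess_sup mu (fun x => (expR (beta * `|x|) * normc (g x))%:E).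

(* The weak derivatives are determined up to null sets, on which the essential
   suprema do not depend, so the set below has at most one element; it is empty,
   and the norm is [+oo], when [g] is not [n] times weakly differentiable. *)
Definition Wninf_norm (R : realType) (n : nat) (beta : R) (g : R -> R[i]) :
    \bar R :=
  ereal_inf [set s | exists h : nat -> R -> R[i],
    [/\ h 0%N = g,
        (forall l, (l < n)%N -> weak_derivative (h l) (h l.+1)) &
        s = (\sum_(l < n.+1) Linf_norm beta (h l))%E]].

Definition L2 (R : realType) (u : R -> R[i]) : Prop :=
  cmeasurable u /\ (\int[mu]_x ((normc (u x)) ^+ 2)%:E < +oo)%E.

(** The potential *)

Definition nonzero_int : set int := [set j | j != 0].

(* The sums over nonzero integers below converge absolutely for almost every
   [x], so the order of summation is immaterial. *)
Definition sum_nonzero (R : realType) (a : int -> R) : R :=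
  limn (fun N : nat => \sum_(1 <= j < N.+1) (a j%:Z + a (- j%:Z))).

Definition potential (R : realType) (q : int -> R -> R[i]) (lambda : int -> R)
    (x y : R) : R[i] :=
  let term (j : int) := q j x * cexp ('i%C * (2 * pi * lambda j * y)%:C) in
  sum_nonzero (fun j => Re (term j)) +i* sum_nonzero (fun j => Im (term j)).

(* Elements of the function spaces are only defined almost everywhere, whence
   the almost-everywhere quantifiers. *)
Record hypotheses_V (R : realType) (q : int -> R -> R[i]) (lambda : int -> R)
    (theta beta : R) : Prop := HypothesesV {
  hypV_theta : 0 < theta;
  hypV_beta : 0 < beta;
  hypV_real : {ae mu, forall x : R, forall y : R,
    Im (potential q lambda x y) = 0};
  hypV_conj : forall j : int, j != 0 ->
    {ae mu, forall x : R, conjc (q j x) = q (- j) x};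
  hypV_odd : forall j : int, j != 0 -> lambda (- j) = - lambda j;
  hypV_sep : forall j k : int, j != 0 -> k != 0 -> j != k ->
    theta <= `|lambda j - lambda k|;
  hypV_low : forall j : int, j != 0 -> theta <= `|lambda j|;
  hypV_sum : (\esum_(j in nonzero_int) Wninf_norm 3 beta (q j) < +oo)%E }.

Definition q_eps (R : realType) (q : int -> R -> R[i]) (lambda : int -> R)
    (eps : R) (x : R) : R :=
  Re (potential q lambda x (x / eps)).

Definition Lambda_eff (R : realType) (q : int -> R -> R[i]) (lambda : int -> R)
    (x : R) : R :=
  (4 * pi ^+ 2)^-1 *
  sum_nonzero (fun j => normc (q j x) ^+ 2 / lambda j ^+ 2).

(** Scattering *)

(* sin (k z) / k *)
Definition jost_kernel (R : realType) (k : R[i]) (z : R) : R[i] :=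
  if k == 0 then z%:C else csin (k * z%:C) / k.

Definition is_jost_plus (R : realType) (U : R -> R) (k : R[i])
    (f : R -> R[i]) : Prop :=
  forall x : R,
    let g y := jost_kernel k (y - x) * (U y)%:C * f y in
    cintegrable `[x, +oo[ g /\
    f x = cexp ('i%C * k * x%:C) + cintegral `[x, +oo[ g.

Definition is_jost_minus (R : realType) (U : R -> R) (k : R[i])
    (f : R -> R[i]) : Prop :=
  forall x : R,
    let g y := jost_kernel k (y - x) * (U y)%:C * f y in
    cintegrable `]-oo, x] g /\
    f x = cexp (- ('i%C * k * x%:C)) - cintegral `]-oo, x] g.

(* The Volterra equations have a unique solution, selected here by [xget]. *)
Definition jost_plus (R : realType) (U : R -> R) (k : R[i]) : R -> R[i] :=
  xget (fun=> 0) [set f | is_jost_plus U k f].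

Definition jost_minus (R : realType) (U : R -> R) (k : R[i]) : R -> R[i] :=
  xget (fun=> 0) [set f | is_jost_minus U k f].

Definition wronskian (R : realType) (h1 h2 : R -> R[i]) (x : R) : R[i] :=
  h1 x * cderive1 h2 x - h2 x * cderive1 h1 x.

(* The Wronskian of the two Jost solutions does not depend on the point; it is
   evaluated at 0. Since [_ / 0 = 0], this function vanishes at the poles of
   the meromorphic function t; [is_pole] only looks at punctured
   neighbourhoods. *)
Definition transmission (R : realType) (U : R -> R) (k : R[i]) : R[i] :=
  - (2 * 'i%C * k) / wronskian (jost_plus U k) (jost_minus U k) 0.

(* [t] is holomorphic in a punctured neighbourhood of [k0], and its modulus
   tends to infinity at [k0]; [C^o] is the complex line as a normed module over
   itself, so that [derivable] is complex differentiability. *)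
Definition is_pole (R : realType) (t : R[i] -> R[i]) (k0 : R[i]) : Prop :=
  let C : numFieldType := R[i] in
  (\forall k \near (k0 : C)^', derivable (t : C^o -> C^o) k 1) /\
  normc (t k) @[k --> (k0 : C)^'] --> +oo.

(** The Schroedinger operator *)

(* [u] is in H^2(R), the domain of [H_U = - d^2/dx^2 + U] on L^2(R), and
   [H_U u = v]. *)
Definition schroedinger (R : realType) (U : R -> R) (u v : R -> R[i]) : Prop :=
  exists u1 u2 : R -> R[i],
    [/\ L2 u /\ weak_derivative u u1,
        L2 u1 /\ weak_derivative u1 u2,
        L2 u2 &
        {ae mu, forall x : R, - u2 x + (U x)%:C * u x = v x}].

Definition eigenfunction (R : realType) (U : R -> R) (E : R)
    (u : R -> R[i]) : Prop :=
  schroedinger U u (fun x => E%:C * u x) /\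
  ~ {ae mu, forall x : R, u x = 0}.

(* [H_U] is self-adjoint, so that simplicity is one-dimensionality of the
   eigenspace. *)
Definition simple_eigenvalue (R : realType) (U : R -> R) (E : R) : Prop :=
  (exists u, eigenfunction U E u) /\
  forall u v, eigenfunction U E u -> eigenfunction U E v ->
    exists c : R[i], {ae mu, forall x : R, v x = c * u x}.

(* Main.v *)
(* The oscillating potential is integrated twice in its fast variable: there is a
   phase Ph = O(eps^2) with Ph' = O(eps) such that conjugation by exp Ph turns
   -d^2/dx^2 + q_eps into an operator with potential S = O(eps^2) and drift Ph',
   where int S = - eps^2 int Lambda_eff + O(eps^3): the diagonal terms of (Ph')^2
   give Lambda_eff, and the remaining frequencies, which are bounded below by the
   separation of the lambda_j, only contribute after one more integration by
   parts. For d = O(eps), with Ph' = O(d) and Ph, S = O(d^2), the Jost solutions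
   exp Ph * exp (i k x) * m are obtained by contraction uniformly for
   0 <= Im k, |k| <= 1, and the Wronskian satisfies, up to a non-zero factor,
   W(i kappa) = 2 kappa + int S + O(d^3) for 0 <= kappa <= d^2. It is real there,
   so that the intermediate value theorem gives a zero
   kappa = eps^2 / 2 * int Lambda_eff + O(eps^3); dW/dk = 2i + O(d) makes it
   simple, hence a pole of t. At the zero the two Jost solutions are proportional,
   and yield an exponentially decaying eigenfunction. Any other eigenfunction is a
   classical solution, as weak derivatives are honest primitives; its Wronskian
   with the first one is constant and integrable, hence zero. *)
Require Import Defs.
From HB Require Import structures.
From mathcomp Require Import all_boot all_order all_algebra.
From mathcomp Require Import complex.
From mathcomp Require Import all_classical all_reals all_analysis.
From mathcomp Require Import measurable_realfun ess_sup_inf.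
From mathcomp Require Import ring lra.

Set Implicit Arguments.
Unset Strict Implicit.
Unset Printing Implicit Defensive.

Import Order.TTheory GRing.Theory Num.Theory.
Import numFieldNormedType.Exports.

Local Open Scope classical_set_scope.
Local Open Scope complex_scope.
Local Open Scope ring_scope.

Local Notation mu := (@lebesgue_measure _).
Local Notation Re := complex.Re.
Local Notation Im := complex.Im.
Local Notation normc := Normc.normc.

(** * Primitives of locally bounded functions *)

Section RealIntegrals.
Context {R : realType}.
Implicit Types (h f g F G : R -> R) (a b x y N : R).

(** The regularity of the data shapes the tools. Only three weak derivatives of [q j] are available
    and the third is merely bounded, so the twofold integration stops after two terms of a series;
    its remainder, of order $\epsilon^2$, is a derivative up to order $\epsilon^3$. For the same
    reason identities between functions are read in integral form ([primitive]). The unknown of the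
    contraction is a multiple of $m'$ rather than $m$: it solves a first-order equation, whose
    solution operator is bounded uniformly down to $k = 0$, where the Volterra kernel $\sin(kz)/k$
    grows linearly. Dependence on [k] goes through the resolvent identity of that operator, which
    yields expansions with quadratic remainder in place of differentiation under the integral sign.
    Finally, the Jost solutions are specified by an integral equation alone and selected by choice,
    so the transmission coefficient is computed only once uniqueness is known among all solutions
    with integrable right-hand side, no growth bound being assumed. *)

Lemma is_derive_expR_lin a x :
  is_derive x (1:R) (fun y => expR (a * y)) (a * expR (a * x)).
Proof.
have -> : (fun y : R => expR (a * y)) = expR \o (a *: id)
  by apply/funext.
apply: is_derive_eq.
by rewrite /= /GRing.scale/= mulr1 mulrC.
Qed.

Lemma continuous_expR_lin a : continuous (fun y : R => expR (a * y)).
Proof.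
move=> x; apply: (@continuous_comp _ _ _ (fun y : R => a * y) expR).
  exact: mulrl_continuous.
exact: continuous_expR.
Qed.

Lemma cvg_expR_lin b : 0 < b -> expR (- b * y) @[y --> +oo] --> (0 : R).
Proof.
move=> b0; rewrite -[X in _ --> X]/(0:R).
have -> : (fun y : R => expR (- b * y)) = (fun y => (expR (b * y))^-1).
  by apply/funext => y; rewrite -expRN mulNr.
apply/(gtr0_cvgV0 (f := fun y : R => expR (b * y))).
  by near=> y; exact: expR_gt0.
apply/cvgryPge => A; near=> y.
apply: (@le_trans _ _ (b * y)); last first.
  by apply: le_trans (expR_ge1Dx _); rewrite lerDr.
rewrite mulrC -ler_pdivrMr//; near: y; exact: nbhs_pinfty_ge.
Unshelve. all: by end_near. Qed.

Lemma Rintegral_expR_tail b x : 0 < b ->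
  \int[mu]_(y in `[x, +oo[) expR (- b * y) = expR (- b * x) / b.
Proof.
move=> b0.
have dF y : is_derive y (1:R) (fun y => - (b^-1) * expR (- b * y)) (expR (- b * y)).
  have := is_derive_expR_lin (- b) y => H.
  have -> : (fun y : R => - (b^-1) * expR (- b * y)) =
    (- (b^-1)) *: (fun y => expR (- b * y)) by apply/funext.
  apply: is_derive_eq.
  by rewrite /GRing.scale/= mulrA mulrNN mulVf ?mul1r// gt_eqF.
rewrite (@Rintegral_ge0_continuous_FTC2y R (fun y => expR (- b * y))
  (fun y => - (b^-1) * expR (- b * y)) x 0).
- by rewrite mulNr opprK add0r mulrC.
- by move=> y _; exact: expR_ge0.
- by apply: continuous_subspaceT; exact: continuous_expR_lin.
- rewrite -(mulr0 (- (b^-1))).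
  by apply: cvgMr; exact: cvg_expR_lin.
- by move=> y _; case: (dF y).
- apply: cvg_at_right_filter.
  by apply: cvgMr; exact: continuous_expR_lin.
- by move=> y _; rewrite derive1E; case: (dF y).
Qed.

Lemma integrable_expR_tail b x : 0 < b ->
  mu.-integrable `[x, +oo[ (EFin \o (fun y : R => expR (- b * y))).
Proof.
move=> b0; apply/integrableP; split.
  apply/measurable_EFinP; apply: measurable_funTS.
  by apply: continuous_measurable_fun; exact: continuous_expR_lin.
(* Were the integral [+oo], its [fine] would be 0, whereas the tail integral computed above is
   positive. *)
rewrite ltNge leye_eq; apply/negP => /eqP H.
have := @Rintegral_expR_tail b x b0.
rewrite /Rintegral.
under eq_integral => y _ do rewrite -[expR _]gtr0_norm ?expR_gt0//.
rewrite H /=.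
move=> /esym/eqP; apply/negP; rewrite gt_eqF//.
by rewrite divr_gt0 ?expR_gt0.
Qed.

Lemma integrable_expR_tailZ b N x : 0 < b ->
  mu.-integrable `[x, +oo[ (EFin \o (fun y : R => N * expR (- b * y))).
Proof.
move=> b0; rewrite (_ : EFin \o _ = (fun y => N%:E * (expR (- b * y))%:E)%E).
  by apply: integrableZl => //; exact: integrable_expR_tail.
by apply/funext.
Qed.

Definition locally_bounded h :=
  forall M, exists C, forall x, `|x| <= M -> `|h x| <= C.

(** The integral form of $F' = h$ suits coefficients that are only measurable and locally bounded.
    Local boundedness makes [F] locally Lipschitz, which is what the product rule rests on. *)
Definition primitive F h :=
  [/\ measurable_fun setT h, locally_bounded h &
      forall a b, a <= b -> F b - F a = \int[mu]_(x in `[a, b]) h x].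

Lemma locally_bounded_itv h a b : locally_bounded h ->
  exists2 C, 0 <= C & forall x, a <= x <= b -> `|h x| <= C.
Proof.
move=> /(_ (`|a| + `|b|)) [C hC]; exists (Num.max 0 C); first by rewrite le_max lexx.
move=> x /andP[ax xb]; rewrite le_max; apply/orP; right; apply: hC.
have [x0|x0] := leP 0 x.
  rewrite ger0_norm// (le_trans xb)// (le_trans (ler_norm b))// lerDr//.
rewrite ltr0_norm// (@le_trans _ _ (- a))// ?lerN2// -normrN (le_trans (ler_norm (-a)))//.
by rewrite lerDl.
Qed.

Lemma locally_bounded_integrable h a b : measurable_fun setT h ->
  locally_bounded h -> mu.-integrable `[a, b] (EFin \o h).
Proof.
move=> mh /locally_bounded_itv -/(_ a b)[C _ hC].
apply: measurable_bounded_integrable => //.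
- by rewrite /= lebesgue_measure_itv/=; case: ifPn => _; rewrite ?ltry.
- exact: measurable_funTS.
- exists C; split; first exact: num_real.
  move=> y Cy x /=; rewrite in_itv/= => xab.
  by rewrite (le_trans _ (ltW Cy))// hC.
Qed.

Lemma Rintegral_itv_cst a b c : a <= b -> \int[mu]_(x in `[a, b]) c = c * (b - a).
Proof.
move=> ab; rewrite Rintegral_cst//= lebesgue_measure_itv/= lte_fin.
by move: ab; rewrite le_eqVlt => /predU1P[->|->]//=; rewrite ltxx subrr.
Qed.

Lemma normr_Rintegral_itv_le h a b C : measurable_fun setT h ->
  locally_bounded h -> a <= b ->
  (forall x, a <= x <= b -> `|h x| <= C) ->
  `|\int[mu]_(x in `[a, b]) h x| <= C * (b - a).
Proof.
move=> mh bh ab hC.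
have ih := locally_bounded_integrable a b mh bh.
apply: (le_trans (le_normr_Rintegral _ _)) => //.
rewrite -Rintegral_itv_cst//.
apply: le_Rintegral => //.
- exact: integrable_norm.
- apply: (@locally_bounded_integrable (fun=> C)); first exact: measurable_cst.
  by move=> M; exists `|C| => _ _.
Qed.

Lemma Rintegral_itv_split_integrable h a b c : mu.-integrable `[a, c] (EFin \o h) ->
  a <= b -> b <= c ->
  \int[mu]_(x in `[a, c]) h x =
  \int[mu]_(x in `[a, b]) h x + \int[mu]_(x in `[b, c]) h x.
Proof.
move=> ih ab bc; rewrite -(Rintegral_itv_obnd_cbnd (r := b)); last first.
  apply: (@integrableS _ _ _ mu `[a, c]) => //.
  by move=> x /=; rewrite !in_itv/= => /andP[/ltW h1 ->]; rewrite (le_trans ab).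
rewrite -(@Rintegral_itvB _ h (BLeft a) (BRight c) b) ?bnd_simp//.
by rewrite addrC subrK.
Qed.

Lemma integral_increment h c : (forall a b, mu.-integrable `[a, b] (EFin \o h)) ->
  let F x := if c <= x then \int[mu]_(y in `[c, x]) h y
             else - \int[mu]_(y in `[x, c]) h y in
  forall a b, a <= b -> F b - F a = \int[mu]_(x in `[a, b]) h x.
Proof.
move=> ih F a b ab; rewrite /F.
case: ifPn => [cb|]; case: ifPn => [ca|].
- by rewrite (@Rintegral_itv_split_integrable h c a b)// addrC addKr.
- rewrite -ltNge => ac; rewrite opprK addrC -Rintegral_itv_split_integrable//; exact: ltW.
- by rewrite (le_trans ca ab).
- rewrite -!ltNge => ac bc; rewrite opprK addrC.
  rewrite (@Rintegral_itv_split_integrable h a b c)// ?addrK//.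
  exact: ltW.
Qed.

Lemma integral_primitive h c : measurable_fun setT h -> locally_bounded h ->
  primitive (fun x => if c <= x then \int[mu]_(y in `[c, x]) h y
                      else - \int[mu]_(y in `[x, c]) h y) h.
Proof.
move=> mh bh; split => //; apply: integral_increment => a b.
exact: locally_bounded_integrable.
Qed.

Lemma primitive_lip F h a b : primitive F h ->
  exists2 C, 0 <= C & forall x y, a <= x <= b -> a <= y <= b ->
    `|F y - F x| <= C * `|y - x|.
Proof.
move=> [mh bh Fh]; have [C C0 hC] := locally_bounded_itv a b bh; exists C => // x y.
wlog xy : x y / x <= y.
  move=> H xab yab; have [xy|/ltW yx] := leP x y; first exact: H.
  by rewrite distrC [in leRHS]distrC H.
move=> /andP[ax xb] /andP[ay yb]; rewrite Fh// [in leRHS]ger0_norm ?subr_ge0//.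
apply: normr_Rintegral_itv_le => // z /andP[xz zy]; apply: hC.
by rewrite (le_trans ax)//= (le_trans zy).
Qed.

Lemma primitive_continuous F h : primitive F h -> continuous F.
Proof.
move=> FF x; have [C C0 FC] := @primitive_lip F h (x - 1) (x + 1) FF.
apply/cvgrPdist_le => /= e e0.
have eC : 0 < e / (C + 1) by rewrite divr_gt0// ltr_wpDl.
near=> y.
have xy1 : `|x - y| <= 1.
  by near: y; apply: cvgr_dist_le => //; exact: cvg_id.
have xyC : `|x - y| <= e / (C + 1).
  by near: y; apply: cvgr_dist_le => //; exact: cvg_id.
have := FC y x; rewrite -ler_distlC xy1 => /(_ isT).
rewrite lerBlDr lerDl ler01 => /(_ isT) H.
rewrite (le_trans H)// (@le_trans _ _ (C * (e / (C + 1))))//; first exact: ler_wpM2l.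
rewrite mulrA ler_pdivrMr ?ltr_wpDl// mulrC ler_wpM2l ?ltW// ltrDl//.
Unshelve. all: by end_near. Qed.

Lemma primitive_measurable F h : primitive F h -> measurable_fun setT F.
Proof. by move=> /primitive_continuous; exact: continuous_measurable_fun. Qed.

Lemma primitive_bounded F h : primitive F h -> locally_bounded F.
Proof.
move=> FF M; have [C C0 FC] := @primitive_lip F h (- `|M|) (`|M|) FF.
exists (`|F 0| + C * `|M|) => x xM.
have := FC 0 x; rewrite oppr_le0 normr_ge0 subr0 -ler_norml.
have xM' : `|x| <= `|M| by rewrite (le_trans xM)// ler_norm.
move=> /(_ isT xM') H.
rewrite -(subrK (F 0) (F x)) (le_trans (ler_normD _ _))// addrC lerD2l (le_trans H)//.
exact: ler_wpM2l.
Qed.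

Lemma primitive_eq F G h g : F =1 G -> h =1 g -> primitive F h -> primitive G g.
Proof. by move=> /funext <- /funext <-. Qed.

Lemma primitive_cst c : primitive (fun=> c) (fun=> 0).
Proof.
split; [exact: measurable_cst|by move=> M; exists 0; rewrite normr0|].
by move=> a b ab; rewrite Rintegral_itv_cst// mul0r subrr.
Qed.

Lemma locally_boundedD h g : locally_bounded h -> locally_bounded g ->
  locally_bounded (fun x => h x + g x).
Proof.
move=> bh bg M; have [C hC] := bh M; have [D gD] := bg M; exists (C + D) => x xM.
by rewrite (le_trans (ler_normD _ _))// lerD ?hC ?gD.
Qed.

Lemma locally_boundedM h g : locally_bounded h -> locally_bounded g ->
  locally_bounded (fun x => h x * g x).
Proof.
move=> bh bg M; have [C hC] := bh M; have [D gD] := bg M; exists (C * D) => x xM.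
by rewrite normrM ler_pM ?hC ?gD.
Qed.

Lemma primitiveD F G f g : primitive F f -> primitive G g ->
  primitive (fun x => F x + G x) (fun x => f x + g x).
Proof.
move=> [mf bf Ff] [mg bg Gg]; split.
- exact: measurable_funD.
- exact: locally_boundedD.
- move=> a b ab; rewrite RintegralD//; try exact: locally_bounded_integrable.
  by rewrite -Ff// -Gg//; ring.
Qed.

Lemma primitiveZ F f c : primitive F f ->
  primitive (fun x => c * F x) (fun x => c * f x).
Proof.
move=> [mf bf Ff]; split.
- by apply: measurable_funM.
- by apply: locally_boundedM => // M; exists `|c|.
- move=> a b ab; rewrite RintegralZl//; try exact: locally_bounded_integrable.
  by rewrite -Ff// mulrBr.
Qed.

Lemma primitiveN F f : primitive F f -> primitive (fun x => - F x) (fun x => - f x).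
Proof. by move=> /(primitiveZ (-1)); apply: primitive_eq => x; rewrite mulN1r. Qed.

Lemma primitiveB F G f g : primitive F f -> primitive G g ->
  primitive (fun x => F x - G x) (fun x => f x - g x).
Proof. by move=> FF /primitiveN; exact: primitiveD. Qed.

(** Subdividing [[a, b]] into [n.+1] equal pieces bounds the total increment by
    [C * (b - a) ^+ 2 / n.+1%:R]. In the product rule this replaces the vanishing of a derivative,
    which need not exist pointwise. *)
Lemma quadratic_increments_cst (H : R -> R) (C : R) a b : a <= b ->
  (forall x y, a <= x -> x <= y -> y <= b -> `|H y - H x| <= C * (y - x) ^+ 2) ->
  H b = H a.
Proof.
move=> ab HC; apply/eqP; rewrite -subr_eq0 -normr_eq0 eq_le normr_ge0 andbT.
have step n : `|H b - H a| <= C * (b - a) ^+ 2 / n.+1%:R.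
  pose p i := a + (b - a) * (i%:R / n.+1%:R).
  have p0 : p 0%N = a by rewrite /p mul0r mulr0 addr0.
  have pn : p n.+1 = b by rewrite /p divff ?pnatr_eq0// mulr1 addrC subrK.
  have pS i : p i.+1 - p i = (b - a) / n.+1%:R.
    rewrite /p -[in LHS]natr1; field.
    by rewrite addrC natr1 pnatr_eq0.
  have ple i j : (i <= j)%N -> p i <= p j.
    move=> ij; rewrite lerD2l ler_wpM2l ?subr_ge0// ler_wpM2r ?invr_ge0// ler_nat//.
  have : `|H b - H a| <= \sum_(i < n.+1) (C * ((b - a) / n.+1%:R) ^+ 2).
    rewrite -[in H b]pn -[in H a]p0 -(telescope_sumr (fun i => H (p i))) // big_mkord.
    rewrite (le_trans (ler_norm_sum _ _ _))// ler_sum// => i _.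
    rewrite -(pS i) HC//; [by rewrite -p0 ple|exact: ple|by rewrite -pn ple].
  rewrite sumr_const card_ord => /le_trans; apply.
  rewrite -mulr_natr le_eqVlt; apply/orP; left; apply/eqP; field.
  by rewrite addrC natr1 pnatr_eq0.
have : C * (b - a) ^+ 2 / n.+1%:R @[n --> \oo] --> (0:R).
  rewrite -(mulr0 (C * (b - a) ^+ 2)); apply: cvgMr.
  exact: cvg_harmonic.
move=> /cvgr_to_ge; apply.
by near=> n; exact: step.
Unshelve. all: by end_near. Qed.

Lemma primitiveM F G f g : primitive F f -> primitive G g ->
  primitive (fun x => F x * G x) (fun x => f x * G x + F x * g x).
Proof.
move=> FF GG; have [mf bf _] := FF; have [mg bg _] := GG.
have mF := primitive_measurable FF; have mG := primitive_measurable GG.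
have bF := primitive_bounded FF; have bG := primitive_bounded GG.
set k := (fun x => f x * G x + F x * g x).
have mk : measurable_fun setT k by apply: measurable_funD; exact: measurable_funM.
have bk : locally_bounded k by apply: locally_boundedD; exact: locally_boundedM.
split => // a b ab.
have := integral_primitive a mk bk; set P := (fun x => _) => PP.
have [_ _ /(_ _ _ ab) <-] := PP.
apply/eqP; rewrite -subr_eq0; apply/eqP.
suff : F b * G b - P b = F a * G a - P a by move=> H; lra.
have [Cf Cf0 fC] := locally_bounded_itv a b bf.
have [Cg Cg0 gC] := locally_bounded_itv a b bg.
have [Lf Lf0 FL] := primitive_lip a b FF.
have [Lg Lg0 GL] := primitive_lip a b GG.
apply: (@quadratic_increments_cst (fun x => F x * G x - P x) (Cf * Lg + Lf * Cg)) => // x y ax xy yb.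
(* Freezing [G] at [x] and [F] at [y] reproduces the increment of [F * G] exactly, while the
   integrand differs from [k] by a Lipschitz increment times a bounded factor, so that its integral
   is quadratic in [y - x]. *)
have [mq bq /(_ x y xy)] := primitiveB (primitiveD (primitiveZ (G x) FF) (primitiveZ (F y) GG)) PP.
move=> E; rewrite (_ : _ - _ = G x * F y + F y * G y - P y - (G x * F x + F y * G x - P x)); last by ring.
rewrite E expr2 mulrA normr_Rintegral_itv_le// => t /andP[xt ty].
rewrite (_ : _ - _ = f t * (G x - G t) + (F y - F t) * g t); last by rewrite /k; ring.
have tab : a <= t <= b by rewrite (le_trans ax)// (le_trans ty).
have xab : a <= x <= b by rewrite ax (le_trans xy).
have yab : a <= y <= b by rewrite yb (le_trans ax).
rewrite (le_trans (ler_normD _ _))// !normrM mulrDl lerD//.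
  rewrite -mulrA ler_pM ?fC// (le_trans (GL _ _ _ _))// ler_wpM2l// distrC ger0_norm ?subr_ge0//.
  by rewrite lerD2r.
rewrite mulrAC ler_pM ?gC// (le_trans (FL _ _ _ _))// ler_wpM2l// ger0_norm ?subr_ge0//.
by rewrite lerD2l lerN2.
Qed.

Lemma C1_primitive F f : (forall x, is_derive x (1:R) F (f x)) -> continuous f ->
  primitive F f.
Proof.
move=> dF cf.
have mf : measurable_fun setT f by exact: continuous_measurable_fun.
have bf : locally_bounded f.
  move=> M; have [M0|M0] := leP 0 M; last first.
    by exists 0 => x xM; move: (le_lt_trans xM M0); rewrite normr_lt0.
  have /(@continuous_compact _ _ f) : compact `[-M, M]%classic by exact: segment_compact.
  move=> /(_ (continuous_subspaceT cf)) /compact_bounded [N [_ HN]].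
  exists (N + 1) => x xM; apply: (HN (N + 1)); first by rewrite ltrDl.
  by exists x => //=; rewrite in_itv/= -ler_norml.
split => // a b; rewrite le_eqVlt => /predU1P[<-|ab].
  by rewrite subrr set_itv1 Rintegral_set1.
have cF : continuous F.
  move=> x; apply: differentiable_continuous; apply/derivable1_diffP.
  by case: (dF x).
rewrite /Rintegral (@continuous_FTC2 _ f F a b ab)//=.
- exact: continuous_subspaceT.
- split => //.
  + by apply: cvg_at_right_filter; exact: cF.
  + by apply: cvg_at_left_filter; exact: cF.
- by move=> x _; rewrite derive1E; case: (dF x).
Qed.

Lemma expR_lin_primitive a :
  primitive (fun x => expR (a * x)) (fun x => a * expR (a * x)).
Proof.
apply: C1_primitive => x; first exact: is_derive_expR_lin.
by apply: cvgMr; exact: continuous_expR_lin.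
Qed.

(** A bridge back to pointwise derivatives, in terms of which the Wronskian is defined. *)
Lemma primitive_is_derive F f x : primitive F f -> {for x, continuous f} ->
  is_derive x (1:R) F (f x).
Proof.
move=> FF cf; have [mf bf Ff] := FF.
have xx1 : x < x + 1 by rewrite ltrDl.
have x1x : x - 1 < x by rewrite ltrBlDr ltrDl.
have := @continuous_FTC1_closed R f (x - 1) x (x + 1) xx1
   (locally_bounded_integrable _ _ mf bf) x1x cf.
rewrite /= => -[dG G'].
have : is_derive x (1:R) (fun y => \int[mu]_(t in `[(x - 1), y]) f t) (f x).
  by apply: DeriveDef; [exact: dG|rewrite -derive1E].
move=> /(is_deriveD (is_derive_cst (F (x - 1)) x (1:R))); rewrite add0r.
apply: near_eq_is_derive.
near=> y; have xy : x - 1 <= y by near: y; exact: lt_le_nbhsr.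
by rewrite !fctE -(Ff _ _ xy) subrKC.
Unshelve. all: by end_near. Qed.

Lemma primitive_expR_comp F f a : primitive F f -> continuous f ->
  primitive (fun x => expR (a * F x)) (fun x => a * f x * expR (a * F x)).
Proof.
move=> FF cf; have cF := primitive_continuous FF; apply: C1_primitive => x.
  have dF := primitive_is_derive FF (cf x).
  have -> : (fun y : R => expR (a * F y)) = expR \o (a *: F) by apply/funext.
  apply: is_derive_eq.
  by rewrite /= /GRing.scale/= mulrC.
apply: cvgM; first by apply: cvgMr; exact: cf.
apply: (@continuous_comp _ _ _ (fun y : R => a * F y) expR).
  by apply: cvgMr; exact: cF.
exact: continuous_expR.
Qed.

Lemma primitive0_cst F a b : primitive F (fun=> 0) -> F a = F b.
Proof.
move=> [_ _ F0]; have H c d : c <= d -> F d = F c.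
  move=> cd; apply/eqP; rewrite -subr_eq0 F0// Rintegral_itv_cst// mul0r//.
by have [ab|/ltW ba] := leP a b; [rewrite (H _ _ ab)|rewrite (H _ _ ba)].
Qed.

Lemma primitive_nondecreasing F f a b : primitive F f -> a <= b ->
  (forall x, a <= x <= b -> 0 <= f x) -> F a <= F b.
Proof.
move=> [_ _ Ff] ab f0; rewrite -subr_ge0 Ff//; apply: Rintegral_ge0 => x.
by rewrite /= in_itv/=; exact: f0.
Qed.

(** The weight is a pure exponential on the whole line, growing to the left: only the behaviour at
    $+\infty$ is constrained, and integrating over [[x, +oo[] reproduces the same weight at every
    [x]. *)
Definition edecay b N h :=
  measurable_fun setT h /\ forall x, `|h x| <= N * expR (- b * x).

Definition tail h x := \int[mu]_(y in `[x, +oo[) h y.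

Lemma edecay_integrable b N h x : 0 < b -> edecay b N h ->
  mu.-integrable `[x, +oo[ (EFin \o h).
Proof.
move=> b0 [mh hN]; apply: (@le_integrable _ _ _ mu `[x, +oo[ _ _
  (EFin \o (fun y => N * expR (- b * y)))) => //.
- by apply/measurable_EFinP; exact: measurable_funTS.
- by move=> y _; rewrite /= lee_fin (le_trans (hN y))// ler_norm.
- exact: integrable_expR_tailZ.
Qed.

Lemma edecay_bounded b N h : edecay b N h -> locally_bounded h.
Proof.
move=> [_ hN] M; have [C hC] := primitive_bounded (expR_lin_primitive (- b)) M.
exists (`|N| * C) => x /hC xC; rewrite (le_trans (hN x))// (le_trans (ler_norm _))//.
by rewrite normrM ler_wpM2l.
Qed.

Lemma normr_tail_le b N h x : 0 < b -> edecay b N h ->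
  `|tail h x| <= N / b * expR (- b * x).
Proof.
move=> b0 hN; rewrite /tail.
apply: (le_trans (le_normr_Rintegral _ _)) => //; first exact: edecay_integrable hN.
rewrite mulrAC -mulrA -Rintegral_expR_tail//.
rewrite -RintegralZl//; last exact: integrable_expR_tail.
apply: le_Rintegral => //.
- by apply: integrable_norm; exact: edecay_integrable hN.
- exact: integrable_expR_tailZ.
- by move=> y _; case: hN.
Qed.

Lemma tail_primitive b N h : 0 < b -> edecay b N h ->
  primitive (tail h) (fun x => - h x).
Proof.
move=> b0 hN; have bh := edecay_bounded hN; have [mh _] := hN.
split; [exact: measurable_funN|by move=> M; have [C hC] := bh M; exists C => x /hC; rewrite normrN|].
move=> a c ac; have ih : mu.-integrable `[a, c] (EFin \o h).
  exact: locally_bounded_integrable.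
have -> : \int[mu]_(x in `[a, c]) - h x = - \int[mu]_(x in `[a, c]) h x.
  rewrite -mulN1r -RintegralZl//; apply: eq_Rintegral => x _; by rewrite mulN1r.
rewrite /tail (_ : \int[mu]_(y in `[a, +oo[) h y =
  \int[mu]_(x in `[a, c]) h x + \int[mu]_(x in `[c, +oo[) h x); first by ring.
rewrite -(Rintegral_itv_obnd_cbnd (r := c)); last first.
  apply: (@integrableS _ _ _ mu `[c, +oo[) => //.
    by move=> x /=; rewrite !in_itv/= !andbT => /ltW.
  exact: edecay_integrable hN.
rewrite -(@Rintegral_itvB _ h (BLeft a) +oo%O c); last 3 first.
- exact: edecay_integrable hN.
- by rewrite bnd_simp.
- by rewrite bnd_simp.
by rewrite addrC subrK.
Qed.

Lemma tailZ b N h c x : 0 < b -> edecay b N h ->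
  tail (fun y => c * h y) x = c * tail h x.
Proof.
move=> b0 hN; rewrite /tail RintegralZl//; exact: edecay_integrable b0 hN.
Qed.

Lemma edecay_cvg0 b N F : 0 < b -> (forall x, 0 <= x -> `|F x| <= N * expR (- b * x)) ->
  F x @[x --> +oo] --> (0 : R).
Proof.
move=> b0 FN; apply/norm_cvg0P.
apply: (@squeeze_cvgr _ _ _ _ (fun=> 0) (fun x => N * expR (- b * x))).
- by near=> x; rewrite normr_ge0 FN//; near: x; exact: nbhs_pinfty_ge.
- exact: cvg_cst.
- by rewrite -(mulr0 N); apply: cvgMr; exact: cvg_expR_lin.
Unshelve. all: by end_near. Qed.

Lemma primitive_cst_cvg0 F x : primitive F (fun=> 0) -> F y @[y --> +oo] --> (0 : R) ->
  F x = 0.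
Proof.
move=> F0 Fl; have -> : F = fun=> F x by apply/funext => y; exact: primitive0_cst.
apply: (cvg_unique _ _ Fl) => //.
have -> : F = fun=> F x by apply/funext => y; exact: primitive0_cst.
exact: cvg_cst.
Qed.

(** The difference of the two sides is constant and tends to 0. This evaluates improper integrals
    from an explicit primitive vanishing at $+\infty$. *)
Lemma tail_eq b N h F x : 0 < b -> edecay b N h ->
  primitive F (fun x => - h x) -> F y @[y --> +oo] --> (0 : R) ->
  tail h x = F x.
Proof.
move=> b0 hN FF F0; apply/eqP; rewrite -subr_eq0; apply/eqP.
apply: (@primitive_cst_cvg0 (fun y => tail h y - F y)).
  by apply: primitive_eq (primitiveB (tail_primitive b0 hN) FF) => // y; rewrite subrr.
rewrite -[X in _ --> X](subr0 (0:R)); apply: cvgB => //.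
apply: (@edecay_cvg0 b (N / b)) => // y _; exact: normr_tail_le.
Qed.

End RealIntegrals.

(** * Complex-valued functions, exponential decay and the first-order solution operator *)

Section ComplexFunctions.
Context {R : realType}.
Implicit Types (z w k l c : R[i]) (f g h F G : R -> R[i]) (a b x y N : R).

Lemma ReD z w : Re (z + w) = Re z + Re w. Proof. by case: z; case: w. Qed.
Lemma ImD z w : Im (z + w) = Im z + Im w. Proof. by case: z; case: w. Qed.
Lemma ReN z : Re (- z) = - Re z. Proof. by case: z. Qed.
Lemma ImN z : Im (- z) = - Im z. Proof. by case: z. Qed.
Lemma ReM z w : Re (z * w) = Re z * Re w - Im z * Im w.
Proof. by case: z; case: w. Qed.
Lemma ImM z w : Im (z * w) = Re z * Im w + Im z * Re w.
Proof. by case: z => a b; case: w => c d /=. Qed.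
Lemma complex_eqP z w : Re z = Re w -> Im z = Im w -> z = w.
Proof. by case: z => ? ?; case: w => ? ? /= -> ->. Qed.

Lemma complex_eta z : Re z +i* Im z = z. Proof. by case: z. Qed.

Lemma normr_Re_le z : `|Re z| <= normc z.
Proof.
by case: z => a b /=; rewrite -sqrtr_sqr ler_wsqrtr// lerDl sqr_ge0.
Qed.

Lemma normr_Im_le z : `|Im z| <= normc z.
Proof.
by case: z => a b /=; rewrite -sqrtr_sqr ler_wsqrtr// lerDr sqr_ge0.
Qed.

Lemma normc_le z : normc z <= `|Re z| + `|Im z|.
Proof.
case: z => a b /=; rewrite -[leRHS]ger0_norm ?addr_ge0// -sqrtr_sqr ler_wsqrtr//.
rewrite sqrrD !real_normK ?num_real// -addrA lerD2l lerDr mulrn_wge0// mulr_ge0.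
Qed.

Lemma normc_ge0 z : 0 <= normc z.
Proof. by case: z => a b /=; exact: sqrtr_ge0. Qed.

Lemma normc_sqr z : normc z ^+ 2 = Re z ^+ 2 + Im z ^+ 2.
Proof. by case: z => a b /=; rewrite sqr_sqrtr// addr_ge0 ?sqr_ge0. Qed.

Lemma normcM z w : normc (z * w) = normc z * normc w.
Proof. exact: Normc.normcM. Qed.

Lemma normc_real x : normc x%:C = `|x|.
Proof. by rewrite /= expr0n addr0 sqrtr_sqr. Qed.

Lemma normc_i : normc ('i%C : R[i]) = 1.
Proof. by rewrite /= expr0n add0r expr1n sqrtr1. Qed.

Lemma normcB_sym z w : normc (z - w) = normc (w - z).
Proof. by rewrite -normcN opprB. Qed.

Lemma normc_eq0 z : (normc z == 0) = (z == 0).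
Proof.
apply/eqP/eqP => [/Normc.eq0_normc//|->]; exact: Normc.normc0.
Qed.

Lemma normc_conj z : normc (conjc z) = normc z.
Proof. by case: z => a b /=; rewrite sqrrN. Qed.

Lemma conjcM z w : conjc (z * w) = conjc z * conjc w.
Proof. exact: rmorphM. Qed.
Lemma conjcD z w : conjc (z + w) = conjc z + conjc w.
Proof. exact: rmorphD. Qed.
Lemma conjcN z : conjc (- z) = - conjc z.
Proof. exact: rmorphN. Qed.
Lemma conjcR x : conjc x%:C = x%:C.
Proof. exact: conjc_real. Qed.

Lemma realcM x y : (x * y)%:C = x%:C * y%:C :> R[i]. Proof. exact: rmorphM. Qed.
Lemma realcD x y : (x + y)%:C = x%:C + y%:C :> R[i]. Proof. exact: rmorphD. Qed.
Lemma realcB x y : (x - y)%:C = x%:C - y%:C :> R[i]. Proof. exact: rmorphB. Qed.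
Lemma realcN x : (- x)%:C = - x%:C :> R[i]. Proof. exact: rmorphN. Qed.
Lemma realcX x n : (x ^+ n)%:C = x%:C ^+ n :> R[i]. Proof. exact: rmorphXn. Qed.
Lemma realc_nat n : (n%:R)%:C = n%:R :> R[i]. Proof. exact: rmorph_nat. Qed.

Lemma cexpD z w : cexp (z + w) = cexp z * cexp w.
Proof.
apply: complex_eqP; rewrite /cexp ?ReM ?ImM /= ReD ImD expRD ?cosD ?sinD; ring.
Qed.

Lemma cexp0 : cexp (0 : R[i]) = 1.
Proof. by rewrite /cexp /= expR0 cos0 sin0 mulr1 mulr0. Qed.

Lemma cexpNK z : cexp (- z) * cexp z = 1.
Proof. by rewrite -cexpD addNr cexp0. Qed.

Lemma cexp_neq0 z : cexp z != 0.
Proof.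
by apply/eqP => z0; have := cexpNK z; rewrite z0 mulr0 => /esym/eqP; rewrite oner_eq0.
Qed.

Lemma normc_cexp z : normc (cexp z) = expR (Re z).
Proof.
rewrite /cexp /= !exprMn -mulrDr cos2Dsin2 mulr1 sqrtr_sqr ger0_norm// expR_ge0.
Qed.

Lemma conjc_cexp z : conjc (cexp z) = cexp (conjc z).
Proof. by case: z => a b; rewrite /cexp /= cosN sinN mulrN. Qed.

Local Arguments Normc.normc : simpl never.
Local Arguments cexp : simpl never.
Local Arguments cintegral : simpl never.

Definition cprimitive F f :=
  primitive (fun x => Re (F x)) (fun x => Re (f x)) /\
  primitive (fun x => Im (F x)) (fun x => Im (f x)).

Lemma cprimitive_eq F G f g : F =1 G -> f =1 g -> cprimitive F f -> cprimitive G g.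
Proof. by move=> /funext <- /funext <-. Qed.

Lemma cprimitiveD F G f g : cprimitive F f -> cprimitive G g ->
  cprimitive (fun x => F x + G x) (fun x => f x + g x).
Proof.
move=> [F1 F2] [G1 G2]; split.
  by apply: primitive_eq (primitiveD F1 G1) => x; rewrite ReD.
by apply: primitive_eq (primitiveD F2 G2) => x; rewrite ImD.
Qed.

Lemma cprimitiveM F G f g : cprimitive F f -> cprimitive G g ->
  cprimitive (fun x => F x * G x) (fun x => f x * G x + F x * g x).
Proof.
move=> [F1 F2] [G1 G2]; split.
  apply: primitive_eq (primitiveB (primitiveM F1 G1) (primitiveM F2 G2)) => x;
  rewrite ?ReD ?ReM//; ring.
apply: primitive_eq (primitiveD (primitiveM F1 G2) (primitiveM F2 G1)) => x;
rewrite ?ImD ?ImM//; ring.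
Qed.

Lemma cprimitive_cst c : cprimitive (fun=> c) (fun=> 0).
Proof. by split; exact: primitive_cst. Qed.

Lemma cprimitiveZ F f c : cprimitive F f ->
  cprimitive (fun x => c * F x) (fun x => c * f x).
Proof.
move=> /(cprimitiveM (cprimitive_cst c)); apply: cprimitive_eq => x//.
by rewrite mul0r add0r.
Qed.

Lemma cprimitiveN F f : cprimitive F f ->
  cprimitive (fun x => - F x) (fun x => - f x).
Proof. by move=> /(cprimitiveZ (-1)); apply: cprimitive_eq => x; rewrite mulN1r. Qed.

Lemma cprimitiveB F G f g : cprimitive F f -> cprimitive G g ->
  cprimitive (fun x => F x - G x) (fun x => f x - g x).
Proof. by move=> FF /cprimitiveN; exact: cprimitiveD. Qed.

Lemma primitive_cprimitive (F f : R -> R) : primitive F f ->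
  cprimitive (fun x => (F x)%:C) (fun x => (f x)%:C).
Proof. by move=> FF; split => //; exact: primitive_cst. Qed.

Lemma cprimitive0_cst F x y : cprimitive F (fun=> 0) -> F x = F y.
Proof.
by move=> [F1 F2]; apply: complex_eqP; [exact: (primitive0_cst _ _ F1)|exact: (primitive0_cst _ _ F2)].
Qed.

Definition clocally_bounded h :=
  locally_bounded (fun x => Re (h x)) /\ locally_bounded (fun x => Im (h x)).

Lemma locally_boundedN (h : R -> R) : locally_bounded h -> locally_bounded (fun x => - h x).
Proof. by move=> bh M; have [C hC] := bh M; exists C => x; rewrite normrN; exact: hC. Qed.

Lemma clocally_boundedM h g : clocally_bounded h -> clocally_bounded g ->
  clocally_bounded (fun x => h x * g x).
Proof.
move=> [h1 h2] [g1 g2]; split.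
  under eq_fun do rewrite ReM.
  by apply: locally_boundedD; [|apply: locally_boundedN]; exact: locally_boundedM.
by under eq_fun do rewrite ImM; apply: locally_boundedD; exact: locally_boundedM.
Qed.

Lemma cprimitive_measurable F f : cprimitive F f -> cmeasurable F.
Proof. by move=> [F1 F2]; split; [exact: primitive_measurable F1|exact: primitive_measurable F2]. Qed.

Lemma cprimitive_bounded F f : cprimitive F f -> clocally_bounded F.
Proof. by move=> [F1 F2]; split; [exact: primitive_bounded F1|exact: primitive_bounded F2]. Qed.

Lemma cmeasurableD f g : cmeasurable f -> cmeasurable g -> cmeasurable (fun x => f x + g x).
Proof.
move=> [f1 f2] [g1 g2]; split.
  by under eq_fun do rewrite ReD; exact: measurable_funD.
by under eq_fun do rewrite ImD; exact: measurable_funD.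
Qed.

Lemma cmeasurableM f g : cmeasurable f -> cmeasurable g -> cmeasurable (fun x => f x * g x).
Proof.
move=> [f1 f2] [g1 g2]; split.
  by under eq_fun do rewrite ReM; apply: measurable_funB; exact: measurable_funM.
by under eq_fun do rewrite ImM; apply: measurable_funD; exact: measurable_funM.
Qed.

Lemma cmeasurable_cst c : cmeasurable (fun=> c : R[i]).
Proof. by split; exact: measurable_cst. Qed.

Lemma cmeasurable_real (f : R -> R) : measurable_fun setT f -> cmeasurable (fun x => (f x)%:C).
Proof. by move=> mf; split => //; exact: measurable_cst. Qed.

Lemma cmeasurableN f : cmeasurable f -> cmeasurable (fun x => - f x).
Proof.
move=> mf; have := cmeasurableM (cmeasurable_cst (-1)) mf.
by under eq_fun do rewrite mulN1r.
Qed.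

Lemma is_derive_cexp_Re c x : is_derive x (1:R) (fun x => Re (cexp (c * x%:C)))
  (Re (c * cexp (c * x%:C))).
Proof.
have E y : Re (cexp (c * y%:C)) = expR (Re c * y) * cos (Im c * y).
  by rewrite /cexp /= ReM ImM /= !(mulr0, subr0, add0r, addr0).
have E' y : Im (cexp (c * y%:C)) = expR (Re c * y) * sin (Im c * y).
  by rewrite /cexp /= ReM ImM /= !(mulr0, subr0, add0r, addr0).
under eq_fun do rewrite E.
have d1 := is_derive_expR_lin (Re c) x.
have d2 : is_derive x (1:R) (fun y => cos (Im c * y)) (- (Im c * sin (Im c * x))).
  have -> : (fun y : R => cos (Im c * y)) = cos \o (Im c *: id) by apply/funext.
  apply: is_derive_eq.
  by rewrite /= /GRing.scale/= mulr1 mulNr mulrC.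
apply: (is_derive_eq (is_deriveM d1 d2)).
by rewrite ReM E E' /GRing.scale/=; ring.
Qed.

Lemma is_derive_cexp_Im c x : is_derive x (1:R) (fun x => Im (cexp (c * x%:C)))
  (Im (c * cexp (c * x%:C))).
Proof.
have E y : Re (cexp (c * y%:C)) = expR (Re c * y) * cos (Im c * y).
  by rewrite /cexp /= ReM ImM /= !(mulr0, subr0, add0r, addr0).
have E' y : Im (cexp (c * y%:C)) = expR (Re c * y) * sin (Im c * y).
  by rewrite /cexp /= ReM ImM /= !(mulr0, subr0, add0r, addr0).
under eq_fun do rewrite E'.
have d1 := is_derive_expR_lin (Re c) x.
have d2 : is_derive x (1:R) (fun y => sin (Im c * y)) (Im c * cos (Im c * x)).
  have -> : (fun y : R => sin (Im c * y)) = sin \o (Im c *: id) by apply/funext.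
  apply: is_derive_eq.
  by rewrite /= /GRing.scale/= mulr1 mulrC.
apply: (is_derive_eq (is_deriveM d1 d2)).
by rewrite ImM E E' /GRing.scale/=; ring.
Qed.

Lemma derivable_continuous_fun (f : R -> R) (df : R -> R) :
  (forall x, is_derive x (1:R) f (df x)) -> continuous f.
Proof.
move=> d x; apply: differentiable_continuous; apply/derivable1_diffP.
by case: (d x).
Qed.

Lemma cprimitive_cexp c : cprimitive (fun x => cexp (c * x%:C)) (fun x => c * cexp (c * x%:C)).
Proof.
have cR := derivable_continuous_fun (is_derive_cexp_Re c).
have cI := derivable_continuous_fun (is_derive_cexp_Im c).
split; (apply: C1_primitive; [exact: is_derive_cexp_Re || exact: is_derive_cexp_Im|]).
  under eq_fun do rewrite ReM.
  by move=> x; apply: cvgB; apply: cvgMr; [exact: cR|exact: cI].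
under eq_fun do rewrite ImM.
by move=> x; apply: cvgD; apply: cvgMr; [exact: cI|exact: cR].
Qed.

Lemma integrableM_cst (D : set R) (u : R) (f : R -> R) : measurable D ->
  mu.-integrable D (EFin \o f) -> mu.-integrable D (EFin \o (fun y => u * f y)).
Proof.
move=> mD fi; rewrite (_ : EFin \o _ = (fun y => u%:E * (f y)%:E)%E); last by apply/funext.
exact: integrableZl.
Qed.

Lemma integrableD_EFin (D : set R) (f g : R -> R) : measurable D ->
  mu.-integrable D (EFin \o f) -> mu.-integrable D (EFin \o g) ->
  mu.-integrable D (EFin \o (fun y => f y + g y)).
Proof.
move=> mD fi gi; rewrite (_ : EFin \o _ = (fun y => (f y)%:E + (g y)%:E)%E); last by apply/funext.
exact: integrableD.
Qed.

Lemma integrableB_EFin (D : set R) (f g : R -> R) : measurable D ->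
  mu.-integrable D (EFin \o f) -> mu.-integrable D (EFin \o g) ->
  mu.-integrable D (EFin \o (fun y => f y - g y)).
Proof.
move=> mD fi gi; rewrite (_ : EFin \o _ = (fun y => (f y)%:E - (g y)%:E)%E); last by apply/funext.
exact: integrableB.
Qed.

Lemma cintegrableD (D : set R) f g : measurable D -> cintegrable D f -> cintegrable D g ->
  cintegrable D (fun x => f x + g x).
Proof.
move=> mD [f1 f2] [g1 g2]; split.
  by under eq_fun do rewrite ReD; exact: integrableD_EFin.
by under eq_fun do rewrite ImD; exact: integrableD_EFin.
Qed.

Lemma cintegrableZ (D : set R) c f : measurable D -> cintegrable D f ->
  cintegrable D (fun x => c * f x).
Proof.
move=> mD [f1 f2]; split.
  by under eq_fun do rewrite ReM; apply: integrableB_EFin => //; exact: integrableM_cst.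
by under eq_fun do rewrite ImM; apply: integrableD_EFin => //; exact: integrableM_cst.
Qed.

Lemma cintegralD (D : set R) f g : measurable D -> cintegrable D f -> cintegrable D g ->
  cintegral D (fun x => f x + g x) = cintegral D f + cintegral D g.
Proof.
move=> mD [f1 f2] [g1 g2]; apply: complex_eqP; rewrite ?ReD ?ImD /=.
  by rewrite -RintegralD//; apply: eq_Rintegral => y _; rewrite ReD.
by rewrite -RintegralD//; apply: eq_Rintegral => y _; rewrite ImD.
Qed.

Lemma cintegralZ (D : set R) c f : measurable D -> cintegrable D f ->
  cintegral D (fun x => c * f x) = c * cintegral D f.
Proof.
move=> mD [f1 f2]; apply: complex_eqP; rewrite ?ReM ?ImM /=.
  rewrite -!RintegralZl// -RintegralB//; try exact: integrableM_cst.
  by apply: eq_Rintegral => y _; rewrite ReM.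
rewrite -!RintegralZl// -RintegralD//; try exact: integrableM_cst.
by apply: eq_Rintegral => y _; rewrite ImM.
Qed.

Lemma cintegrableB (D : set R) f g : measurable D -> cintegrable D f -> cintegrable D g ->
  cintegrable D (fun x => f x - g x).
Proof.
move=> mD fi gi; have := cintegrableD mD fi (cintegrableZ (-1) mD gi).
by under eq_fun do rewrite mulN1r.
Qed.

Lemma cintegralB (D : set R) f g : measurable D -> cintegrable D f -> cintegrable D g ->
  cintegral D (fun x => f x - g x) = cintegral D f - cintegral D g.
Proof.
move=> mD fi gi; have := cintegralD mD fi (cintegrableZ (-1) mD gi).
rewrite (cintegralZ _ mD gi) mulN1r => <-; congr cintegral.
by apply/funext => x; rewrite mulN1r.
Qed.

Lemma ae_mono (P Q : R -> Prop) : (forall x, P x -> Q x) ->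
  {ae @lebesgue_measure R, forall x, P x} -> {ae @lebesgue_measure R, forall x, Q x}.
Proof. by move=> PQ; apply: filterS => //; exact: (ae_filter_ringOfSetsType mu). Qed.

Lemma ae_mono2 (P Q S : R -> Prop) : (forall x, P x -> Q x -> S x) ->
  {ae @lebesgue_measure R, forall x, P x} -> {ae @lebesgue_measure R, forall x, Q x} ->
  {ae @lebesgue_measure R, forall x, S x}.
Proof. by move=> PQ; apply: filterS2 => //; exact: (ae_filter_ringOfSetsType mu). Qed.

Lemma integrable_ae_eq (D : set R) (f g : R -> R) : measurable D ->
  measurable_fun setT g -> {ae @lebesgue_measure R, forall x, f x = g x} ->
  mu.-integrable D (EFin \o f) -> mu.-integrable D (EFin \o g).
Proof.
move=> mD mg fg /integrableP [mf fi]; apply/integrableP; split.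
  by apply/measurable_EFinP; exact: measurable_funTS.
suff -> : (\int[mu]_(x in D) `|(EFin \o g) x| = \int[mu]_(x in D) `|(EFin \o f) x|)%E by [].
apply: ae_eq_integral => //.
- by apply: measurableT_comp => //; apply/measurable_EFinP; exact: measurable_funTS.
- by apply: measurableT_comp.
- by apply: ae_mono fg => x /= -> _.
Qed.

Lemma Rintegral_ae_eq (D : set R) (f g : R -> R) : measurable D ->
  measurable_fun setT f -> measurable_fun setT g ->
  {ae @lebesgue_measure R, forall x, f x = g x} ->
  \int[mu]_(x in D) f x = \int[mu]_(x in D) g x.
Proof.
move=> mD mf mg fg; congr fine; apply: ae_eq_integral => //.
- by apply/measurable_EFinP; exact: measurable_funTS.
- by apply/measurable_EFinP; exact: measurable_funTS.
- by apply: ae_mono fg => x /= -> _.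
Qed.

Lemma cintegrable_ae_eq (D : set R) f g : measurable D -> cmeasurable g ->
  {ae @lebesgue_measure R, forall x, f x = g x} -> cintegrable D f -> cintegrable D g.
Proof.
move=> mD [g1 g2] fg [f1 f2]; split.
  by apply: integrable_ae_eq f1 => //; apply: ae_mono fg => x ->.
by apply: integrable_ae_eq f2 => //; apply: ae_mono fg => x ->.
Qed.

Lemma cintegral_ae_eq (D : set R) f g : measurable D -> cmeasurable f -> cmeasurable g ->
  {ae @lebesgue_measure R, forall x, f x = g x} -> cintegral D f = cintegral D g.
Proof.
move=> mD [f1 f2] [g1 g2] fg; apply: complex_eqP => /=.
  by apply: Rintegral_ae_eq => //; apply: ae_mono fg => x ->.
by apply: Rintegral_ae_eq => //; apply: ae_mono fg => x ->.
Qed.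

Definition cdecay b N h := cmeasurable h /\ forall x, normc (h x) <= N * expR (- b * x).

Definition ctail h x := cintegral `[x, +oo[ h.
Local Arguments ctail : simpl never.

Lemma cdecay_Re b N h : cdecay b N h -> edecay b N (fun x => Re (h x)).
Proof. by move=> [[m1 m2] hN]; split => // x; rewrite (le_trans (normr_Re_le _)). Qed.

Lemma cdecay_Im b N h : cdecay b N h -> edecay b N (fun x => Im (h x)).
Proof. by move=> [[m1 m2] hN]; split => // x; rewrite (le_trans (normr_Im_le _)). Qed.

Lemma ctail_primitive b N h : 0 < b -> cdecay b N h ->
  cprimitive (ctail h) (fun x => - h x).
Proof.
move=> b0 hN; split.
  by apply: primitive_eq (tail_primitive b0 (cdecay_Re hN)) => // x; rewrite ReN.
by apply: primitive_eq (tail_primitive b0 (cdecay_Im hN)) => // x; rewrite ImN.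
Qed.

(** The factor 2 is the price of integrating real and imaginary parts separately. *)
Lemma cdecay_ctail b N h : 0 < b -> cdecay b N h -> cdecay b (2 * N / b) (ctail h).
Proof.
move=> b0 hN; split; first exact: cprimitive_measurable (ctail_primitive b0 hN).
move=> x; apply: (le_trans (normc_le _)).
rewrite (_ : _ * _ = N / b * expR (- b * x) + N / b * expR (- b * x)); last by ring.
apply: lerD.
  exact: (normr_tail_le x b0 (cdecay_Re hN)).
exact: (normr_tail_le x b0 (cdecay_Im hN)).
Qed.

Lemma cdecay_integrable b N h x : 0 < b -> cdecay b N h -> cintegrable `[x, +oo[ h.
Proof.
by move=> b0 hN; split; [exact: edecay_integrable (cdecay_Re hN)|exact: edecay_integrable (cdecay_Im hN)].
Qed.

Lemma ctailD b N M h g : 0 < b -> cdecay b N h -> cdecay b M g ->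
  ctail (fun y => h y + g y) = fun x => ctail h x + ctail g x.
Proof.
move=> b0 hN gM; apply/funext => x; apply: cintegralD => //.
  exact: cdecay_integrable hN.
exact: cdecay_integrable gM.
Qed.

Lemma ctailZ b N h c : 0 < b -> cdecay b N h ->
  ctail (fun y => c * h y) = fun x => c * ctail h x.
Proof.
by move=> b0 hN; apply/funext => x; apply: cintegralZ => //; exact: cdecay_integrable hN.
Qed.

Lemma exp_decay_cvg0 b N F : 0 < b -> (forall x, 0 <= x -> normc (F x) <= N * expR (- b * x)) ->
  Re (F y) @[y --> +oo] --> (0:R) /\ Im (F y) @[y --> +oo] --> (0:R).
Proof.
move=> b0 FN; split; apply: (@edecay_cvg0 _ b N) => // x x0.
  exact: le_trans (normr_Re_le _) (FN x x0).
exact: le_trans (normr_Im_le _) (FN x x0).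
Qed.

Lemma ctail_eq b N a M h F x : 0 < b -> cdecay b N h -> 0 < a ->
  cprimitive F (fun x => - h x) ->
  (forall x, 0 <= x -> normc (F x) <= M * expR (- a * x)) ->
  ctail h x = F x.
Proof.
move=> b0 hN a0 [F1 F2] /(exp_decay_cvg0 a0)[c1 c2]; apply: complex_eqP.
  apply: (@tail_eq R b N (fun x => Re (h x)) (fun x => Re (F x)) x b0 (cdecay_Re hN)) => //.
  by apply: primitive_eq F1 => // y; rewrite ReN.
apply: (@tail_eq R b N (fun x => Im (h x)) (fun x => Im (F x)) x b0 (cdecay_Im hN)) => //.
by apply: primitive_eq F2 => // y; rewrite ImN.
Qed.

Lemma ctail_conj b N h : 0 < b -> cdecay b N h ->
  ctail (fun y => conjc (h y)) = fun x => conjc (ctail h x).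
Proof.
move=> b0 hN; apply/funext => x; apply: complex_eqP.
  have -> : Re (conjc (ctail h x)) = Re (ctail h x) by case: (ctail h x).
  by apply: eq_Rintegral => y _; case: (h y).
have -> : Im (conjc (ctail h x)) = - Im (ctail h x) by case: (ctail h x).
rewrite -mulN1r -[RHS](@tailZ R b N (fun y => Im (h y)) (-1) x b0 (cdecay_Im hN)).
by apply: eq_Rintegral => y _; case: (h y) => u v /=; rewrite mulN1r.
Qed.

Lemma cdecayD b N M h g : cdecay b N h -> cdecay b M g ->
  cdecay b (N + M) (fun x => h x + g x).
Proof.
move=> [mh hN] [mg gM]; split; first exact: cmeasurableD.
by move=> x; rewrite (le_trans (le_normcD _ _))// mulrDl lerD.
Qed.

Lemma cdecayM b C N h g : cmeasurable g -> (forall x, normc (g x) <= C) -> cdecay b N h ->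
  cdecay b (C * N) (fun x => g x * h x).
Proof.
move=> mg gC [mh hN]; split; first exact: cmeasurableM.
by move=> x; rewrite normcM -mulrA ler_pM ?normc_ge0.
Qed.

Lemma cdecayZ b c N h : cdecay b N h -> cdecay b (normc c * N) (fun x => c * h x).
Proof. by move=> hN; apply: cdecayM => //; exact: cmeasurable_cst. Qed.

Lemma cdecayN b N h : cdecay b N h -> cdecay b N (fun x => - h x).
Proof.
move=> [mh hN]; split; first exact: cmeasurableN.
by move=> x; rewrite normcN.
Qed.

Lemma cdecayB b N M h g : cdecay b N h -> cdecay b M g ->
  cdecay b (N + M) (fun x => h x - g x).
Proof. by move=> hN /cdecayN; exact: cdecayD. Qed.

Lemma cdecay_le b N M h : N <= M -> cdecay b N h -> cdecay b M h.
Proof.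
move=> NM [mh hN]; split=> // x; rewrite (le_trans (hN x))// ler_wpM2r// expR_ge0.
Qed.

Lemma cdecay_ge0 b N h : cdecay b N h -> 0 <= N.
Proof.
move=> [_ /(_ 0)]; rewrite mulr0 expR0 mulr1; exact: (le_trans (normc_ge0 _)).
Qed.

Lemma cdecay_eq b N h g : h =1 g -> cdecay b N h -> cdecay b N g.
Proof. by move=> /funext ->. Qed.

Lemma cdecay_cvg0_Re b N h : 0 < b -> cdecay b N h -> Re (h y) @[y --> +oo] --> (0:R).
Proof.
move=> b0 /cdecay_Re [_ hN]; exact: (@edecay_cvg0 _ b N).
Qed.

Lemma cdecay_cvg0_Im b N h : 0 < b -> cdecay b N h -> Im (h y) @[y --> +oo] --> (0:R).
Proof.
move=> b0 /cdecay_Im [_ hN]; exact: (@edecay_cvg0 _ b N).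
Qed.

(* [exp (- c x) * v x] is constant and tends to 0 at +oo. *)
Lemma cprimitive_exp_decay0 c b N v : 0 < b + Re c -> cdecay b N v ->
  cprimitive v (fun x => c * v x) -> forall x, v x = 0.
Proof.
move=> bc vN Pv x.
pose e y := cexp (- c * y%:C).
have Pe : cprimitive e (fun y => - c * e y) by exact: cprimitive_cexp.
have P0 : cprimitive (fun y => e y * v y) (fun=> 0).
  by apply: cprimitive_eq (cprimitiveM Pe Pv) => // y; ring.
have dec : cdecay (b + Re c) N (fun y => e y * v y).
  case: vN => mv vN; split; first exact: cmeasurableM (cprimitive_measurable Pe) mv.
  move=> y; rewrite normcM normc_cexp ReM /= mulr0 subr0 ReN.
  rewrite mulrC (le_trans (ler_wpM2r (expR_ge0 _) (vN y)))// -mulrA -expRD.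
  by rewrite opprD mulrDl.
have e0 : e x * v x = 0.
  apply: complex_eqP.
    apply: (@primitive_cst_cvg0 _ (fun y => Re (e y * v y)) x); first by case: P0.
    exact: cdecay_cvg0_Re dec.
  apply: (@primitive_cst_cvg0 _ (fun y => Im (e y * v y)) x); first by case: P0.
  exact: cdecay_cvg0_Im dec.
by move/eqP: e0; rewrite mulf_eq0 (negbTE (cexp_neq0 _)) => /eqP.
Qed.

(* The decaying solution [v] of [v' = - 2 i k v - h]. *)
Definition Jop k h x :=
  cexp (- (2 * 'i%C * k) * x%:C) * ctail (fun y => cexp (2 * 'i%C * k * y%:C) * h y) x.

Local Arguments Jop : simpl never.

Lemma Re_2ik k : Re (2 * 'i%C * k) = - (2 * Im k).
Proof. by case: k => u v; rewrite !(ReM, ImM) /=; ring. Qed.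

Lemma cdecay_cexp_mul k b N h : cdecay b N h ->
  cdecay (b + 2 * Im k) N (fun y => cexp (2 * 'i%C * k * y%:C) * h y).
Proof.
move=> [mh hN]; split; first exact: cmeasurableM (cprimitive_measurable (cprimitive_cexp _)) mh.
move=> x; rewrite normcM normc_cexp [Re (_ * x%:C)]ReM Re_2ik /= mulr0 subr0.
rewrite mulrC (le_trans (ler_wpM2r (expR_ge0 _) (hN x)))// -mulrA -expRD.
by rewrite opprD [in leRHS]mulrDl.
Qed.

(** The rate gains [2 * Im k] inside the tail and the prefactor takes it back. Replacing
    [b + 2 * Im k] by [b] in the denominator makes the bound uniform over the closed upper
    half-plane, [k = 0] included. *)
Lemma cdecay_Jop k b N h : 0 < b -> 0 <= Im k -> cdecay b N h ->
  cdecay b (2 * N / b) (Jop k h).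
Proof.
move=> b0 k0 hN; have N0 := cdecay_ge0 hN.
have bk : 0 < b + 2 * Im k by rewrite ltr_wpDr// mulr_ge0.
have [mt tN] := cdecay_ctail bk (cdecay_cexp_mul k hN).
split; first exact: cmeasurableM (cprimitive_measurable (cprimitive_cexp _)) mt.
move=> x; rewrite normcM normc_cexp [Re (_ * x%:C)]ReM ReN Re_2ik /= mulr0 subr0 opprK.
apply: (le_trans (ler_wpM2l (expR_ge0 _) (tN x))); rewrite mulrCA -expRD.
rewrite (_ : 2 * Im k * x + - (b + 2 * Im k) * x = - b * x); last by ring.
rewrite ler_wpM2r ?expR_ge0// ler_wpM2l ?mulr_ge0// lef_pV2 ?posrE// lerDl mulr_ge0//.
Qed.

Lemma Jop_primitive k b N h : 0 < b -> 0 <= Im k -> cdecay b N h ->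
  cprimitive (Jop k h) (fun x => - (2 * 'i%C * k) * Jop k h x - h x).
Proof.
move=> b0 k0 hN.
have bk : 0 < b + 2 * Im k by rewrite ltr_wpDr// mulr_ge0.
have := cprimitiveM (cprimitive_cexp (- (2 * 'i%C * k)))
  (ctail_primitive bk (cdecay_cexp_mul k hN)).
apply: cprimitive_eq => // x.
rewrite /Jop mulrA; congr (_ + _).
rewrite mulrN mulNr; have := cexpNK (2 * 'i%C * k * x%:C).
by set e1 := cexp _; set e2 := cexp _; move=> E; rewrite mulrA E mul1r.
Qed.

Lemma JopD k b N M h g : 0 < b -> 0 <= Im k -> cdecay b N h -> cdecay b M g ->
  Jop k (fun x => h x + g x) = fun x => Jop k h x + Jop k g x.
Proof.
move=> b0 k0 hN gM.
have bk : 0 < b + 2 * Im k by rewrite ltr_wpDr// mulr_ge0.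
apply/funext => x; rewrite /Jop -mulrDr; congr (_ * _).
rewrite -(congr1 (fun f => f x) (ctailD bk (cdecay_cexp_mul k hN) (cdecay_cexp_mul k gM))).
by congr (ctail _ x); apply/funext => y; rewrite mulrDr.
Qed.

Lemma JopZ k b N c h : 0 < b -> 0 <= Im k -> cdecay b N h ->
  Jop k (fun x => c * h x) = fun x => c * Jop k h x.
Proof.
move=> b0 k0 hN.
have bk : 0 < b + 2 * Im k by rewrite ltr_wpDr// mulr_ge0.
apply/funext => x; rewrite /Jop mulrCA; congr (_ * _).
rewrite -(congr1 (fun f => f x) (ctailZ c bk (cdecay_cexp_mul k hN))).
by congr (ctail _ x); apply/funext => y; rewrite mulrCA.
Qed.

(* Both sides decay and solve the same first-order linear equation. *)
Lemma Jop_resolvent k l b N h : 0 < b -> 0 <= Im k -> 0 <= Im l -> cdecay b N h ->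
  forall x, Jop l h x - Jop k h x = 2 * 'i%C * (l - k) * Jop l (Jop k h) x.
Proof.
move=> b0 k0 l0 hN x; apply/eqP; rewrite -subr_eq0; apply/eqP.
have Jk := cdecay_Jop b0 k0 hN; have Jl := cdecay_Jop b0 l0 hN.
have Jlk := cdecay_Jop b0 l0 Jk.
have dv := cdecayB (cdecayB Jl Jk) (cdecayZ (2 * 'i%C * (l - k)) Jlk).
apply: (cprimitive_exp_decay0 (c := - (2 * 'i%C * l)) _ dv).
  by rewrite ReN Re_2ik opprK ltr_wpDr// mulr_ge0.
have := cprimitiveB (cprimitiveB (Jop_primitive b0 l0 hN) (Jop_primitive b0 k0 hN))
  (cprimitiveZ (2 * 'i%C * (l - k)) (Jop_primitive b0 l0 Jk)).
by apply: cprimitive_eq => // y; ring.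
Qed.

(** [- conjc k] is the mirror image of [k] in the imaginary axis; on that axis the operator
    therefore maps real functions to real functions. *)
Lemma Jop_conj k b N h : 0 < b -> 0 <= Im k -> cdecay b N h ->
  Jop (- conjc k) (fun y => conjc (h y)) = fun x => conjc (Jop k h x).
Proof.
move=> b0 k0 hN.
have bk : 0 < b + 2 * Im k by rewrite ltr_wpDr// mulr_ge0.
have E y (e : R[i]) : e = conjc (2 * 'i%C * k) -> cexp (e * y%:C) = conjc (cexp (2 * 'i%C * k * y%:C)).
  by move=> ->; rewrite conjc_cexp [in RHS]conjcM conjcR.
have e1 : 2 * 'i%C * - conjc k = conjc (2 * 'i%C * k).
  by case: k {k0 bk E} => u v; apply: complex_eqP; rewrite !(ReM, ImM, ReN, ImN)/=; ring.
apply/funext => x; rewrite /Jop conjcM.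
rewrite -(congr1 (fun f => f x) (ctail_conj bk (cdecay_cexp_mul k hN))); congr (_ * _).
  by rewrite conjc_cexp [in RHS]conjcM conjcR conjcN e1.
by congr (ctail _ x); apply/funext => y; rewrite conjcM (E y _ e1).
Qed.

End ComplexFunctions.

Section NormalSeries.
Context {R : realType}.
Implicit Types (t s : nat -> R).

Lemma normal_series_cvg t s : (forall n, `|t n| <= s n) -> cvgn (series s) -> cvgn (series t).
Proof.
move=> ts cs; apply: normed_cvg.
by apply: (@series_le_cvg _ (fun n => `|t n|) s) => // n; exact: le_trans (normr_ge0 _) (ts n).
Qed.

Lemma normal_series_tail t s n : (forall n, `|t n| <= s n) -> cvgn (series s) ->
  `|limn (series t) - series t n| <= limn (series s) - series s n.
Proof.
move=> ts cs; have ct := normal_series_cvg ts cs.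
apply: (@ler_cvg_to nat \oo _ R (fun m => `|series t m - series t n|) (fun m => series s m - series s n)).
- by apply: cvg_norm; apply: cvgB => //; exact: cvg_cst.
- by apply: cvgB => //; exact: cvg_cst.
near=> m; have nm : (n <= m)%N by near: m; exact: nbhs_infty_ge.
rewrite !sub_series nm; apply: (le_trans (ler_norm_sum _ _ _)); exact: ler_sum.
Unshelve. all: by end_near. Qed.

Lemma geometric_half_tail (a : R) n : limn (series (geometric a 2^-1)) -
  series (geometric a 2^-1) n = 2 * a * (2^-1) ^+ n.
Proof.
have h1 : `|2^-1 : R| < 1 by rewrite ger0_norm ?invr_ge0// invf_lt1 ?ltr1n.
rewrite (cvg_lim _ (@cvg_geometric_series R a _ h1))//.
rewrite geometric_seriesE /=; last by rewrite lt_eqF// invf_lt1 ?ltr1n.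
move: (_ ^+ n) => e; by field.
Qed.

End NormalSeries.

(** * Fixed points of contractions in a weighted space *)

Section Contraction.
Context {R : realType}.
Implicit Types (f g h w : R -> R[i]) (a b c x y N M : R).
Local Arguments Normc.normc : simpl never.

Lemma cvg_half_pow c : c * (2^-1) ^+ n @[n --> \oo] --> (0:R).
Proof.
rewrite -(mulr0 c); apply: cvgMr; apply: cvg_expr.
by rewrite ger0_norm ?invr_ge0// invf_lt1 ?ltr1n.
Qed.

Lemma le0_half_pow a c : (forall n : nat, a <= c * (2^-1) ^+ n) -> a <= 0.
Proof.
move=> ac; apply: (cvgr_to_ge (cvg_half_pow c)).
by near=> n; exact: ac.
Unshelve. all: by end_near. Qed.

(** Additivity is stated for decaying functions, on which the integrals defining [K] converge. *)
Definition half_contraction b (K : (R -> R[i]) -> R -> R[i]) :=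
  (forall N h, cdecay b N h -> cdecay b (N / 2) (K h)) /\
  (forall N M h g, cdecay b N h -> cdecay b M g ->
     K (fun x => h x + g x) = fun x => K h x + K g x).

(** Feeding the bound back into the equation halves the excess over [2 * N] each time, so the a
    priori constant [M] disappears. With [N = 0] this is uniqueness of the fixed point. *)
Lemma half_contraction_bound b K N M g w : half_contraction b K ->
  cdecay b N g -> cdecay b M w -> (forall x, w x = g x + K w x) ->
  cdecay b (2 * N) w.
Proof.
move=> [K1 K2] gN wM wE; have [mw _] := wM; split => // x.
have H n : cdecay b (2 * N + M * (2^-1) ^+ n) w.
  elim: n => [|n IH].
    by rewrite expr0 mulr1; apply: cdecay_le wM; rewrite lerDr mulr_ge0// (cdecay_ge0 gN).
  have := cdecayD gN (K1 _ _ IH); rewrite (_ : N + _ = 2 * N + M * 2^-1 ^+ n.+1).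
    by apply: cdecay_eq => y; rewrite [RHS]wE.
  by rewrite exprS; lra.
rewrite -subr_le0; apply: (le0_half_pow (c := M * expR (- b * x))) => n.
have [_ /(_ x)] := H n; rewrite mulrDl; lra.
Qed.

Lemma half_contraction_fixpoint b K N g : half_contraction b K ->
  cdecay b N g -> exists2 w, cdecay b (2 * N) w & forall x, w x = g x + K w x.
Proof.
move=> HK gN; have [K1 K2] := HK; have N0 := cdecay_ge0 gN.
pose t n := iter n K g.
have tN n : cdecay b (N * (2^-1) ^+ n) (t n).
  elim: n => [|n IH]; first by rewrite expr0 mulr1.
  by rewrite exprSr mulrA; exact: K1.
pose s n x := \sum_(i < n) t i x.
have sS n x : s n.+1 x = s n x + t n x by rewrite /s big_ord_recr.
have s0 : s 0%N = fun=> 0 by apply/funext => x; rewrite /s big_ord0.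
have sN n : cdecay b (\sum_(i < n) N * (2^-1) ^+ i) (s n).
  elim: n => [|n IH].
    rewrite big_ord0 s0; split; first exact: cmeasurable_cst.
    by move=> x; rewrite Normc.normc0 mul0r.
  rewrite big_ord_recr; apply: cdecay_eq (cdecayD IH (tN n)) => x.
  by rewrite sS.
have sK n : s n.+1 = fun x => g x + K (s n) x.
  elim: n => [|n IH].
    have K0 : cdecay b 0 (K (s 0%N)).
      by rewrite -(mul0r (2^-1 : R)); apply: K1; have := sN 0%N; rewrite big_ord0.
    apply/funext => x; rewrite sS {1}s0 add0r.
    case: K0 => _ /(_ x); rewrite mul0r => H.
    have /eqP -> : K (s 0%N) x == 0.
      by rewrite -normc_eq0 eq_le H normc_ge0.
    by rewrite addr0.
  apply/funext => x; rewrite sS [in LHS]IH.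
  have -> : s n.+1 = fun y => s n y + t n y by apply/funext => y; exact: sS.
  by rewrite (K2 _ _ _ _ (sN n) (tN n)) addrA.
have hlt : `|2^-1 : R| < 1 by rewrite ger0_norm ?invr_ge0// invf_lt1 ?ltr1n.
(* [P] stands for the real or the imaginary part: the Neumann series is summed as two dominated real
   series. *)
have comp (P : R[i] -> R) : (forall z1 z2, P (z1 + z2) = P z1 + P z2) -> P 0 = 0 ->
    (forall z, `|P z| <= normc z) ->
    exists v : R -> R, forall x, (fun n => P (s n x)) @ \oo --> v x /\
      forall n, `|v x - P (s n x)| <= 2 * N * (2^-1) ^+ n * expR (- b * x).
  move=> PD P0 Pn; exists (fun x => limn (series (fun n => P (t n x)))) => x.
  have ts n : `|P (t n x)| <= geometric (N * expR (- b * x)) 2^-1 n.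
    by rewrite (le_trans (Pn _))// (le_trans ((tN n).2 x))//= mulrAC.
  have E n : P (s n x) = series (fun n => P (t n x)) n.
    elim: n => [|n IH]; first by rewrite s0 P0 /series/= big_geq.
    by rewrite sS PD IH /series/= big_nat_recr.
  have cg := @is_cvg_geometric_series R (N * expR (- b * x)) _ hlt.
  under eq_fun do rewrite E.
  split; first exact: normal_series_cvg ts cg.
  move=> n; rewrite E (le_trans (normal_series_tail n ts cg))// geometric_half_tail.
  by rewrite le_eqVlt; apply/orP; left; apply/eqP; ring.
have [u uP] := comp (@Re R) (@ReD R) erefl (@normr_Re_le R).
have [v vP] := comp (@Im R) (@ImD R) erefl (@normr_Im_le R).
pose w x := u x +i* v x.
have mw : cmeasurable w.
  split; apply: (@measurable_fun_cvg _ _ _ setT).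
  - by move=> n; case: (sN n) => -[+ _] _; exact.
  - by move=> x _; case: (uP x).
  - by move=> n; case: (sN n) => -[_ +] _; exact.
  - by move=> x _; case: (vP x).
have ws n : cdecay b (4 * N * (2^-1) ^+ n) (fun x => w x - s n x).
  split; first by apply: cmeasurableD => //; apply: cmeasurableN; case: (sN n).
  move=> x; rewrite (le_trans (normc_le _))// ReD ImD ReN ImN.
  have [_ /(_ n) h1] := uP x; have [_ /(_ n) h2] := vP x.
  rewrite (le_trans (lerD h1 h2))// le_eqVlt; apply/orP; left; apply/eqP; ring.
have wN : cdecay b (4 * N) w.
  by have := ws 0%N; rewrite expr0 mulr1; apply: cdecay_eq => x; rewrite s0 subr0.
have wE x : w x = g x + K w x.
  apply/eqP; rewrite -subr_eq0 -normc_eq0 eq_le normc_ge0 andbT.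
  (* As [s n.+1 = g + K (s n)], the defect of [w] in the equation is [(w - s n.+1) - K (w - s n)],
     and both differences are geometrically small. *)
  apply: (le0_half_pow (c := 4 * N * expR (- b * x))) => n.
  have Kw : K w x = K (s n) x + K (fun x => w x - s n x) x.
    rewrite -(congr1 (fun f => f x) (K2 _ _ _ _ (sN n) (ws n))); congr (K _ x).
    by apply/funext => y; rewrite addrC subrK.
  rewrite Kw addrA -[g x + _]/((fun x => g x + K (s n) x) x) -sK opprD addrA.
  rewrite (le_trans (le_normcD _ _))// normcN.
  have [_ /(_ x) h1] := ws n.+1; have [_ /(_ x) h2] := K1 _ _ (ws n).
  rewrite (le_trans (lerD h1 h2))// exprS le_eqVlt; apply/orP; left; apply/eqP; by field.
by exists w => //; exact: half_contraction_bound gN wN wE.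
Qed.

End Contraction.

(** * Jost solutions of a modulated Schroedinger operator *)

Section Modulated.
Context {R : realType}.
Implicit Types (k l c z : R[i]) (f g h w : R -> R[i]) (x y N M : R).
Local Arguments Normc.normc : simpl never.
Local Arguments cexp : simpl never.
Local Arguments ctail : simpl never.
Local Arguments Jop : simpl never.

(* [exp Ph] conjugates [- d^2/dx^2 + V] into an operator whose potential [S] is
   of order [d ^+ 2], up to a drift term [Ph1] of order [d]. *)
Record modulated (b d : R) (V Ph Ph1 S : R -> R) : Prop := Modulated {
  mod_b : 0 < b;
  mod_d : 0 <= d;
  mod_d4 : d <= 4^-1;
  mod_db : d <= b ^+ 2 / 96;
  mod_Ph : primitive Ph Ph1;
  mod_Ph1 : primitive Ph1 (fun x => V x - S x - Ph1 x ^+ 2);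
  mod_mS : measurable_fun setT S;
  mod_Phd : forall x, `|Ph x| <= d ^+ 2 * expR (- b * `|x|);
  mod_Ph1d : forall x, `|Ph1 x| <= d * expR (- b * `|x|);
  mod_Sd : forall x, `|S x| <= d ^+ 2 * expR (- b * `|x|) }.

Variables (b d : R) (V Ph Ph1 S : R -> R).
Hypothesis HM : modulated b d V Ph Ph1 S.

Let b0 : 0 < b. Proof. by case: HM. Qed.
Let d0 : 0 <= d. Proof. by case: HM. Qed.
Let d4 : d <= 4^-1. Proof. by case: HM. Qed.

Let d2d : d ^+ 2 <= d.
Proof. by rewrite expr2 ler_piMr// (le_trans d4)// invf_le1 ?ler1n. Qed.

Lemma expR_absle x : expR (- b * `|x|) <= expR (- b * x).
Proof. by rewrite ler_expR !mulNr lerN2 ler_wpM2l ?ler_norm// ltW. Qed.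

Lemma expR_absle1 x : expR (- b * `|x|) <= 1.
Proof. by rewrite -expR0 ler_expR mulNr oppr_le0 mulr_ge0// ltW. Qed.

Let d2le x : d ^+ 2 * expR (- b * `|x|) <= 4^-1.
Proof.
by rewrite (le_trans _ d4)// -[leRHS]mulr1 ler_pM ?expR_ge0// ?sqr_ge0// expR_absle1.
Qed.

Lemma expR_half_le2 y : y <= 2^-1 -> expR y <= 2.
Proof.
move=> y2; rewrite -[expR y]invrK -expRN -[leRHS]invrK lef_pV2 ?posrE ?expR_gt0 ?invr_gt0//.
by rewrite (le_trans _ (expR_ge1Dx (- y)))//; lra.
Qed.

(** The requirement [d <= 4^-1] keeps [2 * Ph] between $-1/2$ and $1/2$, where $e^y \le 1/(1-y) \le
    2$. *)
Lemma expR_Ph_le2 x : expR (2 * Ph x) <= 2 /\ expR (- 2 * Ph x) <= 2.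
Proof.
have := le_trans (mod_Phd HM x) (d2le x); rewrite ler_norml => /andP[h1 h2].
by split; apply: expR_half_le2; lra.
Qed.

(** The first condition bounds [Jop k]; the second lets the drift term [k * G1] share the bound of
    order [d] on [G]. *)
Definition jregion k := 0 <= Im k /\ normc k <= 1.

(* Writing the Jost solution as [exp Ph * exp (i k x) * m], the function
   [w = - exp (2 Ph) * m'] satisfies [w = Jop k (G k) + Kop k w], and
   [m = 1 + Bop w]. *)
Definition G1 x : R[i] := - (2 * 'i%C) * (expR (2 * Ph x) * Ph1 x)%:C.
Definition G k x : R[i] := (expR (2 * Ph x) * S x)%:C + k * G1 x.

Definition Bop h := ctail (fun y => (expR (- 2 * Ph y))%:C * h y).

Definition Kop k h := Jop k (fun x => G k x * Bop h x).

Let cPh1 : continuous Ph1.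
Proof. exact: primitive_continuous (mod_Ph1 HM). Qed.

Lemma mE (c : R) : measurable_fun setT (fun x => expR (c * Ph x)).
Proof. exact: (primitive_measurable (primitive_expR_comp c (mod_Ph HM) cPh1)). Qed.

Lemma mG1 : cmeasurable G1.
Proof.
apply: cmeasurableM; first exact: cmeasurable_cst.
apply: cmeasurable_real; apply: measurable_funM; first exact: mE.
exact: primitive_measurable (mod_Ph1 HM).
Qed.

Lemma mG k : cmeasurable (G k).
Proof.
apply: cmeasurableD.
  by apply: cmeasurable_real; apply: measurable_funM; [exact: mE|exact: mod_mS HM].
apply: cmeasurableM; [exact: cmeasurable_cst|exact: mG1].
Qed.

Lemma normc_2i : normc (2 * 'i%C : R[i]) = 2.
Proof. by rewrite normcM normc_i mulr1 (_ : 2 = 2%:C) ?normc_real ?ger0_norm// rmorphMn. Qed.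

Lemma cdecay2i (a N : R) h : cdecay a N h -> cdecay a (2 * N) (fun x => 2 * 'i%C * h x).
Proof. by rewrite -[in X in _ -> X]normc_2i; exact: cdecayZ. Qed.

Lemma normc_G1 x : normc (G1 x) <= 4 * d * expR (- b * `|x|).
Proof.
rewrite /G1 normcM normcN normc_2i normc_real normrM ger0_norm ?expR_ge0//.
have [h _] := expR_Ph_le2 x.
rewrite (_ : 4 * d * _ = 2 * (2 * (d * expR (- b * `|x|)))); last by ring.
by rewrite ler_wpM2l// ler_pM ?expR_ge0//; case: HM.
Qed.

Lemma normc_G k x : jregion k -> normc (G k x) <= 6 * d * expR (- b * `|x|).
Proof.
move=> [_ k1]; rewrite (le_trans (le_normcD _ _))// normcM normc_real normrM.
rewrite [`|expR _|]ger0_norm ?expR_ge0//.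
have [h _] := expR_Ph_le2 x.
have h1 : expR (2 * Ph x) * `|S x| <= 2 * (d ^+ 2 * expR (- b * `|x|)).
  by rewrite ler_pM ?expR_ge0//; case: HM.
have h2 : normc k * normc (G1 x) <= 1 * (4 * d * expR (- b * `|x|)).
  by rewrite ler_pM ?normc_ge0// normc_G1.
have h3 : d ^+ 2 * expR (- b * `|x|) <= d * expR (- b * `|x|).
  by rewrite ler_wpM2r ?expR_ge0.
by rewrite (le_trans (lerD h1 h2))//; lra.
Qed.

Lemma cdecay_abs (q : R -> R[i]) N : cmeasurable q ->
  (forall x, normc (q x) <= N * expR (- b * `|x|)) -> 0 <= N -> cdecay b N q.
Proof.
by move=> mq qN N0; split => // x; rewrite (le_trans (qN x))// ler_wpM2l// expR_absle.
Qed.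

Lemma normc_abs_le (q : R -> R[i]) N : 0 <= N ->
  (forall x, normc (q x) <= N * expR (- b * `|x|)) -> forall x, normc (q x) <= N.
Proof.
by move=> N0 qN x; rewrite (le_trans (qN x))// -[leRHS]mulr1 ler_wpM2l// expR_absle1.
Qed.

Lemma normc_GN k x : jregion k -> normc (G k x) <= 6 * d.
Proof.
move=> kr; apply: (@normc_abs_le (G k)) => [|y]; first by rewrite mulr_ge0.
exact: normc_G.
Qed.

Lemma normc_G1N x : normc (G1 x) <= 4 * d.
Proof.
apply: (@normc_abs_le G1) => [|y]; first by rewrite mulr_ge0.
exact: normc_G1.
Qed.

Lemma cdecay_G k : jregion k -> cdecay b (6 * d) (G k).
Proof.
move=> kr; apply: cdecay_abs; [exact: mG|by move=> x; exact: normc_G|by rewrite mulr_ge0].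
Qed.

Lemma cdecay_G1 : cdecay b (4 * d) G1.
Proof.
by apply: cdecay_abs; [exact: mG1|exact: normc_G1|rewrite mulr_ge0].
Qed.

Lemma cdecay_E (c : R) N h : (forall x, expR (c * Ph x) <= 2) -> cdecay b N h ->
  cdecay b (2 * N) (fun y => (expR (c * Ph y))%:C * h y).
Proof.
move=> c2; apply: cdecayM; first by apply: cmeasurable_real; exact: mE.
by move=> x; rewrite normc_real ger0_norm ?expR_ge0.
Qed.

Lemma cdecay_EN N h : cdecay b N h ->
  cdecay b (2 * N) (fun y => (expR (- 2 * Ph y))%:C * h y).
Proof. by apply: cdecay_E => x; case: (expR_Ph_le2 x). Qed.

Lemma cdecay_B N h : cdecay b N h -> cdecay b (4 * N / b) (Bop h).
Proof.
move=> /cdecay_EN /(cdecay_ctail b0); rewrite (_ : 2 * (2 * N) = 4 * N)//; by ring.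
Qed.

Lemma BopD N M h g : cdecay b N h -> cdecay b M g ->
  Bop (fun x => h x + g x) = fun x => Bop h x + Bop g x.
Proof.
move=> /cdecay_EN hN /cdecay_EN gM; rewrite /Bop.
rewrite -(ctailD b0 hN gM); congr ctail; apply/funext => y; exact: mulrDr.
Qed.

Lemma BopZ N c h : cdecay b N h -> Bop (fun x => c * h x) = fun x => c * Bop h x.
Proof.
move=> /cdecay_EN hN; rewrite /Bop -(ctailZ c b0 hN); congr ctail.
by apply/funext => y; rewrite mulrCA.
Qed.

Lemma Bop_primitive N h : cdecay b N h ->
  cprimitive (Bop h) (fun x => - ((expR (- 2 * Ph x))%:C * h x)).
Proof. by move=> /cdecay_EN; exact: ctail_primitive. Qed.

Lemma cdecay_GB k N h : jregion k -> cdecay b N h ->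
  cdecay b (6 * d * (4 * N / b)) (fun x => G k x * Bop h x).
Proof.
move=> kr /cdecay_B; apply: cdecayM; first exact: mG.
by move=> x; exact: normc_GN.
Qed.

Lemma cdecay_G1B N h : cdecay b N h ->
  cdecay b (4 * d * (4 * N / b)) (fun x => G1 x * Bop h x).
Proof.
move=> /cdecay_B; apply: cdecayM; first exact: mG1.
exact: normc_G1N.
Qed.

Lemma Kop_half_contraction k : jregion k -> half_contraction b (Kop k).
Proof.
move=> kr; have [k0 _] := kr; split => [N h hN|N M h g hN gM].
  have N0 := cdecay_ge0 hN.
  have := cdecay_Jop b0 k0 (cdecay_GB kr hN); apply: cdecay_le.
  (* Origin of the constant [b ^+ 2 / 96]: [Bop] costs [4 / b], [Jop] costs [2 / b] and [G] is at
     most [6 * d], so [Kop] has norm at most [48 * d / b ^+ 2], which has to be at most $1/2$. *)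
  have := mod_db HM; rewrite ler_pdivlMr// => hd.
  rewrite (_ : 2 * _ / b = N * (d * 96) / (2 * b ^+ 2)); last first.
    by field; rewrite gt_eqF.
  rewrite ler_pdivrMr ?mulr_gt0 ?exprn_gt0//.
  rewrite (_ : N / 2 * _ = N * b ^+ 2); last by field.
  exact: ler_wpM2l.
rewrite /Kop -(JopD b0 k0 (cdecay_GB kr hN) (cdecay_GB kr gM)); congr Jop.
by apply/funext => x; rewrite (BopD hN gM) mulrDr.
Qed.

Definition is_w k w := (exists N, cdecay b N w) /\
  forall x, w x = Jop k (G k) x + Kop k w x.

Lemma cdecay_JG k : jregion k -> cdecay b (12 * d / b) (Jop k (G k)).
Proof.
move=> kr; have [k0 _] := kr.
have := cdecay_Jop b0 k0 (cdecay_G kr); rewrite (_ : 2 * (6 * d) = 12 * d)//; by ring.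
Qed.

Lemma is_w_exists k : jregion k -> exists w, is_w k w.
Proof.
move=> kr.
have [w wN wE] := half_contraction_fixpoint (Kop_half_contraction kr) (cdecay_JG kr).
by exists w; split => //; exists (2 * (12 * d / b)).
Qed.

Lemma cdecay_w k w : jregion k -> is_w k w -> cdecay b (24 * d / b) w.
Proof.
move=> kr [[N wN] wE].
have := half_contraction_bound (Kop_half_contraction kr) (cdecay_JG kr) wN wE.
by apply: cdecay_le; rewrite le_eqVlt; apply/orP; left; apply/eqP; ring.
Qed.

(** The difference is a fixed point with source 0, which the a priori bound annihilates. *)
Lemma is_w_unique k w g : jregion k -> is_w k w -> is_w k g -> w = g.
Proof.
move=> kr kw kg; have wN := cdecay_w kr kw; have gN := cdecay_w kr kg.
have [K1 K2] := Kop_half_contraction kr.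
have E : forall x, w x - g x = 0 + Kop k (fun x => w x - g x) x.
  move=> x; have [_ wE] := kw; have [_ gE] := kg.
  have -> : Kop k (fun x => w x - g x) x = Kop k w x - Kop k g x.
    have := K2 _ _ _ _ (cdecayB wN gN) gN => /(congr1 (fun f => f x)).
    have -> : (fun x : R => w x - g x + g x) = w by apply/funext => y; rewrite subrK.
    by move=> ->; rewrite addrK.
  have := wE x; have := gE x.
  by move: (Kop k w x) (Kop k g x) (Jop k (G k) x) => A1 A2 A3 -> ->; ring.
have z0 : cdecay b 0 (fun=> 0 : R[i]).
  by split; [exact: cmeasurable_cst|move=> x; rewrite Normc.normc0 mul0r].
have [_ h0] := half_contraction_bound (Kop_half_contraction kr) z0 (cdecayB wN gN) E.
apply/funext => x; apply/eqP; rewrite -subr_eq0 -normc_eq0 eq_le normc_ge0 andbT.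
by have := h0 x; rewrite mulr0 mul0r.
Qed.

Definition wsol k : R -> R[i] := xget (fun=> 0) [set w | is_w k w].

Lemma wsolP k : jregion k -> is_w k (wsol k).
Proof.
move=> kr; have [w kw] := is_w_exists kr.
by rewrite /wsol; case: xgetP => [v -> //|/(_ w)/(_ kw)].
Qed.

Definition msol k x := 1 + Bop (wsol k) x.

Lemma cdecay_wsol k : jregion k -> cdecay b (24 * d / b) (wsol k).
Proof. by move=> kr; exact: cdecay_w kr (wsolP kr). Qed.

Lemma cdecay_Bwsol k : jregion k -> cdecay b (96 * d / b ^+ 2) (Bop (wsol k)).
Proof.
move=> kr; have := cdecay_B (cdecay_wsol kr); apply: cdecay_le.
by rewrite le_eqVlt; apply/orP; left; apply/eqP; field; rewrite gt_eqF.
Qed.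

Let dbb : 96 * d / b ^+ 2 <= 1.
Proof.
by rewrite ler_pdivrMr ?exprn_gt0// mul1r; have := mod_db HM; rewrite ler_pdivlMr// mulrC.
Qed.

Lemma cdecay_Gm k l : jregion k -> jregion l ->
  cdecay b (12 * d) (fun x => G l x * msol k x).
Proof.
move=> kr lr.
have h1 : cdecay b (6 * d * 1) (fun x => G l x * Bop (wsol k) x).
  apply: cdecayM; [exact: mG|by move=> x; exact: normc_GN|].
  exact: cdecay_le dbb (cdecay_Bwsol kr).
have := cdecayD (cdecay_G lr) h1; rewrite (_ : 6 * d + 6 * d * 1 = 12 * d); last by ring.
by apply: cdecay_eq => x; rewrite /msol mulrDr mulr1.
Qed.

Lemma cdecay_G1m k : jregion k -> cdecay b (8 * d) (fun x => G1 x * msol k x).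
Proof.
move=> kr.
have h1 : cdecay b (4 * d * 1) (fun x => G1 x * Bop (wsol k) x).
  apply: cdecayM; [exact: mG1|exact: normc_G1N|].
  exact: cdecay_le dbb (cdecay_Bwsol kr).
have := cdecayD cdecay_G1 h1; rewrite (_ : 4 * d + 4 * d * 1 = 8 * d); last by ring.
by apply: cdecay_eq => x; rewrite /msol mulrDr mulr1.
Qed.

Lemma wsolE k : jregion k -> wsol k = Jop k (fun x => G k x * msol k x).
Proof.
move=> kr; have [k0 _] := kr; have [_ wE] := wsolP kr.
apply/funext => x; rewrite [LHS]wE.
rewrite -(congr1 (fun f => f x) (JopD b0 k0 (cdecay_G kr) (cdecay_GB kr (cdecay_wsol kr)))).
by congr (Jop k _ x); apply/funext => y; rewrite /msol mulrDr mulr1.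
Qed.

Lemma wsol_primitive k : jregion k ->
  cprimitive (wsol k) (fun x => - (2 * 'i%C * k) * wsol k x - G k x * msol k x).
Proof.
move=> kr; have [k0 _] := kr.
by have := Jop_primitive b0 k0 (cdecay_Gm kr kr); rewrite -wsolE.
Qed.

Lemma msol_primitive k : jregion k ->
  cprimitive (msol k) (fun x => - ((expR (- 2 * Ph x))%:C * wsol k x)).
Proof.
move=> kr; have := cprimitiveD (cprimitive_cst 1) (Bop_primitive (cdecay_wsol kr)).
by apply: cprimitive_eq => // x; rewrite add0r.
Qed.

Lemma jregion_conj k : jregion k -> jregion (- conjc k).
Proof.
move=> [k0 k1]; split; last by rewrite normcN normc_conj.
by case: k k0 {k1} => u v /=; rewrite opprK.
Qed.

(** Conjugating the equation of [wsol k] gives that of [wsol (- conjc k)], because [Ph], [Ph1] and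
    [S] are real and [k] enters [G] through ['i%C * k]; uniqueness concludes. *)
Lemma wsol_conj k : jregion k -> wsol (- conjc k) = fun x => conjc (wsol k x).
Proof.
move=> kr; have kr' := jregion_conj kr; have [k0 _] := kr.
apply: (is_w_unique kr'); first exact: wsolP.
have wN := cdecay_wsol kr.
have [m1 m2] : cmeasurable (wsol k) by case: wN.
split.
  exists (24 * d / b); split.
    have e1 : (fun x => Re (conjc (wsol k x))) = fun x => Re (wsol k x).
      by apply/funext => x; case: (wsol k x).
    have e2 : (fun x => Im (conjc (wsol k x))) = fun x => - Im (wsol k x).
      by apply/funext => x; case: (wsol k x).
    by split; rewrite ?e1 ?e2//; exact: measurable_funN.
  by move=> x; rewrite normc_conj; case: wN.
have conjG x : G (- conjc k) x = conjc (G k x).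
  rewrite /G /G1 conjcD conjcR !conjcM conjcR; congr (_ + _).
  rewrite !mulrA; congr (_ * _); apply: complex_eqP.
    by case: k {kr kr' k0 wN m1 m2} => u v; rewrite !(ReM, ImM, ReN, ImN)/=; ring.
  by case: k {kr kr' k0 wN m1 m2} => u v; rewrite !(ReM, ImM, ReN, ImN)/=; ring.
have conjB : Bop (fun x => conjc (wsol k x)) = fun x => conjc (Bop (wsol k) x).
  rewrite /Bop -(ctail_conj b0 (cdecay_EN wN)); congr ctail.
  by apply/funext => y; rewrite conjcM conjcR.
move=> x; have [_ wE] := wsolP kr; rewrite [in LHS]wE conjcD; congr (_ + _).
  rewrite -(congr1 (fun f => f x) (Jop_conj b0 k0 (cdecay_G kr))); congr (Jop _ _ x).
  by apply/funext => y; rewrite conjG.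
rewrite /Kop conjB -(congr1 (fun f => f x) (Jop_conj b0 k0 (cdecay_GB kr wN))).
by congr (Jop _ _ x); apply/funext => y; rewrite conjG conjcM.
Qed.

Definition jenv k x : R[i] := (expR (Ph x))%:C * cexp ('i%C * k * x%:C).
Definition jf k x := jenv k x * msol k x.
(** This is the derivative of [msol k], as [jf1 k] is that of [jf k]. *)
Definition jp k x : R[i] := - ((expR (- 2 * Ph x))%:C * wsol k x).
Definition jf1 k x := jenv k x * (((Ph1 x)%:C + 'i%C * k) * msol k x + jp k x).
Local Arguments jenv : simpl never.
Local Arguments jp : simpl never.

Lemma jenv_primitive k :
  cprimitive (jenv k) (fun x => ((Ph1 x)%:C + 'i%C * k) * jenv k x).
Proof.
have h := primitive_cprimitive (primitive_expR_comp 1 (mod_Ph HM) cPh1).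
apply: cprimitive_eq (cprimitiveM h (cprimitive_cexp ('i%C * k))) => x.
  by rewrite /jenv mul1r.
by rewrite /jenv !mul1r rmorphM; ring.
Qed.

(** In classical terms $m'' + 2(ik + \mathrm{Ph}')m' = (S - 2ik\,\mathrm{Ph}')m$, to which $f'' = (V
    - k^2)f$ reduces for $f = e^{\mathrm{Ph}}e^{ikx}m$. The integrating factor $e^{2\mathrm{Ph}}$ in
    [wsol] absorbs the drift $2\,\mathrm{Ph}'m'$. *)
Lemma jp_primitive k : jregion k ->
  cprimitive (jp k) (fun x => - (2 * 'i%C * k + 2 * (Ph1 x)%:C) * jp k x
     + ((S x)%:C - 2 * 'i%C * k * (Ph1 x)%:C) * msol k x).
Proof.
move=> kr.
have h := primitive_cprimitive (primitive_expR_comp (- 2) (mod_Ph HM) cPh1).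
apply: cprimitive_eq (cprimitiveN (cprimitiveM h (wsol_primitive kr))) => // x.
rewrite /G /G1 /jp !realcM realcN realc_nat.
have E : (expR (- 2 * Ph x))%:C * (expR (2 * Ph x))%:C = 1 :> R[i].
  by rewrite -rmorphM -expRD mulNr addNr expR0.
rewrite [in RHS](_ : (S x)%:C = (expR (- 2 * Ph x))%:C * (expR (2 * Ph x))%:C * (S x)%:C); last by rewrite E mul1r.
rewrite [in RHS](_ : 2 * 'i%C * k * (Ph1 x)%:C = (expR (- 2 * Ph x))%:C * (expR (2 * Ph x))%:C * (2 * 'i%C * k * (Ph1 x)%:C)); last by rewrite E mul1r.
by ring.
Qed.

Lemma jf_primitive k : jregion k -> cprimitive (jf k) (jf1 k).
Proof.
move=> kr; apply: cprimitive_eq (cprimitiveM (jenv_primitive k) (msol_primitive kr)) => // x.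
rewrite /jf1 /jp; move: (msol k x) (jenv k x) (wsol k x) => A B C; ring.
Qed.

Lemma jf1_primitive k : jregion k ->
  cprimitive (jf1 k) (fun x => ((V x)%:C - k ^+ 2) * jf k x).
Proof.
move=> kr.
have h := primitive_cprimitive (mod_Ph1 HM).
have h1 := cprimitiveD (cprimitiveM (cprimitiveD h (cprimitive_cst ('i%C * k))) (msol_primitive kr)) (jp_primitive kr).
apply: cprimitive_eq (cprimitiveM (jenv_primitive k) h1) => // x.
rewrite /jf -[- (_ * wsol k x)]/(jp k x) !realcB realcX.
move: (msol k x) (jenv k x) (jp k x) (V x)%:C (S x)%:C (Ph1 x)%:C => A B C D F H.
have i2 : 'i%C * 'i%C = -1 :> R[i] by rewrite -expr2 sqr_i.
rewrite [in RHS](_ : k ^+ 2 = - ('i%C * 'i%C) * k ^+ 2); last by rewrite i2 opprK mul1r.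
by ring.
Qed.

(** The parameter sits in two places: [G] is affine in it with slope [G1], and [Jop] obeys the
    resolvent identity. *)
Lemma Kop_diff k l N h : jregion k -> jregion l -> cdecay b N h -> forall x,
  Kop l h x - Kop k h x =
  (l - k) * (Jop l (fun x => G1 x * Bop h x) x
     + 2 * 'i%C * Jop l (Jop k (fun x => G k x * Bop h x)) x).
Proof.
move=> kr lr hN x; have [k0 _] := kr; have [l0 _] := lr.
have := Jop_resolvent b0 k0 l0 (cdecay_GB kr hN) x.
have : Kop l h x = Jop l (fun x => G k x * Bop h x) x + (l - k) * Jop l (fun x => G1 x * Bop h x) x.
  rewrite -(congr1 (fun f => f x) (JopZ (l - k) b0 l0 (cdecay_G1B hN))).
  rewrite -(congr1 (fun f => f x) (JopD b0 l0 (cdecay_GB kr hN) (cdecayZ (l - k) (cdecay_G1B hN)))).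
  congr (Jop l _ x); apply/funext => y; rewrite /G; move: (G1 y) (Bop h y) => A B; ring.
rewrite /Kop => -> E; rewrite -addrAC E.
move: (Jop l (fun x => G1 x * Bop h x) x) (Jop l _ x) => A B; ring.
Qed.

(* The derivative [D] of [wsol] with respect to [k] solves
   [D = Jop k (rhsD k) + Kop k D]. *)
Definition rhsD k x : R[i] := 2 * 'i%C * wsol k x + G1 x * msol k x.
Local Arguments rhsD : simpl never.

Lemma cdecay_rhsD k : jregion k -> cdecay b ((48 / b + 8) * d) (rhsD k).
Proof.
move=> kr; have := cdecayD (cdecayZ (2 * 'i%C) (cdecay_wsol kr)) (cdecay_G1m kr).
by apply: cdecay_le; rewrite normc_2i le_eqVlt; apply/orP; left; apply/eqP; ring.
Qed.

(** The increment of [wsol] solves the fixed-point equation at [l] with a source proportional to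
    [l - k]. In [rhsD k], [2 * 'i%C * wsol k] comes from varying [Jop] and [G1 * msol k] from
    varying [G]. *)
Lemma wsol_diff k l : jregion k -> jregion l -> forall x,
  wsol l x - wsol k x = (l - k) * Jop l (rhsD k) x + Kop l (fun x => wsol l x - wsol k x) x.
Proof.
move=> kr lr x; have [k0 _] := kr; have [l0 _] := lr.
have E := Jop_resolvent b0 k0 l0 (cdecay_Gm kr kr) x.
rewrite -(wsolE kr) in E.
have wd := cdecayB (cdecay_wsol lr) (cdecay_wsol kr).
have E1 : wsol l x = Jop l (fun x => G l x * msol k x) x + Kop l (fun x => wsol l x - wsol k x) x.
  rewrite [in LHS]wsolE//.
  rewrite -(congr1 (fun f => f x) (JopD b0 l0 (cdecay_Gm kr lr) (cdecay_GB lr wd))).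
  congr (Jop l _ x); apply/funext => y; rewrite -mulrDr; congr (_ * _).
  rewrite /msol -addrA; congr (_ + _).
  rewrite -(congr1 (fun f => f y) (BopD (cdecay_wsol kr) wd)); congr (Bop _ y).
  by apply/funext => z; rewrite addrC subrK.
have E2 : Jop l (fun x => G l x * msol k x) x =
    Jop l (fun x => G k x * msol k x) x + (l - k) * Jop l (fun x => G1 x * msol k x) x.
  rewrite -(congr1 (fun f => f x) (JopZ (l - k) b0 l0 (cdecay_G1m kr))).
  rewrite -(congr1 (fun f => f x) (JopD b0 l0 (cdecay_Gm kr kr) (cdecayZ (l - k) (cdecay_G1m kr)))).
  congr (Jop l _ x); apply/funext => y; rewrite /G; move: (G1 y) (msol k y) => A B; ring.
have E3 : Jop l (rhsD k) x = 2 * 'i%C * Jop l (wsol k) x + Jop l (fun x => G1 x * msol k x) x.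
  rewrite -(congr1 (fun f => f x) (JopZ (2 * 'i%C) b0 l0 (cdecay_wsol kr))).
  by rewrite -(congr1 (fun f => f x) (JopD b0 l0 (cdecayZ (2 * 'i%C) (cdecay_wsol kr)) (cdecay_G1m kr))).
rewrite [in LHS]E1 E2 E3; move/eqP: E; rewrite subr_eq => /eqP ->.
move: (Jop l (fun x => G1 x * msol k x) x) (Jop l (wsol k) x) (Kop l _ x) (wsol k x) => A B C D; ring.
Qed.

(** Subtracting [l - k] times the equation of the candidate derivative [D] leaves, for the
    remainder, the fixed-point equation at [l] with source [(l - k) ^+ 2 * Q l]. The a priori bound
    then makes the remainder quadratic, uniformly over the region. *)
Lemma wsol_derivative k : jregion k ->
  exists2 D, cdecay b (4 / b * (48 / b + 8) * d) D &
  exists2 C, 0 <= C & forall l, jregion l ->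
    cdecay b (C * normc (l - k) ^+ 2) (fun x => wsol l x - wsol k x - (l - k) * D x).
Proof.
move=> kr; have [k0 _] := kr; have rN := cdecay_rhsD kr.
have JrN := cdecay_Jop b0 k0 rN.
have [D DN DE] := half_contraction_fixpoint (Kop_half_contraction kr) JrN.
exists D.
  by apply: cdecay_le DN; rewrite le_eqVlt; apply/orP; left; apply/eqP; ring.
set NR := (48 / b + 8) * d in rN JrN DN *.
set ND := 2 * (2 * NR / b) in DN *.
pose N1 := 2 * (4 * d * (4 * ND / b)) / b.
pose N2 := 2 * (2 * (2 * (6 * d * (4 * ND / b)) / b) / b).
pose N3 := 2 * (2 * (2 * NR / b) / b).
pose Q l x := Jop l (fun x => G1 x * Bop D x) x
     + 2 * 'i%C * Jop l (Jop k (fun x => G k x * Bop D x)) x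
     + 2 * 'i%C * Jop l (Jop k (rhsD k)) x.
have QN l : jregion l -> cdecay b (N1 + N2 + N3) (Q l).
  move=> lr; have [l0 _] := lr.
  apply: cdecayD; first apply: cdecayD.
  - exact: cdecay_Jop b0 l0 (cdecay_G1B DN).
  - apply: cdecay2i; exact: cdecay_Jop b0 l0 (cdecay_Jop b0 k0 (cdecay_GB kr DN)).
  - by apply: cdecay2i; exact: cdecay_Jop b0 l0 JrN.
exists (2 * (N1 + N2 + N3)); first by rewrite mulr_ge0// (cdecay_ge0 (QN k kr)).
move=> l lr; have [l0 _] := lr.
have eN : cdecay b (normc ((l - k) ^+ 2) * (N1 + N2 + N3)) (fun x => (l - k) ^+ 2 * Q l x).
  by apply: cdecayZ; exact: QN.
have wd := cdecayB (cdecay_wsol lr) (cdecay_wsol kr).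
have EN := cdecayB wd (cdecayZ (l - k) DN).
have := half_contraction_bound (Kop_half_contraction lr) eN EN.
rewrite (_ : 2 * (normc ((l - k) ^+ 2) * _) = 2 * (N1 + N2 + N3) * normc (l - k) ^+ 2); last first.
  by rewrite expr2 normcM; ring.
apply => x.
have [_ K2] := Kop_half_contraction lr.
have E1 : Kop l (fun x => wsol l x - wsol k x) x =
    Kop l (fun x => wsol l x - wsol k x - (l - k) * D x) x + (l - k) * Kop l D x.
  have KZ : Kop l (fun x => (l - k) * D x) = fun x => (l - k) * Kop l D x.
    rewrite /Kop -(JopZ (l - k) b0 l0 (cdecay_GB lr DN)); congr Jop; apply/funext => y.
    by rewrite (BopZ _ DN) mulrCA.
  rewrite -(congr1 (fun f => f x) KZ) -(congr1 (fun f => f x) (K2 _ _ _ _ EN (cdecayZ (l - k) DN))).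
  by congr (Kop l _ x); apply/funext => y; rewrite subrK.
rewrite [in LHS]wsol_diff// E1 [in LHS]DE.
have := Kop_diff kr lr DN x; move/eqP; rewrite subr_eq => /eqP ->.
have := Jop_resolvent b0 k0 l0 rN x; move/eqP; rewrite subr_eq => /eqP ->.
rewrite /Q.
move: (Kop l _ x) (Kop k D x) (Jop k (rhsD k) x) (Jop l (Jop k (rhsD k)) x)
  (Jop l (fun x => G1 x * Bop D x) x) (Jop l (Jop k (fun x => G k x * Bop D x)) x)
  => A1 A2 A3 A4 A5 A6; ring.
Qed.

End Modulated.

(** * Existence for the Volterra equation *)

Section JostExistence.
Context {R : realType}.
Implicit Types (k l c z : R[i]) (f g h w : R -> R[i]) (x y N M : R).
Local Arguments Normc.normc : simpl never.
Local Arguments cexp : simpl never.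
Local Arguments csin : simpl never.
Local Arguments ctail : simpl never.
Local Arguments cintegral : simpl never.
Local Arguments jenv : simpl never.
Local Arguments jp : simpl never.

Variables (b d : R) (V Ph Ph1 S : R -> R).
Hypothesis HM : modulated b d V Ph Ph1 S.
Variables (CV : R) (U : R -> R).
Hypothesis VC : forall x, `|V x| <= CV * expR (- b * `|x|).
Hypothesis mU : measurable_fun setT U.
Hypothesis UV : {ae @lebesgue_measure R, forall x, U x = V x}.

Let b0 : 0 < b. Proof. by case: HM. Qed.
Let d0 : 0 <= d. Proof. by case: HM. Qed.
Let d4 : d <= 4^-1. Proof. by case: HM. Qed.

Let CV0 : 0 <= CV.
Proof. by have := VC 0; rewrite normr0 mulr0 expR0 mulr1; exact: le_trans. Qed.

Lemma expR_sub1_le (t : R) : `|t| <= 2^-1 -> `|expR t - 1| <= 2 * `|t|.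
Proof.
move=> t2; have h : `|expR t - 1| <= `|t| * expR `|t|.
  have [t0|t0] := leP 0 t.
    rewrite !ger0_norm// ?subr_ge0; last by rewrite -expR0 ler_expR.
    have := expR_ge1Dx (- t); have := expRN t; have := expR_gt0 t => e0 -> h.
    have : (1 - t) * expR t <= 1 by rewrite -ler_pdivlMr// div1r.
    lra.
  rewrite ler0_norm; last by rewrite subr_le0 -expR0 ler_expR ltW.
  have := expR_ge1Dx t; rewrite ltr0_norm// => h.
  have h2 : 1 <= expR (- t) by rewrite -expR0 ler_expR; lra.
  have : - t * 1 <= - t * expR (- t) by rewrite ler_wpM2l//; lra.
  lra.
rewrite (le_trans h)// mulrC ler_wpM2r//; exact: expR_half_le2.
Qed.

Lemma normr_Ph_le x : `|Ph x| <= d ^+ 2 * expR (- b * `|x|) /\ `|Ph x| <= 4^-1.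
Proof.
have h := mod_Phd HM x; split => //; rewrite (le_trans h)//.
rewrite (le_trans _ d4)// -[leRHS]mulr1 ler_pM ?expR_ge0 ?sqr_ge0//; last first.
  exact: (expR_absle1 HM).
by rewrite expr2 ler_piMr// (le_trans d4)// invf_le1 ?ler1n.
Qed.

Lemma expR_Ph1_le2 x : expR (Ph x) <= 2.
Proof. by apply: expR_half_le2; have [_] := normr_Ph_le x; rewrite ler_norml => /andP[_]; lra. Qed.

Lemma normc_msol_le k x : jregion k -> normc (msol b Ph Ph1 S k x) <= 1 + expR (- b * x).
Proof.
move=> kr; rewrite /msol (le_trans (le_normcD _ _))// Normc.normc1 lerD2l.
have [_ /(_ x) h] := cdecay_Bwsol HM kr; rewrite (le_trans h)// -[leRHS]mul1r ler_wpM2r ?expR_ge0//.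
by rewrite ler_pdivrMr ?exprn_gt0// mul1r; have := mod_db HM; rewrite ler_pdivlMr// mulrC.
Qed.

Local Notation msol := (msol b Ph Ph1 S).
Local Notation wsol := (wsol b Ph Ph1 S).
Local Notation jf := (jf b Ph Ph1 S).
Local Notation jf1 := (jf1 b Ph Ph1 S).
Local Notation jp := (jp b Ph Ph1 S).
Local Notation jenv := (jenv Ph).

Lemma normc_jp_le k x : jregion k -> normc (jp k x) <= 48 * d / b * expR (- b * x).
Proof.
move=> kr; rewrite /jp normcN normcM normc_real ger0_norm ?expR_ge0//.
have [_ h] := expR_Ph_le2 HM x; have [_ /(_ x) hw] := cdecay_wsol HM kr.
rewrite (_ : 48 * d / b * _ = 2 * (24 * d / b * expR (- b * x))); last by ring.
by rewrite ler_pM ?expR_ge0 ?normc_ge0.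
Qed.

Lemma mV : measurable_fun setT V.
Proof.
have [m1 _ _] := mod_Ph1 HM; have mS := mod_mS HM; have m2 := primitive_measurable (mod_Ph1 HM).
have -> : V = fun x => (V x - S x - Ph1 x ^+ 2) + S x + Ph1 x ^+ 2 by apply/funext => x; ring.
by apply: measurable_funD; [exact: measurable_funD|exact: measurable_funX].
Qed.

Lemma normc_Vm_le k x : jregion k ->
  normc ((V x)%:C * (expR (Ph x))%:C * msol k x) <= 4 * CV /\
  normc ((V x)%:C * (expR (Ph x))%:C * msol k x) <= 4 * CV * expR (- b * x).
Proof.
move=> kr; rewrite !normcM !normc_real [`|expR _|]ger0_norm ?expR_ge0//.
have h1 : `|V x| * expR (Ph x) * normc (msol k x) <=
    (CV * expR (- b * `|x|)) * 2 * (1 + expR (- b * x)).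
  by rewrite ler_pM ?mulr_ge0 ?expR_ge0 ?normc_ge0 ?normc_msol_le// ler_pM ?expR_ge0// expR_Ph1_le2.
have e1 := expR_absle1 HM x; have e2 := expR_absle HM x.
have e3 : expR (- b * `|x|) * expR (- b * x) <= 1 /\ expR (- b * `|x|) * expR (- b * x) <= expR (- b * x).
  rewrite -expRD; split.
    rewrite -expR0 ler_expR !mulNr -opprD oppr_le0 -mulrDr mulr_ge0 ?(ltW b0)//.
    by have := ler_norm (- x); rewrite normrN; lra.
  by rewrite ler_expR gerDr mulNr oppr_le0 mulr_ge0 ?(ltW b0).
have e0 := expR_ge0 (- b * `|x|).
split; rewrite (le_trans h1)//.
  rewrite (_ : 4 * CV = CV * 4); last by ring.
  rewrite -2!mulrA ler_wpM2l//; case: e3; nra.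
rewrite (_ : 4 * CV * _ = CV * (4 * expR (- b * x))); last by ring.
rewrite -2!mulrA ler_wpM2l//; case: e3; nra.
Qed.

(** The function bounded here is [jf1 k - 'i%C * k * jf k] stripped of its factor $e^{ikx}$: the
    boundary term which has to vanish at $+\infty$. *)
Lemma normc_Phm_le k x : jregion k -> 0 <= x ->
  normc ((expR (Ph x))%:C * ((Ph1 x)%:C * msol k x + jp k x)) <=
   (4 * d + 96 * d / b) * expR (- b * x).
Proof.
move=> kr x0; rewrite normcM normc_real ger0_norm ?expR_ge0//.
have hp := normc_jp_le x kr; have hm := normc_msol_le x kr.
have hP := mod_Ph1d HM x; rewrite (ger0_norm x0) in hP.
have e1 : expR (- b * x) <= 1 by rewrite -expR0 ler_expR mulNr oppr_le0 mulr_ge0 ?(ltW b0).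
have e0 := expR_ge0 (- b * x).
have h : normc ((Ph1 x)%:C * msol k x + jp k x) <= d * expR (- b * x) * 2 + 48 * d / b * expR (- b * x).
  rewrite (le_trans (le_normcD _ _))// lerD// normcM normc_real ler_pM ?normc_ge0//.
  by lra.
rewrite (_ : (4 * d + _) * _ = 2 * (d * expR (- b * x) * 2 + 48 * d / b * expR (- b * x))); last by ring.
by rewrite ler_pM ?expR_ge0 ?normc_ge0// expR_Ph1_le2.
Qed.

Lemma cmeasurable_jost_kernel k x : k != 0 -> cmeasurable (fun y => jost_kernel k (y - x)).
Proof.
move=> kn0; rewrite /jost_kernel (negbTE kn0) /csin.
apply: cmeasurableM; last exact: cmeasurable_cst.
apply: cmeasurableM; last exact: cmeasurable_cst.
have h (c : R[i]) : cmeasurable (fun y => cexp (c * (y - x)%:C)).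
  have -> : (fun y => cexp (c * (y - x)%:C)) = (fun y => cexp (c * y%:C) * cexp (- (c * x%:C))).
    by apply/funext => y; rewrite realcB mulrBr cexpD.
  apply: cmeasurableM; last exact: cmeasurable_cst.
  exact: cprimitive_measurable (cprimitive_cexp _).
apply: cmeasurableD; last apply: cmeasurableN.
  by under eq_fun do rewrite mulrA; exact: h.
by under eq_fun do rewrite mulrA -mulNr; exact: h.
Qed.

(* The two exponentials in the kernel are integrated separately, each having an
   explicit primitive in terms of the solution and its derivative. *)
Lemma jf_jost_plus k : jregion k -> 0 < Im k -> is_jost_plus U k (jf k).
Proof.
move=> kr k0 x.
have kn0 : k != 0 by apply/eqP => k0'; move: k0; rewrite k0' /= ltxx.
pose g1 y := cexp ('i%C * k * y%:C) * ((V y)%:C * jf k y).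
pose g2 y := cexp (- ('i%C * k) * y%:C) * ((V y)%:C * jf k y).
have mjf := cprimitive_measurable (jf_primitive HM kr).
have mVc := cmeasurable_real mV.
have ee y : cexp (- ('i%C * k) * y%:C) * cexp ('i%C * k * y%:C) = 1.
  by rewrite mulNr cexpNK.
have Ri : Re ('i%C * k) = - Im k by rewrite ReM /=; ring.
have dg1 : cdecay (2 * Im k) (4 * CV) g1.
  split.
    apply: cmeasurableM; first exact: cprimitive_measurable (cprimitive_cexp _).
    exact: cmeasurableM.
  move=> y; have [h _] := normc_Vm_le y kr.
  rewrite (_ : g1 y = (cexp ('i%C * k * y%:C) * cexp ('i%C * k * y%:C)) *
    ((V y)%:C * (expR (Ph y))%:C * msol k y)); last by rewrite /g1 /jf /jenv; ring.
  rewrite normcM -cexpD normc_cexp mulrC.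
  rewrite (_ : Re _ = - (2 * Im k) * y); first by rewrite ler_wpM2r ?expR_ge0.
  by rewrite ReD !(ReM, ImM) /=; ring.
have dg2 : cdecay b (4 * CV) g2.
  split.
    apply: cmeasurableM; first exact: cprimitive_measurable (cprimitive_cexp _).
    exact: cmeasurableM.
  move=> y; have [_ h] := normc_Vm_le y kr.
  rewrite (_ : g2 y = (cexp (- ('i%C * k) * y%:C) * cexp ('i%C * k * y%:C)) *
    ((V y)%:C * (expR (Ph y))%:C * msol k y)); last by rewrite /g2 /jf /jenv; ring.
  by rewrite ee mul1r.
have i2 : 'i%C * 'i%C = -1 :> R[i] by rewrite -expr2 sqr_i.
have k20 : 0 < 2 * Im k by rewrite mulr_gt0.
(* $e^{ikx}(f' - ikf)$ has derivative $e^{ikx}Vf$, and it tends to 0 at $+\infty$ because $e^{2ikx}$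
   decays for $\Im k > 0$. *)
have T1 : ctail g1 x = - (cexp ('i%C * k * x%:C) * (jf1 k x - 'i%C * k * jf k x)).
  apply: (ctail_eq _ k20 dg1 (a := 2 * Im k) (M := 4 * d + 96 * d / b) _
    (F := fun x => - (cexp ('i%C * k * x%:C) * (jf1 k x - 'i%C * k * jf k x)))) => //.
    have := cprimitiveN (cprimitiveM (cprimitive_cexp ('i%C * k))
      (cprimitiveB (jf1_primitive HM kr) (cprimitiveZ ('i%C * k) (jf_primitive HM kr)))).
    apply: cprimitive_eq => // y; rewrite /g1; congr (- _).
    rewrite [in LHS](_ : k ^+ 2 = - ('i%C * 'i%C) * k ^+ 2); last by rewrite i2 opprK mul1r.
    move: (cexp _) (jf k y) (jf1 k y) (V y)%:C => A B C D; ring.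
  move=> y y0; rewrite normcN.
  rewrite (_ : _ * _ = (cexp ('i%C * k * y%:C) * cexp ('i%C * k * y%:C)) *
     ((expR (Ph y))%:C * ((Ph1 y)%:C * msol k y + jp k y))); last first.
    rewrite /jf1 /jf /jenv; move: (cexp _) (msol k y) (jp k y) => A B C; ring.
  rewrite normcM -cexpD normc_cexp mulrC.
  rewrite (_ : Re _ = - (2 * Im k) * y); last by rewrite ReD !(ReM, ImM) /=; ring.
  rewrite ler_wpM2r ?expR_ge0// (le_trans (normc_Phm_le kr y0))//.
  rewrite -[leRHS]mulr1 ler_wpM2l ?addr_ge0 ?divr_ge0 ?mulr_ge0 ?(ltW b0)//.
  by rewrite -expR0 ler_expR mulNr oppr_le0 mulr_ge0 ?(ltW b0).
(* $e^{-ikx}(f' + ikf)$ has derivative $e^{-ikx}Vf$ and limit $2ik$, since $f \sim e^{ikx}$. This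
   constant produces the free term of the Volterra equation. *)
have T2 : ctail g2 x = 2 * 'i%C * k - cexp (- ('i%C * k) * x%:C) * (jf1 k x + 'i%C * k * jf k x).
  apply: (ctail_eq _ b0 dg2 (a := b) (M := 4 * d + 96 * d / b + 2 * (2 * d ^+ 2 + 2)) b0
    (F := fun x => 2 * 'i%C * k - cexp (- ('i%C * k) * x%:C) * (jf1 k x + 'i%C * k * jf k x))).
    have := cprimitiveB (cprimitive_cst (2 * 'i%C * k)) (cprimitiveM (cprimitive_cexp (- ('i%C * k)))
      (cprimitiveD (jf1_primitive HM kr) (cprimitiveZ ('i%C * k) (jf_primitive HM kr)))).
    apply: cprimitive_eq => // y; rewrite /g2 add0r; congr (- _).
    rewrite [in LHS](_ : k ^+ 2 = - ('i%C * 'i%C) * k ^+ 2); last by rewrite i2 opprK mul1r.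
    move: (cexp _) (jf k y) (jf1 k y) (V y)%:C => A B C D; ring.
  move=> y y0.
  rewrite (_ : _ - _ = - ((expR (Ph y))%:C * ((Ph1 y)%:C * msol k y + jp k y)) -
     2 * 'i%C * k * ((expR (Ph y))%:C * msol k y - 1)); last first.
    have := ee y; rewrite /jf1 /jf /jenv.
    move: (cexp (- ('i%C * k) * y%:C)) (cexp ('i%C * k * y%:C)) (msol k y) (jp k y) => A1 A B C E.
    transitivity (2 * 'i%C * k - (A1 * A) * ((expR (Ph y))%:C * (((Ph1 y)%:C + 2 * 'i%C * k) * B + C))).
      by ring.
    by rewrite E; ring.
  rewrite (le_trans (le_normcD _ _))// !normcN [in leRHS]mulrDl lerD ?normc_Phm_le//.
  rewrite normcM -[leRHS]mulrA ler_pM ?normc_ge0//.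
    by rewrite normcM normc_2i ler_piMr//; case: kr.
  have -> : (expR (Ph y))%:C * msol k y - 1 = (expR (Ph y) - 1)%:C + (expR (Ph y))%:C * (msol k y - 1).
    by rewrite realcB; ring.
  rewrite (le_trans (le_normcD _ _))// normcM !normc_real [in leRHS]mulrDl lerD//.
    have [h1 h2] := normr_Ph_le y; rewrite (le_trans (expR_sub1_le _))//; first by lra.
    by rewrite -mulrA ler_wpM2l//; rewrite (ger0_norm y0) in h1.
  rewrite ger0_norm ?expR_ge0// ler_pM ?expR_ge0 ?normc_ge0 ?expR_Ph1_le2//.
  have -> : msol k y - 1 = Bop Ph (wsol k) y by rewrite /msol addrC addKr.
  have [_ /(_ y) h] := cdecay_Bwsol HM kr; rewrite (le_trans h)// -[leRHS]mul1r ler_wpM2r ?expR_ge0//.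
  by rewrite ler_pdivrMr ?exprn_gt0// mul1r; have := mod_db HM; rewrite ler_pdivlMr// mulrC.
set a1 := cexp (- ('i%C * k * x%:C)) / (2 * 'i%C) / k.
set a2 := cexp ('i%C * k * x%:C) / (2 * 'i%C) / k.
pose g y := jost_kernel k (y - x) * (U y)%:C * jf k y.
pose gV y := a1 * g1 y - a2 * g2 y.
have gE y : gV y = jost_kernel k (y - x) * (V y)%:C * jf k y.
  rewrite /jost_kernel (negbTE kn0) /csin /gV /g1 /g2 /a1 /a2.
  have -> : 'i%C * (k * (y - x)%:C) = 'i%C * k * y%:C + - ('i%C * k * x%:C).
    by rewrite realcB; ring.
  rewrite opprD opprK !cexpD mulNr.
  move: (cexp _) (cexp _) (cexp _) (cexp _) (jf k y) (V y)%:C => A B C D E F; ring.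
have mK := cmeasurable_jost_kernel x kn0.
have mg : cmeasurable g.
  by apply: cmeasurableM => //; apply: cmeasurableM => //; exact: cmeasurable_real.
have mgV : cmeasurable gV.
  have -> : gV = fun y => jost_kernel k (y - x) * (V y)%:C * jf k y by apply/funext.
  by apply: cmeasurableM => //; exact: cmeasurableM.
have ggV : {ae @lebesgue_measure R, forall y, gV y = g y}.
  by apply: ae_mono UV => y Uy; rewrite gE /g Uy.
have i1 := cdecay_integrable x k20 dg1.
have i2' := cdecay_integrable x b0 dg2.
have igV : cintegrable `[x, +oo[ gV.
  by apply: cintegrableB => //; exact: cintegrableZ.
split; first exact: cintegrable_ae_eq ggV igV.
rewrite -/g -(cintegral_ae_eq _ mgV mg ggV)// cintegralB//; try exact: cintegrableZ.
rewrite !cintegralZ// -/(ctail g1 x) -/(ctail g2 x) T1 T2 /a1 /a2 mulNr.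
have := cexpNK ('i%C * k * x%:C).
move: (cexp _) (cexp _) (jf k x) (jf1 k x) => A1 A B C E.
have i0 : 'i%C != 0 :> R[i] by rewrite -normc_eq0 normc_i oner_eq0.
transitivity (A + (- (A1 * A * (C - 'i%C * k * B)) - A * (2 * 'i%C * k) + A1 * A * (C + 'i%C * k * B)) / (2 * 'i%C * k)); last first.
  by field; rewrite kn0 i0.
by rewrite (mulrC A1) E; field; rewrite kn0 i0.
Qed.

End JostExistence.

(** * Uniqueness for the Volterra equation *)

Section JostUniqueness.
Context {R : realType}.
Implicit Types (k l c z : R[i]) (f g h w : R -> R[i]) (x y N M : R).
Local Arguments Normc.normc : simpl never.
Local Arguments cexp : simpl never.
Local Arguments csin : simpl never.
Local Arguments cintegral : simpl never.

Lemma normc_cintegral_le (D : set R) g (B : R -> R) : measurable D -> (forall y, 0 <= B y) ->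
  cintegrable D g -> mu.-integrable D (EFin \o B) ->
  {ae @lebesgue_measure R, forall y, D y -> normc (g y) <= B y} ->
  normc (cintegral D g) <= 2 * \int[mu]_(y in D) B y.
Proof.
move=> mD B0 [g1 g2] iB gB; rewrite (le_trans (normc_le _))//.
have H (v : R -> R) : mu.-integrable D (EFin \o v) -> (forall y, `|v y| <= normc (g y)) ->
    `|\int[mu]_(y in D) v y| <= \int[mu]_(y in D) B y.
  move=> iv vg; rewrite (le_trans (le_normr_Rintegral _ _))// /Rintegral fine_le//.
  - by apply: integrable_fin_num => //; exact: integrable_norm.
  - exact: integrable_fin_num.
  - apply: ae_ge0_le_integral => //.
    + by have /integrableP[] := integrable_norm iv.
    + by move=> y _; rewrite lee_fin.
    + by case/integrableP : iB.
    + by apply: ae_mono gB => y yB Dy; rewrite lee_fin (le_trans (vg y))// yB.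
rewrite mulr2n mulrDl mul1r lerD//.
  by apply: (H (fun y => Re (g y))) => // y; exact: normr_Re_le.
by apply: (H (fun y => Im (g y))) => // y; exact: normr_Im_le.
Qed.

Variables (b C : R) (U : R -> R).
Hypothesis b0 : 0 < b.
Hypothesis UC : {ae @lebesgue_measure R, forall x, `|U x| <= C * expR (- b * x)}.

Lemma normc_jost_kernel_le k x : k != 0 -> 0 <= x -> 0 <= Im k ->
  normc (jost_kernel k x) <= expR (Im k * x) / normc k.
Proof.
move=> k0 x0 ik; rewrite /jost_kernel (negbTE k0) normcM Normc.normcV.
rewrite ler_wpM2r ?invr_ge0 ?normc_ge0// /csin normcM Normc.normcV normc_2i.
rewrite ler_pdivrMr// (le_trans (le_normcD _ _))// normcN !normc_cexp.
have -> : Re (- ('i%C * (k * x%:C))) = Im k * x by rewrite ReN !(ReM, ImM)/=; ring.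
have -> : Re ('i%C * (k * x%:C)) = - (Im k * x) by rewrite !(ReM, ImM)/=; ring.
rewrite mulr2n mulrDr mulr1 lerD2r ler_expR.
by rewrite (@le_trans _ _ 0)// ?oppr_le0 mulr_ge0.
Qed.

(** For $s = x\,\Im k \ge 1$ one has $e^s - e^{-s} \ge e^s/2$: the growing exponential of the sine
    dominates. It turns integrability of the Volterra integrand into weighted integrability of
    [U * h]. *)
Lemma normc_jost_kernel_ge k x : k != 0 -> 0 < Im k -> (Im k)^-1 <= x ->
  expR (Im k * x) / (4 * normc k) <= normc (jost_kernel k x).
Proof.
move=> k0 ik kx; rewrite /jost_kernel (negbTE k0) normcM Normc.normcV.
have nk : 0 < normc k by rewrite lt_neqAle normc_ge0 andbT eq_sym normc_eq0.
rewrite invfM mulrA ler_wpM2r ?invr_ge0 ?normc_ge0// /csin normcM Normc.normcV normc_2i.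
rewrite ler_pdivlMr//.
have h : expR (Im k * x) - expR (- (Im k * x)) <= normc (cexp ('i%C * (k * x%:C)) - cexp (- ('i%C * (k * x%:C)))).
  rewrite lerBlDr.
  have -> : expR (- (Im k * x)) = normc (cexp ('i%C * (k * x%:C))).
    by rewrite normc_cexp !(ReM, ImM)/=; congr expR; ring.
  have -> : expR (Im k * x) = normc (cexp (- ('i%C * (k * x%:C)))).
    by rewrite normc_cexp ReN !(ReM, ImM)/=; congr expR; ring.
  rewrite normcB_sym; have := le_normcD (cexp (- ('i%C * (k * x%:C))) - cexp ('i%C * (k * x%:C))) (cexp ('i%C * (k * x%:C))).
  by rewrite subrK.
rewrite (le_trans _ h)//.
have h1 : 1 <= Im k * x by rewrite mulrC -ler_pdivrMr// mul1r.
have h2 := expR_ge1Dx (Im k * x).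
have h3 : expR (- (Im k * x)) <= 1 by rewrite -expR0 ler_expR oppr_le0 (le_trans ler01).
lra.
Qed.

(** Integrability of the integrand at one point is enough. The point [x0] lies [(Im k)^-1] to the
    left of [x1], so that the lower bound of the kernel holds for all [y] beyond [x1]; the kernel at
    [x] is then at most a multiple of $e^{-\Im k\,(x - x0)}$ times the kernel at [x0]. *)
Lemma jost_plus_bounded k h x1 : 0 < Im k ->
  (forall x, let g y := jost_kernel k (y - x) * (U y)%:C * h y in
     cintegrable `[x, +oo[ g /\ h x = cintegral `[x, +oo[ g) ->
  exists2 M, 0 <= M & forall x, x1 <= x -> normc (h x) <= M * expR (- Im k * x).
Proof.
move=> ik hE; have kn0 : k != 0 by apply/eqP => k0'; move: ik; rewrite k0' /= ltxx.
have nk : 0 < normc k by rewrite lt_neqAle normc_ge0 andbT eq_sym normc_eq0.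
pose x0 := x1 - (Im k)^-1.
have x01 : x0 <= x1 by rewrite gerDl oppr_le0 invr_ge0 ltW.
have [[i1 i2] _] := hE x0.
set g0 := fun y => jost_kernel k (y - x0) * (U y)%:C * h y in i1 i2.
pose B y := `|Re (g0 y)| + `|Im (g0 y)|.
have iB : mu.-integrable `[x0, +oo[ (EFin \o B).
  by apply: integrableD_EFin => //; exact: integrable_norm.
have B0 y : 0 <= B y by rewrite addr_ge0.
pose L := \int[mu]_(y in `[x0, +oo[) B y.
have L0 : 0 <= L by apply: Rintegral_ge0 => y _.
exists (2 * (4 * expR (Im k * x0) * L)); first by rewrite !mulr_ge0 ?expR_ge0.
move=> x x1x; have [ix ->] := hE x.
have sub : `[x, +oo[ `<=` `[x0, +oo[.
  move=> y; rewrite /= !in_itv/= !andbT; apply: le_trans; exact: le_trans x1x.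
have iBx : mu.-integrable `[x, +oo[ (EFin \o B) by exact: integrableS iB.
set c := 4 * expR (- (Im k * (x - x0))).
have c0 : 0 <= c by rewrite mulr_ge0 ?expR_ge0.
have := @normc_cintegral_le `[x, +oo[ _ (fun y => c * B y) _ _ ix _ _.
move=> H; apply: (le_trans (H _ _ _ _)) => //.
- by move=> y; rewrite mulr_ge0.
- by apply: integrableM_cst.
- apply: aeW => y; rewrite /= in_itv/= andbT => xy.
  have yx0 : (Im k)^-1 <= y - x0 by rewrite /x0 opprB addrCA lerDl subr_ge0 (le_trans x1x).
  have h1 := normc_jost_kernel_ge kn0 ik yx0.
  have yx : 0 <= y - x by rewrite subr_ge0.
  have h2 := normc_jost_kernel_le kn0 yx (ltW ik).
  have h3 : normc (g0 y) <= B y by exact: normc_le.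
  rewrite -mulrA normcM.
  apply: (le_trans (ler_wpM2r (normc_ge0 _) h2)).
  have e : expR (Im k * (y - x)) / normc k = c * (expR (Im k * (y - x0)) / (4 * normc k)).
    rewrite /c (_ : Im k * (y - x) = - (Im k * (x - x0)) + Im k * (y - x0)); last by ring.
    by rewrite expRD; field; rewrite gt_eqF.
  rewrite e -mulrA ler_wpM2l// (le_trans _ h3)// /g0 -mulrA [leRHS]normcM.
  by rewrite ler_wpM2r ?normc_ge0.
rewrite RintegralZl// -[leRHS]mulrA; rewrite ler_wpM2l//.
rewrite /c (_ : 4 * expR (Im k * x0) * L * _ = 4 * expR (- (Im k * (x - x0))) * L); last first.
  rewrite (_ : - (Im k * (x - x0)) = Im k * x0 + - Im k * x) ?expRD; by ring.
rewrite ler_wpM2l// /Rintegral fine_le//.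
- exact: integrable_fin_num.
- exact: integrable_fin_num.
- apply: ge0_subset_integral => //.
  + by case/integrableP : iB.
  + by move=> y _; rewrite lee_fin.
Qed.

(** Iterating the equation from the bound of [jost_plus_bounded] gains, at each round, a factor
    [A * expR (- b * x)] and a factorial denominator. In [A], the 2 comes from the complex integral,
    [normc k] from the kernel and [b] from integrating the exponential. *)
Lemma jost_plus_homogeneous0 k h : 0 < Im k ->
  (forall x, let g y := jost_kernel k (y - x) * (U y)%:C * h y in
     cintegrable `[x, +oo[ g /\ h x = cintegral `[x, +oo[ g) ->
  forall x, h x = 0.
Proof.
move=> ik hE x1; have kn0 : k != 0 by apply/eqP => k0'; move: ik; rewrite k0' /= ltxx.
have nk : 0 < normc k by rewrite lt_neqAle normc_ge0 andbT eq_sym normc_eq0.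
have ecE (y : R) m : exp_coeff y m = y ^+ m / m`!%:R by [].
have [M M0 hM] := jost_plus_bounded x1 ik hE.
pose A := 2 * `|C| / (normc k * b).
have A0 : 0 <= A by rewrite divr_ge0 ?mulr_ge0 ?normc_ge0// ltW.
have step n x : x1 <= x ->
    normc (h x) <= M * expR (- Im k * x) * exp_coeff (A * expR (- b * x)) n.
  elim: n x => [|n IH] x x1x; first by rewrite /exp_coeff/= expr0 fact0 divr1 mulr1 hM.
  have [ix ->] := hE x.
  set c := M * `|C| / normc k * expR (- Im k * x) * (A ^+ n / n`!%:R).
  have c0 : 0 <= c by rewrite !(mulr_ge0, divr_ge0, invr_ge0) ?expR_ge0 ?normc_ge0 ?exprn_ge0.
  have nb : 0 < n.+1%:R * b by rewrite mulr_gt0// ltr0n.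
  have H := @normc_cintegral_le `[x, +oo[ _ (fun y => c * expR (- (n.+1%:R * b) * y)) _ _ ix _ _.
  apply: (le_trans (H _ _ _ _)) => //.
  - by move=> y; rewrite mulr_ge0 ?expR_ge0.
  - exact: integrable_expR_tailZ.
  - apply: ae_mono UC => y Uy; rewrite /= in_itv/= andbT => xy.
    have yx : 0 <= y - x by rewrite subr_ge0.
    have h2 := normc_jost_kernel_le kn0 yx (ltW ik).
    have Uy' : `|U y| <= `|C| * expR (- b * y).
      by rewrite (le_trans Uy)// ler_wpM2r ?expR_ge0// ler_norm.
    rewrite !normcM normc_real.
    have := ler_pM (mulr_ge0 (normc_ge0 _) (normr_ge0 _)) (normc_ge0 _)
       (ler_pM (normc_ge0 _) (normr_ge0 _) h2 Uy') (IH y (le_trans x1x xy)).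
    move=> /le_trans; apply; rewrite le_eqVlt; apply/orP; left; apply/eqP.
    rewrite /c /exp_coeff/= exprMn -expRM_natl.
    rewrite (_ : - (n.+1%:R * b) * y = - b * y + n%:R * (- b * y)); last by rewrite -natr1; ring.
    rewrite (_ : Im k * (y - x) = Im k * y + - Im k * x); last by ring.
    have e1 : expR (Im k * y) * expR (- Im k * y) = 1 by rewrite -expRD mulNr addrN expR0.
    rewrite !expRD.
    transitivity ((expR (Im k * y) * expR (- Im k * y)) * (expR (- Im k * x) / normc k * (`|C| * expR (- b * y)) * (M * (A ^+ n * expR (n%:R * (- b * y)) / n`!%:R)))); first by ring.
    by rewrite e1; ring.
  rewrite RintegralZl//; last exact: integrable_expR_tail.
  rewrite Rintegral_expR_tail// le_eqVlt; apply/orP; left; apply/eqP.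
  rewrite /c ecE [(A * expR _) ^+ _]exprMn -expRM_natl factS natrM.
  rewrite (_ : - (n.+1%:R * b) * x = n.+1%:R * (- b * x)); last by ring.
  rewrite (_ : A ^+ n.+1 = 2 * `|C| / (normc k * b) * A ^+ n); last by rewrite exprS.
  have := pnatr_eq0 R n.+1; have := pnatr_eq0 R n`!.
  move: (A ^+ n) (n.+1%:R : R) (n`!%:R : R) => An n1 nf nf0 n10.
  by field; rewrite nf0 n10 -lt0n fact_gt0 !gt_eqF//.
apply/eqP; rewrite -normc_eq0 eq_le normc_ge0 andbT.
have l0 : M * expR (- Im k * x1) * exp_coeff (A * expR (- b * x1)) n @[n --> \oo] --> (0:R).
  by rewrite -(mulr0 (M * expR (- Im k * x1))); apply: cvgMr; exact: cvg_exp_coeff.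
apply: (cvgr_to_ge l0); near=> n; exact: step.
Unshelve. all: by end_near. Qed.

Lemma jost_plus_unique k f g : 0 < Im k -> is_jost_plus U k f -> is_jost_plus U k g -> f = g.
Proof.
move=> ik jf jg; apply/funext => x; apply/eqP; rewrite -subr_eq0; apply/eqP.
apply: (jost_plus_homogeneous0 (k := k) (h := fun x => f x - g x)) => //= y.
have [i1 e1] := jf y; have [i2 e2] := jg y.
have E : (fun z : R => jost_kernel k (z - y) * (U z)%:C * (f z - g z)) =
   (fun z : R => jost_kernel k (z - y) * (U z)%:C * f z - jost_kernel k (z - y) * (U z)%:C * g z).
  by apply/funext => z; rewrite mulrBr.
rewrite E; split; first exact: cintegrableB.
by rewrite cintegralB// {1}e1 {1}e2; move: (cintegral _ _) (cintegral _ _) => u v; ring.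
Qed.

End JostUniqueness.

(** * The reflection $x \mapsto -x$ *)

Section Reflection.
Context {R : realType}.
Implicit Types (f g h : R -> R[i]) (x y N M : R).
Local Arguments Normc.normc : simpl never.
Local Arguments cexp : simpl never.
Local Arguments csin : simpl never.
Local Arguments cintegral : simpl never.

Local Notation oppR := (fun x : R => - x).
Local Notation RT := (measurableTypeR R).

Let mopp : measurable_fun [set: RT] (oppR : RT -> RT).
Proof. exact: oppr_measurable. Qed.

Let phi : {mfun RT >-> RT} :=
  MeasurableFun.Pack (MeasurableFun.Class (isMeasurableFun.Build _ _ _ _ _ mopp)).

Lemma lebesgue_measure_opp (A : set RT) : measurable A ->
  pushforward (@lebesgue_measure R) phi A = lebesgue_measure A.
Proof.
move=> mA; apply/esym.
apply: (@lebesgue_measure_unique R (pushforward (@lebesgue_measure R) phi)) => //.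
move=> _ [[a b] _ <-] /=; rewrite /pushforward.
have -> : (phi @^-1` `]a, b]) = `[- b, - a[%classic :> set R.
  by apply/seteqP; split => x /=; rewrite !in_itv/= lerNl ltrNr andbC.
by rewrite !lebesgue_measure_itv/= !lte_fin ltrN2 -EFinD -EFinB opprK addrC.
Qed.

Lemma ge0_integral_opp (f : R -> \bar R) : measurable_fun setT f -> (forall x, 0 <= f x)%E ->
  (\int[mu]_x f x = \int[mu]_x f (- x)%R)%E.
Proof.
move=> mf f0; rewrite -[RHS](@ge0_integral_pushforward _ _ _ _ _ phi mopp (@lebesgue_measure R) setT f)//.
apply/esym; apply: (eq_measure_integral (@lebesgue_measure R)) => A mA _.
exact: lebesgue_measure_opp.
Qed.

Lemma integrable_opp (f : R -> \bar R) : mu.-integrable setT f ->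
  mu.-integrable setT (fun x => f (- x)).
Proof.
move=> /integrableP[mf fi]; apply/integrableP; split; first exact: measurableT_comp mf mopp.
by rewrite -(@ge0_integral_opp (fun x => `|f x|%E))//; exact: measurableT_comp.
Qed.

Lemma integral_opp (f : R -> \bar R) : mu.-integrable setT f ->
  (\int[mu]_x f x = \int[mu]_x f (- x)%R)%E.
Proof.
move=> fi; have [mf _] := integrableP _ _ _ fi.
rewrite -[RHS](@integral_pushforward _ _ _ _ _ phi mopp (@lebesgue_measure R) setT f)//; last first.
  by rewrite preimage_setT; exact: integrable_opp.
apply/esym; apply: (eq_measure_integral (@lebesgue_measure R)) => A mA _.
exact: lebesgue_measure_opp.
Qed.

Lemma patch_opp (D : set R) (f : R -> \bar R) :
  (fun x => (f \_ D) (- x)) = (fun x => f (- x)) \_ (oppR @^-1` D).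
Proof.
apply/funext => x; rewrite !patchE.
by congr (if _ then _ else _); apply/idP/idP; rewrite !inE.
Qed.

Lemma measurable_opp_set (D : set R) : measurable D -> measurable (oppR @^-1` D).
Proof. by move=> mD; rewrite -[X in measurable X]setTI; exact: mopp. Qed.

Lemma Rintegral_opp (D : set R) (f : R -> R) : measurable D ->
  mu.-integrable D (EFin \o f) ->
  mu.-integrable (oppR @^-1` D) (EFin \o (fun x => f (- x))) /\
  \int[mu]_(x in oppR @^-1` D) f (- x) = \int[mu]_(x in D) f x.
Proof.
move=> mD fD; have fi := (@integrable_mkcond _ _ _ (@lebesgue_measure R) D _ mD).1 fD.
split.
  apply: (@integrable_mkcond _ _ _ (@lebesgue_measure R) _ _ (measurable_opp_set mD)).2.
  by have := integrable_opp fi; rewrite patch_opp.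
rewrite /Rintegral [in RHS]integral_mkcond [in LHS]integral_mkcond; congr fine.
by rewrite (integral_opp fi) [in RHS]patch_opp.
Qed.

Lemma cintegral_opp (D : set R) f : measurable D -> cintegrable D f ->
  cintegrable (oppR @^-1` D) (fun x => f (- x)) /\
  cintegral (oppR @^-1` D) (fun x => f (- x)) = cintegral D f.
Proof.
move=> mD [f1 f2].
have [g1 e1] := Rintegral_opp mD f1; have [g2 e2] := Rintegral_opp mD f2.
by split; [split|apply: complex_eqP].
Qed.

Lemma oppR_itv_cy x : oppR @^-1` `[x, +oo[ = `]-oo, - x]%classic.
Proof. by apply/seteqP; split => y /=; rewrite !in_itv/= andbT lerNr. Qed.

Lemma oppR_itv_yc x : oppR @^-1` `]-oo, x] = `[- x, +oo[%classic.
Proof. by apply/seteqP; split => y /=; rewrite !in_itv/= andbT lerNl. Qed.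

Lemma oppR_itv_cc x y : oppR @^-1` `[x, y] = `[- y, - x]%classic.
Proof. by apply/seteqP; split => z /=; rewrite !in_itv/= lerNr lerNl andbC. Qed.

Lemma primitive_opp (F f : R -> R) : primitive F f ->
  primitive (fun x => F (- x)) (fun x => - f (- x)).
Proof.
move=> [mf bf Ff]; have mfo : measurable_fun setT (fun x => f (- x)).
  exact: measurableT_comp mf mopp.
have bfo : locally_bounded (fun x => f (- x)).
  by move=> M; have [C hC] := bf M; exists C => x xM; apply: hC; rewrite normrN.
split; [exact: measurable_funN|exact: locally_boundedN|move=> a b ab].
have := @Rintegral_opp `[- b, - a] f (measurable_itv _) (locally_bounded_integrable _ _ mf bf).
rewrite oppR_itv_cc !opprK => -[_ E].
rewrite -opprB Ff ?lerN2// -E -mulN1r -RintegralZl//; last exact: locally_bounded_integrable.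
by apply: eq_Rintegral => x _; rewrite mulN1r.
Qed.

Lemma ae_opp (P : R -> Prop) : {ae @lebesgue_measure R, forall x, P x} ->
  {ae @lebesgue_measure R, forall x, P (- x)}.
Proof.
move=> [N [mN N0 PN]]; exists (oppR @^-1` N); split.
- exact: measurable_opp_set.
- by rewrite -N0 -[RHS]lebesgue_measure_opp.
- by move=> x /= Px; apply: PN.
Qed.

Lemma jost_kernelN (k : R[i]) x : jost_kernel k (- x) = - jost_kernel k x.
Proof.
rewrite /jost_kernel; case: ifP => _; first exact: realcN.
by rewrite realcN mulrN /csin [in LHS]mulrN opprK -!mulNr opprB.
Qed.

(** The kernel is odd, which accounts for the opposite signs of the integrals in the two Volterra
    equations. The left Jost solution thus needs no analysis of its own. *)
Lemma is_jost_minus_opp (U : R -> R) (k : R[i]) f :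
  is_jost_minus U k f -> is_jost_plus (fun x => U (- x)) k (fun x => f (- x)).
Proof.
move=> H x; have [i1 e1] := H (- x).
have [i2 e2] := cintegral_opp (measurable_itv _) i1; rewrite oppR_itv_yc opprK in i2 e2; rewrite opprK in e1.
have E : (fun y => jost_kernel k (y - x) * (U (- y))%:C * f (- y)) =
    fun y : R => -1 * (jost_kernel k (- y + x) * (U (- y))%:C * f (- y)).
  apply/funext => y; rewrite (_ : - y + x = - (y - x)) ?jost_kernelN; last by ring.
  ring.
rewrite /= E; split; first exact: cintegrableZ.
by rewrite cintegralZ// e2 [in LHS]e1 realcN mulrN opprK mulN1r.
Qed.

Lemma is_jost_plus_opp (U : R -> R) (k : R[i]) f :
  is_jost_plus (fun x => U (- x)) k f -> is_jost_minus U k (fun x => f (- x)).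
Proof.
move=> H x; have [i1 e1] := H (- x).
have [i2 e2] := cintegral_opp (measurable_itv _) i1; rewrite oppR_itv_cy opprK in i2 e2; rewrite opprK in e1.
have E : (fun y => jost_kernel k (y - x) * (U y)%:C * f (- y)) =
    fun y : R => -1 * (jost_kernel k (- y + x) * (U (- - y))%:C * f (- y)).
  apply/funext => y; rewrite (_ : - y + x = - (y - x)) ?jost_kernelN; last by ring.
  by rewrite opprK; ring.
rewrite /= E; split; first exact: cintegrableZ.
by rewrite cintegralZ// e2 [in LHS]e1 realcN mulrN mulN1r opprK.
Qed.

Lemma modulated_opp b d (V Ph Ph1 S : R -> R) : modulated b d V Ph Ph1 S ->
  modulated b d (fun x => V (- x)) (fun x => Ph (- x)) (fun x => - Ph1 (- x)) (fun x => S (- x)).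
Proof.
move=> [? ? ? ? h1 h2 h3 h4 h5 h6]; split => //.
- exact: primitive_opp.
- by apply: primitive_eq (primitiveN (primitive_opp h2)) => x //; rewrite opprK sqrrN.
- exact: measurableT_comp h3 mopp.
- by move=> x; have := h4 (- x); rewrite normrN.
- by move=> x; have := h5 (- x); rewrite !normrN.
- by move=> x; have := h6 (- x); rewrite normrN.
Qed.

End Reflection.

(** * The Wronskian and the poles of the transmission coefficient *)

Section ComplexDifferentiation.
Context {R : realType}.
Implicit Types (k l c z a u : R[i]) (F G : R[i] -> R[i]) (r e : R).
Local Notation C := (R[i] : numFieldType).
Local Arguments Normc.normc : simpl never.

Lemma numnormE z : `|z| = (normc z)%:C.
Proof. by rewrite normc_def; case: z. Qed.

Lemma nbhs_normc (P : set R[i]) k r : 0 < r ->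
  (forall l, normc (l - k) < r -> P l) -> nbhs (k : C) P.
Proof.
move=> r0 H; apply/nbhs_ballP; exists (r%:C) => /=; first by rewrite ltcR.
by move=> l; rewrite /ball/= numnormE ltcR normcB_sym => /H.
Qed.

Lemma dnbhs_normc (P : set R[i]) k r : 0 < r ->
  (forall l, l != k -> normc (l - k) < r -> P l) -> (k : C)^' P.
Proof. by move=> r0 H; apply: (nbhs_normc r0) => l lr lk; exact: H. Qed.

(** A first-order expansion with quadratic remainder is what the contraction argument delivers. It
    is stable under sums and products, and gives complex differentiability as well as continuity
    along the imaginary axis. *)
Definition qdiff F k a := exists2 N, 0 <= N & exists2 r, 0 < r &
  forall l, normc (l - k) < r -> normc (F l - F k - (l - k) * a) <= N * normc (l - k) ^+ 2.

Lemma qdiff_derivable F k a : qdiff F k a -> derivable (F : C^o -> C^o) k 1.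
Proof.
move=> [N N0 [r r0 H]]; apply/cvg_ex; exists (a : C^o).
apply/cvgrPdist_le => /= e e0.
have [e1 e1' e1E] : exists2 e1 : R, 0 < e1 & e = e1%:C.
  exists (Re e); first by move: e0; rewrite ltcE => /andP[].
  by move: e0; rewrite ltcE => /andP[/eqP h _]; apply: complex_eqP => //=.
apply: (dnbhs_normc (r := Num.min r (e1 / (N + 1)))).
  by rewrite lt_min r0 divr_gt0// ltr_wpDl.
move=> h h0; rewrite subr0 lt_min => /andP[hr he]; rewrite /= numnormE e1E lecR.
have := H (h + k); rewrite addrK => /(_ hr) Hh.
have -> : a - h^-1 * (F (h * 1 + k) - F k) = - h^-1 * (F (h + k) - F k - h * a).
  by rewrite mulr1; field.
rewrite normcM normcN Normc.normcV.
have nh : 0 < normc h by rewrite lt_neqAle normc_ge0 andbT eq_sym normc_eq0.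
rewrite (le_trans (ler_wpM2l _ Hh)) ?invr_ge0 ?normc_ge0//.
rewrite (_ : (normc h)^-1 * (N * normc h ^+ 2) = N * normc h); last by field; rewrite gt_eqF.
rewrite (le_trans (ler_wpM2l N0 (ltW he)))// mulrA ler_pdivrMr ?ltr_wpDl//.
by rewrite mulrC ler_wpM2l ?(ltW e1')// lerDl.
Qed.

Lemma qdiff_cst c k : qdiff (fun=> c) k 0.
Proof.
exists 0 => //; exists 1 => // l _; rewrite subrr mulr0 subr0 Normc.normc0 mul0r//.
Qed.

Lemma qdiff_id k : qdiff id k 1.
Proof.
exists 0 => //; exists 1 => // l _; rewrite mulr1 subrr Normc.normc0 mul0r//.
Qed.

Lemma qdiffD F G k a u : qdiff F k a -> qdiff G k u -> qdiff (fun l => F l + G l) k (a + u).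
Proof.
move=> [N N0 [r r0 H]] [M M0 [s s0 H']]; exists (N + M); first exact: addr_ge0.
exists (Num.min r s) => [|l]; rewrite lt_min ?r0// => /andP[lr ls].
rewrite (_ : _ - _ = (F l - F k - (l - k) * a) + (G l - G k - (l - k) * u)); last by ring.
by rewrite (le_trans (le_normcD _ _))// [in leRHS]mulrDl lerD ?H ?H'.
Qed.

Lemma qdiffM F G k a u : qdiff F k a -> qdiff G k u ->
  qdiff (fun l => F l * G l) k (a * G k + F k * u).
Proof.
move=> [N N0 [r r0 H]] [M M0 [s s0 H']].
exists (N * normc (G k) + normc (F k) * M + (N + normc a) * (M + normc u)).
  by rewrite !addr_ge0 ?mulr_ge0 ?addr_ge0 ?normc_ge0.
exists (Num.min (Num.min r s) 1) => [|l]; first by rewrite !lt_min r0 s0 ltr01.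
rewrite !lt_min => /andP[/andP[lr ls] l1].
have hF := H l lr; have hG := H' l ls.
have n0 := normc_ge0 (l - k).
have sq : normc (l - k) ^+ 2 <= normc (l - k) by rewrite expr2 ler_piMr// ltW.
have hFl : normc (F l - F k) <= (N + normc a) * normc (l - k).
  rewrite -[F l - F k](subrK ((l - k) * a)) (le_trans (le_normcD _ _))// [in leRHS]mulrDl lerD//.
    by rewrite (le_trans hF)// ler_wpM2l.
  by rewrite normcM mulrC.
have hGl : normc (G l - G k) <= (M + normc u) * normc (l - k).
  rewrite -[G l - G k](subrK ((l - k) * u)) (le_trans (le_normcD _ _))// [in leRHS]mulrDl lerD//.
    by rewrite (le_trans hG)// ler_wpM2l.
  by rewrite normcM mulrC.
rewrite (_ : _ - _ = (F l - F k - (l - k) * a) * G k + F k * (G l - G k - (l - k) * u) +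
   (F l - F k) * (G l - G k)); last by ring.
rewrite (le_trans (le_normcD _ _))// [in leRHS]mulrDl lerD//.
  rewrite (le_trans (le_normcD _ _))// [in leRHS]mulrDl lerD//.
    by rewrite normcM mulrAC ler_wpM2r ?normc_ge0.
  by rewrite normcM -mulrA ler_wpM2l ?normc_ge0.
rewrite normcM (le_trans (ler_pM _ _ hFl hGl)) ?normc_ge0//.
by rewrite le_eqVlt; apply/orP; left; apply/eqP; ring.
Qed.

Lemma qdiffZ F k a c : qdiff F k a -> qdiff (fun l => c * F l) k (c * a).
Proof. by move=> /(qdiffM (qdiff_cst c k)); rewrite mul0r add0r. Qed.

Lemma qdiffN F k a : qdiff F k a -> qdiff (fun l => - F l) k (- a).
Proof.
move=> /(qdiffZ (-1)); rewrite mulN1r.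
by rewrite (_ : (fun l => -1 * F l) = (fun l => - F l))//; apply/funext => l; rewrite mulN1r.
Qed.

(** Near [k0], [normc (F k)] is pinched between two multiples of [normc (k - k0)]: the lower one
    excludes other zeros, hence holomorphy on a punctured disc; the upper one makes the quotient
    blow up, [k0 != 0] keeping the numerator away from 0. *)
Lemma simple_zero_pole (t F : R[i] -> R[i]) c k0 a r : 0 < r -> c != 0 -> k0 != 0 ->
  F k0 = 0 -> a != 0 -> qdiff F k0 a ->
  (forall k, normc (k - k0) < r -> exists u, qdiff F k u) ->
  (forall k, normc (k - k0) < r -> t k = c * k / F k) -> is_pole t k0.
Proof.
move=> r0 c0 k00 F0 a0 [N N0 [s s0 H]] HF Ht.
have na : 0 < normc a by rewrite lt_neqAle normc_ge0 andbT eq_sym normc_eq0.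
have nc : 0 < normc c by rewrite lt_neqAle normc_ge0 andbT eq_sym normc_eq0.
have nk : 0 < normc k0 by rewrite lt_neqAle normc_ge0 andbT eq_sym normc_eq0.
pose q := Num.min (Num.min r s) (normc a / (2 * (N + 1))).
have q0 : 0 < q by rewrite !lt_min r0 s0 divr_gt0// mulr_gt0// ltr_wpDl.
have Fge l : normc (l - k0) < q -> normc a / 2 * normc (l - k0) <= normc (F l) <= 2 * normc a * normc (l - k0).
  rewrite !lt_min => /andP[/andP[lr ls] la]; have := H l ls; rewrite F0 subr0 => h.
  have n0 := normc_ge0 (l - k0).
  have h2 : N * normc (l - k0) ^+ 2 <= normc a / 2 * normc (l - k0).
    rewrite expr2 mulrA ler_wpM2r//; move: la; rewrite ltr_pdivlMr ?mulr_gt0 ?ltr_wpDl// => la.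
    rewrite ler_pdivlMr//; nra.
  have h3 := le_normcD (F l - (l - k0) * a) ((l - k0) * a).
  have h4 := le_normcD ((l - k0) * a - F l) (F l).
  rewrite subrK !normcM in h3; rewrite subrK normcB_sym !normcM in h4.
  by apply/andP; split; nra.
have Fn0 l : l != k0 -> normc (l - k0) < q -> F l != 0.
  move=> lk /Fge /andP[h _]; rewrite -normc_eq0 gt_eqF// (lt_le_trans _ h)//.
  by rewrite mulr_gt0 ?divr_gt0// lt_neqAle normc_ge0 andbT eq_sym normc_eq0 subr_eq0.
have qr : q <= r by rewrite !ge_min lexx.
clearbody q; split.
  apply: (dnbhs_normc q0) => l lk lq.
  have lr := lt_le_trans lq qr.
  have [u qu] := HF l lr.
  have dl : 0 < r - normc (l - k0) by rewrite subr_gt0.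
  have D : derivable ((fun l => c * l / F l) : C^o -> C^o) l 1.
    apply: derivableM; first by exact: qdiff_derivable (qdiffZ c (qdiff_id l)).
    by apply: derivableV; [exact: Fn0|exact: qdiff_derivable qu].
  apply: near_eq_derivable D; apply: (nbhs_normc dl) => m ml.
  rewrite Ht// -(subrK l m) -addrA (le_lt_trans (le_normcD _ _))//.
  by rewrite -ltrBrDr.
apply/cvgryPge => A.
pose A1 := `|A| + 1; have A10 : 0 < A1 by rewrite ltr_wpDl.
(* The radius ensures both [normc l >= normc k0 / 2] and [A1 * (2 * normc a * normc (l - k0)) <=
   normc c * normc k0 / 2]. *)
pose p := Num.min (Num.min q (normc k0 / 2)) (normc c * normc k0 / (4 * normc a * A1)).
apply: (dnbhs_normc (r := p)); first by rewrite !lt_min q0 !divr_gt0 ?mulr_gt0.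
move=> l lk; rewrite !lt_min => /andP[/andP[lq l2] lA].
have lr := lt_le_trans lq qr.
rewrite Ht// !normcM Normc.normcV.
have Fl := Fge l lq; have := Fn0 l lk lq; rewrite -normc_eq0 => Fl0.
have Fl1 : 0 < normc (F l) by rewrite lt_neqAle eq_sym Fl0 normc_ge0.
rewrite ler_pdivlMr// (@le_trans _ _ (A1 * normc (F l)))//.
  by rewrite ler_wpM2r ?normc_ge0// (le_trans (ler_norm A))// lerDl.
have nl : normc k0 / 2 <= normc l.
  have := le_normcD (k0 - l) l; rewrite subrK normcB_sym; lra.
case/andP: Fl => _ Fl.
apply: (@le_trans _ _ (normc c * (normc k0 / 2))); last by rewrite ler_wpM2l ?normc_ge0.
move: lA; rewrite ltr_pdivlMr ?mulr_gt0// => lA.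
have := ler_wpM2l (ltW A10) Fl; lra.
Qed.

End ComplexDifferentiation.

(** * Expansions of the Wronskian in [k] and in [d] *)

Section WronskianAnalysis.
Context {R : realType}.
Implicit Types (k l c z : R[i]) (f g h w : R -> R[i]) (x y N M : R).
Local Arguments Normc.normc : simpl never.
Local Arguments cexp : simpl never.
Local Arguments ctail : simpl never.
Local Arguments Jop : simpl never.
Local Arguments jenv : simpl never.
Local Arguments jp : simpl never.

Lemma cprimitive_cderive1 f g h x : cprimitive f g -> cprimitive g h -> cderive1 f x = g x.
Proof.
move=> [f1 f2] [g1 g2]; rewrite /cderive1 !derive1E.
have c1 := primitive_continuous g1; have c2 := primitive_continuous g2.
have [_ ->] := primitive_is_derive f1 (c1 x).
have [_ ->] := primitive_is_derive f2 (c2 x).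
by rewrite complex_eta.
Qed.

Lemma cprimitive_opp f g : cprimitive f g ->
  cprimitive (fun x => f (- x)) (fun x => - g (- x)).
Proof.
move=> [f1 f2]; split.
  by apply: primitive_eq (primitive_opp f1) => // x; rewrite ReN.
by apply: primitive_eq (primitive_opp f2) => // x; rewrite ImN.
Qed.

Lemma normc_MDM (A B C D : R) k l c z : normc k <= A -> normc l <= B ->
  normc c <= C -> normc z <= D -> normc (k * l + c * z) <= A * B + C * D.
Proof.
move=> h1 h2 h3 h4; rewrite (le_trans (le_normcD _ _))// !normcM.
by rewrite lerD// ler_pM ?normc_ge0.
Qed.

Lemma wronskianE f g (f1 g1 : R[i]) x : cderive1 f x = f1 -> cderive1 g x = g1 ->
  wronskian f g x = f x * g1 - g x * f1.
Proof. by move=> <- <-. Qed.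

(** Reflection flips the sign of the drift [P] at the origin, so the two contributions [P * (m * n)]
    cancel. *)
Lemma wronskian_algebra (e E P I k m n w v : R[i]) : E * e ^+ 2 = 1 ->
  e * m * - (e * ((- P + I * k) * n - E * v)) -
  e * n * (e * ((P + I * k) * m - E * w)) =
  - (e ^+ 2 * (2 * I * k * (m * n) - E * (m * v + n * w))).
Proof. by move=> Ee; ring. Qed.

Lemma Im_real_algebra (y u1 u2 u3 u4 u5 : R) :
  Im (2 * 'i%C * ('i%C * y%:C) * (u1%:C * u2%:C) -
      u5%:C * (u1%:C * u4%:C + u2%:C * u3%:C)) = 0.
Proof.
have -> : 2 * 'i%C * ('i%C * y%:C) * (u1%:C * u2%:C) -
      u5%:C * (u1%:C * u4%:C + u2%:C * u3%:C) =
      (- (2 * y * (u1 * u2)) - u5 * (u1 * u4 + u2 * u3))%:C.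
  by apply: complex_eqP; rewrite /=; ring.
by [].
Qed.

Lemma expR_sub1_le2 (t D : R) : `|t| <= D -> `|t| <= 4^-1 ->
  `|expR (- 2 * t) - 1| <= 4 * D.
Proof.
move=> tD t4; have hn : `|- 2 * t| = 2 * `|t| by rewrite mulNr normrN normrM [`|2|]ger0_norm.
have h : `|- 2 * t| <= 2^-1 by rewrite hn; lra.
by have := expR_sub1_le h; rewrite hn; lra.
Qed.

Lemma wconst_algebra (b d c j : R) : c * d * (24 * d / b) <= c * (24 / b) * d ->
  2 * (288 * d / b ^+ 2) + 2 * (1 * (c * d * 2 + 2 * (c * d))) +
  2 * (c * d * (24 * d / b) + 2 * (j * d) + (c * d * (24 * d / b) + 2 * (j * d))) <=
  (576 / b ^+ 2 + 8 * c + 2 * (48 / b * c + 4 * j)) * d.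
Proof. lra. Qed.

Section OneSide.
Variables (b d : R) (V Ph Ph1 S : R -> R).
Hypothesis HM : modulated b d V Ph Ph1 S.
Local Notation msol := (msol b Ph Ph1 S).
Local Notation wsol := (wsol b Ph Ph1 S).

Let b0 : 0 < b. Proof. by case: HM. Qed.
Let d0 : 0 <= d. Proof. by case: HM. Qed.

(** [jconst * d] is the bound of [wsol_derivative] on the derivative of [wsol] in [k]. *)
Definition jconst := 4 / b * (48 / b + 8).

Lemma jconst_gt0 : 0 < jconst.
Proof. by rewrite mulr_gt0 ?divr_gt0// addr_gt0 ?divr_gt0. Qed.

Lemma jregion_interior k : 0 < Im k -> normc k < 1 ->
  exists2 r, 0 < r & forall l, normc (l - k) < r -> jregion l /\ 0 < Im l.
Proof.
move=> k0 k1; exists (Num.min (Im k) (1 - normc k)); first by rewrite lt_min k0 subr_gt0.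
move=> l; rewrite lt_min => /andP[h1 h2].
have h3 := normr_Im_le (l - k); rewrite ImD ImN in h3.
have : 0 < Im l by have := le_lt_trans h3 h1; rewrite ltr_norml => /andP[]; lra.
move=> il; split => //; split; first exact: ltW.
by have := le_normcD (l - k) k; rewrite subrK; lra.
Qed.

Lemma wsol0_qdiff k : 0 < Im k -> normc k < 1 ->
  exists2 D, normc D <= jconst * d & qdiff (fun l => wsol l 0) k D.
Proof.
move=> k0 k1; have [r r0 rH] := jregion_interior k0 k1.
have [kr _] : jregion k /\ 0 < Im k by apply: rH; rewrite subrr Normc.normc0.
have [D [_ DN] [N N0 H]] := wsol_derivative HM kr.
exists (D 0); first by have := DN 0; rewrite mulr0 expR0 mulr1.
exists N => //; exists r => // l /rH[lr _].
by have [_ /(_ 0)] := H l lr; rewrite mulr0 expR0 mulr1.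
Qed.

Lemma msol0_qdiff k : 0 < Im k -> normc k < 1 ->
  exists2 D, normc D <= 4 * jconst / b * d & qdiff (fun l => msol l 0) k D.
Proof.
move=> k0 k1; have [r r0 rH] := jregion_interior k0 k1.
have [kr _] : jregion k /\ 0 < Im k by apply: rH; rewrite subrr Normc.normc0.
have [D DN [N N0 H]] := wsol_derivative HM kr.
exists (Bop Ph D 0).
  have [_ /(_ 0)] := cdecay_B HM DN; rewrite mulr0 expR0 mulr1.
  by rewrite -/jconst (_ : 4 * (jconst * d) / b = 4 * jconst / b * d)//; ring.
exists (4 * N / b); first by rewrite divr_ge0 ?mulr_ge0// ltW.
exists r => // l /rH[lr _].
have [_ /(_ 0)] := cdecay_B HM (H l lr); rewrite mulr0 expR0 mulr1.
have wd := cdecayB (cdecay_wsol HM lr) (cdecay_wsol HM kr).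
have -> : Bop Ph (fun x => wsol l x - wsol k x - (l - k) * D x) 0 =
    msol l 0 - msol k 0 - (l - k) * Bop Ph D 0.
  have e1 := congr1 (fun f => f 0) (BopD HM (cdecayB wd (cdecayZ (l - k) DN)) (cdecayZ (l - k) DN)).
  have e2 := congr1 (fun f => f 0) (BopD HM wd (cdecay_wsol HM kr)).
  have e3 := congr1 (fun f => f 0) (BopZ HM (l - k) DN).
  rewrite /= in e1 e2 e3; rewrite /msol.
  have E1 : (fun x => wsol l x - wsol k x - (l - k) * D x + (l - k) * D x) = (fun x => wsol l x - wsol k x).
    by apply/funext => x; rewrite subrK.
  have E2 : (fun x => wsol l x - wsol k x + wsol k x) = wsol l by apply/funext => x; rewrite subrK.
  rewrite E1 in e1; rewrite E2 in e2; rewrite e2 e1 e3; ring.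
by move=> h; apply: (le_trans h); rewrite le_eqVlt; apply/orP; left; apply/eqP; ring.
Qed.

Lemma msol_conj k : jregion k -> msol (- conjc k) = fun x => conjc (msol k x).
Proof.
move=> kr; rewrite /msol (wsol_conj HM kr) /Bop; apply/funext => x.
rewrite conjcD -(congr1 (fun f => f x) (ctail_conj b0 (cdecay_EN HM (cdecay_wsol HM kr)))).
congr (_ + ctail _ x); first by apply: complex_eqP; rewrite /= ?oppr0.
by apply/funext => y; rewrite conjcM conjcR.
Qed.

Lemma normc_msol0 k : jregion k -> normc (msol k 0 - 1) <= 96 * d / b ^+ 2 /\ normc (msol k 0) <= 2.
Proof.
move=> kr; have [_ /(_ 0)] := cdecay_Bwsol HM kr; rewrite mulr0 expR0 mulr1.
have := normc_msol_le HM 0 kr; rewrite mulr0 expR0.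
by move=> h1 h2; split; rewrite /msol ?[1 + _ - 1]addrC ?addKr//.
Qed.

Lemma normc_wsol0 k : jregion k -> normc (wsol k 0) <= 24 * d / b.
Proof. by move=> kr; have [_ /(_ 0)] := cdecay_wsol HM kr; rewrite mulr0 expR0 mulr1. Qed.

(* The leading term of [wsol k 0] is the integral of [S] over the half-line. *)
Lemma wsol0_approx k : jregion k -> normc k <= d ^+ 2 ->
  normc (wsol k 0 - (tail S 0)%:C) <=
   (2 / b * (12 + 192 / b ^+ 2) + 8 / b ^+ 2) * d ^+ 3.
Proof.
move=> kr kd; have [k0 _] := kr.
have S0 : cdecay b (d ^+ 2) (fun x => (S x)%:C).
  split; first by apply: cmeasurable_real; exact: mod_mS HM.
  by move=> x; rewrite normc_real (le_trans (mod_Sd HM x))// ler_wpM2l ?sqr_ge0// (expR_absle HM).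
have dd : d <= 1 by rewrite (le_trans (mod_d4 HM))// invf_le1 ?ler1n.
have d3 : d ^+ 4 <= d ^+ 3 by rewrite exprS ler_piMl ?exprn_ge0.
(* All parts of [dl] have order at least three in [d]: [expR (2 * Ph) - 1] and [S] are each of order
   two, [msol k - 1] of order one, and in [k * G1] the assumption [normc k <= d ^+ 2] supplies two
   orders. *)
pose dl x := G Ph Ph1 S k x * msol k x - (S x)%:C.
have dlN : cdecay b ((12 + 192 / b ^+ 2) * d ^+ 3) dl.
  split.
    apply: cmeasurableD; first by case: (cdecay_Gm HM kr kr).
    by apply: cmeasurableN; case: S0.
  move=> x.
  have -> : dl x = (expR (2 * Ph x) - 1)%:C * (S x)%:C +
      (expR (2 * Ph x))%:C * (S x)%:C * Bop Ph (wsol k) x + k * (G1 Ph Ph1 x * msol k x).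
    rewrite /dl /G realcB realcM /msol; move: (Bop _ _ x) (G1 _ _ x) => A B; ring.
  have [hP1 hP2] := normr_Ph_le HM x; have hS := mod_Sd HM x.
  have e1 := expR_absle1 HM x; have e2 := expR_absle HM x.
  have e0 := expR_ge0 (- b * `|x|).
  have h1 : normc ((expR (2 * Ph x) - 1)%:C * (S x)%:C) <= 4 * d ^+ 3 * expR (- b * x).
    rewrite normcM !normc_real.
    have h : `|expR (2 * Ph x) - 1| <= 4 * d ^+ 2.
      rewrite (le_trans (expR_sub1_le _))// normrM ger0_norm//; first by lra.
      by rewrite mulrA -natrM ler_wpM2l// (le_trans hP1)// ler_piMr// sqr_ge0.
    rewrite (le_trans (ler_pM _ _ h hS))// (_ : 4 * d ^+ 2 * _ = 4 * d ^+ 4 * expR (- b * `|x|)); last by ring.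
    by rewrite ler_pM ?mulr_ge0 ?exprn_ge0// ler_wpM2l.
  have h2 : normc ((expR (2 * Ph x))%:C * (S x)%:C * Bop Ph (wsol k) x) <= 192 / b ^+ 2 * d ^+ 3 * expR (- b * x).
    have [_ /(_ x) hB] := cdecay_Bwsol HM kr.
    have [hE _] := expR_Ph_le2 HM x.
    rewrite !normcM !normc_real [`|expR _|]ger0_norm ?expR_ge0//.
    have hS' : `|S x| <= d ^+ 2 by rewrite (le_trans hS)// ler_piMr// sqr_ge0.
    rewrite (le_trans (ler_pM _ _ (ler_pM _ _ hE hS') hB)) ?mulr_ge0 ?expR_ge0 ?normc_ge0//.
    by rewrite le_eqVlt; apply/orP; left; apply/eqP; ring.
  have h3 : normc (k * (G1 Ph Ph1 x * msol k x)) <= 8 * d ^+ 3 * expR (- b * x).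
    have [_ /(_ x) hG] := cdecay_G1m HM kr.
    rewrite normcM (le_trans (ler_pM _ _ kd hG)) ?normc_ge0//.
    by rewrite le_eqVlt; apply/orP; left; apply/eqP; ring.
  rewrite (le_trans (le_normcD _ _))// (le_trans (lerD (le_normcD _ _) (lexx _)))//.
  rewrite (le_trans (lerD (lerD h1 h2) h3))// le_eqVlt; apply/orP; left; apply/eqP; ring.
(* At [k = 0] the operator is plain integration of the tail. The resolvent identity between 0 and
   [k] then costs [normc k] times a function of order [d ^+ 2], hence order four. *)
have JS : Jop 0 (fun x => (S x)%:C) 0 = (tail S 0)%:C.
  rewrite /Jop (_ : - (2 * 'i%C * 0) * _ = 0) ?cexp0 ?mul1r; last by rewrite mulr0.
  have -> : (fun y => cexp (2 * 'i%C * 0 * y%:C) * (S y)%:C) = (fun y => (S y)%:C).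
    by apply/funext => y; rewrite mulr0 mul0r cexp0 mul1r.
  apply: complex_eqP => //=.
  by rewrite /Rintegral integral0.
have E : wsol k 0 = Jop k dl 0 + Jop k (fun x => (S x)%:C) 0.
  rewrite [in LHS](wsolE HM kr) -(congr1 (fun f => f 0) (JopD b0 k0 dlN S0)).
  by congr (Jop k _ 0); apply/funext => y; rewrite subrK.
have J0 := cdecay_Jop b0 (lexx 0 : 0 <= Im (0 : R[i])) S0.
have := Jop_resolvent b0 (lexx 0 : 0 <= Im (0 : R[i])) k0 S0 0.
rewrite JS subr0 E -addrA => ->.
rewrite (le_trans (le_normcD _ _))// [in leRHS]mulrDl lerD//.
  have [_ /(_ 0)] := cdecay_Jop b0 k0 dlN; rewrite mulr0 expR0 mulr1 => h.
  by rewrite (le_trans h)// le_eqVlt; apply/orP; left; apply/eqP; ring.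
have [_ /(_ 0)] := cdecay_Jop b0 k0 J0; rewrite mulr0 expR0 mulr1 => h.
rewrite normcM normcM normc_2i (le_trans (ler_pM _ _ (ler_wpM2l _ kd) h)) ?mulr_ge0 ?normc_ge0//.
rewrite (_ : 2 * d ^+ 2 * (2 * (2 * d ^+ 2 / b) / b) = 8 / b ^+ 2 * d ^+ 4); last by field; rewrite gt_eqF.
by rewrite ler_wpM2l// divr_ge0// exprn_ge0// ltW.
Qed.

End OneSide.

Section TwoSides.
Variables (b d : R) (V Ph Ph1 S : R -> R).
Hypothesis HM : modulated b d V Ph Ph1 S.
Let HN := modulated_opp HM.

Let b0 : 0 < b. Proof. by case: HM. Qed.
Let d0 : 0 <= d. Proof. by case: HM. Qed.
Let d1 : d <= 1.
Proof. by rewrite (le_trans (mod_d4 HM))// invf_le1 ?ler1n. Qed.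

Let mp k := msol b Ph Ph1 S k 0.
Let wp k := wsol b Ph Ph1 S k 0.
Let mm k := msol b (fun x => Ph (- x)) (fun x => - Ph1 (- x)) (fun x => S (- x)) k 0.
Let wm k := wsol b (fun x => Ph (- x)) (fun x => - Ph1 (- x)) (fun x => S (- x)) k 0.
Let E0 : R[i] := (expR (- 2 * Ph 0))%:C.

(* The Wronskian at 0 of the two Jost solutions is [- exp (2 Ph 0) * Wf k]; the
   left one is the right one of the reflected potential [x |-> V (- x)]. *)
Definition Wf k := 2 * 'i%C * k * (mp k * mm k) - E0 * (mp k * wm k + mm k * wp k).

(** [wconst * d] bounds the deviation of the derivative of [Wf] from [2 * 'i%C]; what matters is
    that [wconst] depends on [b] alone. *)
Definition wconst : R := 576 / b ^+ 2 + 8 * (4 * jconst b / b) +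
  2 * (48 / b * (4 * jconst b / b) + 4 * jconst b).

Let normc_E0 : normc E0 <= 2.
Proof. by rewrite normc_real ger0_norm ?expR_ge0//; case: (expR_Ph_le2 HM 0). Qed.

Let normc_mm1 k : jregion k -> normc (mp k * mm k - 1) <= 288 * d / b ^+ 2.
Proof.
move=> kr; have [h1 h2] := normc_msol0 HM kr; have [h3 h4] := normc_msol0 HN kr.
rewrite (_ : mp k * mm k - 1 = (mp k - 1) * mm k + (mm k - 1)); last by ring.
rewrite (le_trans (le_normcD _ _))// normcM.
rewrite (le_trans (lerD (ler_pM _ _ h1 h4) h3)) ?normc_ge0//.
by rewrite le_eqVlt; apply/orP; left; apply/eqP; ring.
Qed.

(** The [2 * 'i%C] comes from differentiating the explicit [k], since [mp k * mm k] is close to 1;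
    every other term contains a [wsol] or a derivative in [k], of order [d]. *)
Lemma Wf_qdiff k : 0 < Im k -> normc k < 1 ->
  exists2 a, normc (a - 2 * 'i%C) <= wconst * d & qdiff Wf k a.
Proof.
move=> k0 k1; have kr : jregion k by split; exact: ltW.
have [D1 n1 q1] := msol0_qdiff HM k0 k1; have [D2 n2 q2] := msol0_qdiff HN k0 k1.
have [D3 n3 q3] := wsol0_qdiff HM k0 k1; have [D4 n4 q4] := wsol0_qdiff HN k0 k1.
have qid := qdiffZ (2 * 'i%C) (qdiff_id k).
have q12 := qdiffM q1 q2.
have q := qdiffD (qdiffM qid q12) (qdiffN (qdiffZ E0 (qdiffD (qdiffM q1 q4) (qdiffM q2 q3)))).
eexists; last exact: q.
have [h1 h2] := normc_msol0 HM kr; have [h3 h4] := normc_msol0 HN kr.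
have h5 := normc_wsol0 HM kr; have h6 := normc_wsol0 HN kr.
have hm := normc_mm1 kr.
rewrite -/(mp k) -/(mm k) -/(wp k) -/(wm k) in h1 h2 h3 h4 h5 h6 hm *.
set c := 4 * jconst b / b in n1 n2; set j := jconst b in n3 n4.
have j0 : 0 <= j := ltW (jconst_gt0 HM).
have c0 : 0 <= c by rewrite /c divr_ge0// ?(ltW b0)// mulr_ge0.
rewrite (_ : _ - 2 * 'i%C = 2 * 'i%C * (mp k * mm k - 1) + 2 * 'i%C * (k * (D1 * mm k + mp k * D2))
   - E0 * (D1 * wm k + mp k * D4 + (D2 * wp k + mm k * D3))); last by ring.
have e1 : normc (2 * 'i%C * (mp k * mm k - 1)) <= 2 * (288 * d / b ^+ 2).
  by rewrite normcM normc_2i ler_wpM2l.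
have e2 : normc (2 * 'i%C * (k * (D1 * mm k + mp k * D2))) <= 2 * (1 * (c * d * 2 + 2 * (c * d))).
  rewrite normcM normc_2i ler_wpM2l// normcM ler_pM ?normc_ge0 ?(ltW k1)//.
  exact: (normc_MDM n1 h4 h2 n2).
have e3 : normc (E0 * (D1 * wm k + mp k * D4 + (D2 * wp k + mm k * D3))) <=
    2 * (c * d * (24 * d / b) + 2 * (j * d) + (c * d * (24 * d / b) + 2 * (j * d))).
  rewrite normcM ler_pM ?normc_ge0// (le_trans (le_normcD _ _))//.
  by apply: lerD; [exact: (normc_MDM n1 h6 h2 n4)|exact: (normc_MDM n2 h5 h4 n3)].
rewrite (le_trans (le_normcD _ _))// normcN (le_trans (lerD (le_normcD _ _) (lexx _)))//.
rewrite (le_trans (lerD (lerD e1 e2) e3))//.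
have e4 : c * d * (24 * d / b) <= c * (24 / b) * d.
  rewrite (_ : _ * _ = c * (24 / b) * d * d); last by ring.
  by rewrite ler_piMr// mulr_ge0// mulr_ge0// divr_ge0// ltW.
exact: wconst_algebra.
Qed.

Let E0e : E0 * (expR (Ph 0))%:C ^+ 2 = 1.
Proof.
rewrite /E0 -realcX -realcM -expRM_natl -expRD (_ : _ + _ = 0) ?expR0//.
by rewrite mulNr mulr_natl addNr.
Qed.

Lemma jf_wronskian k :
  let jm := jf b (fun x => Ph (- x)) (fun x => - Ph1 (- x)) (fun x => S (- x)) k 0 in
  let jm1 := jf1 b (fun x => Ph (- x)) (fun x => - Ph1 (- x)) (fun x => S (- x)) k 0 in
  jf b Ph Ph1 S k 0 * - jm1 - jm * jf1 b Ph Ph1 S k 0 = - ((expR (Ph 0))%:C ^+ 2 * Wf k).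
Proof.
rewrite -(wronskian_algebra (Ph1 0)%:C 'i%C k (mp k) (mm k) (wp k) (wm k) E0e).
rewrite /jf1 /jf /jp /jenv -/(mp k) -/(mm k) -/(wp k) -/(wm k).
by rewrite !oppr0 -/(mp k) -/(mm k) -/(wp k) -/(wm k) -/E0 !mulr0 !cexp0 !mulr1 realcN.
Qed.

Lemma Wf_transmission (CV : R) (U : R -> R) k :
  (forall x, `|V x| <= CV * expR (- b * `|x|)) -> measurable_fun setT U ->
  {ae @lebesgue_measure R, forall x, U x = V x} -> jregion k -> 0 < Im k ->
  transmission U k = 2 * 'i%C * E0 * k / Wf k.
Proof.
move=> VC mU UV kr k0.
have UVo := ae_opp UV.
have mUo : measurable_fun setT (fun x => U (- x)).
  exact: measurableT_comp mU (@oppr_measurable R setT).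
have VCo x : `|V (- x)| <= CV * expR (- b * `|x|) by have := VC (- x); rewrite normrN.
have CV0 : 0 <= CV by have := VC 0; rewrite normr0 mulr0 expR0 mulr1; exact: le_trans.
have Ub : {ae @lebesgue_measure R, forall x, `|U x| <= CV * expR (- b * x)}.
  apply: ae_mono UV => x ->; rewrite (le_trans (VC x))// ler_wpM2l//; exact: (expR_absle HM).
have Ubo : {ae @lebesgue_measure R, forall x, `|U (- x)| <= CV * expR (- b * x)}.
  apply: ae_mono UVo => x ->; rewrite (le_trans (VCo x))// ler_wpM2l//; exact: (expR_absle HM).
have J1 := jf_jost_plus HM VC mU UV kr k0.
have J2 := jf_jost_plus HN VCo mUo UVo kr k0.
have -> : transmission U k = - (2 * 'i%C * k) / wronskian (jf b Ph Ph1 S k)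
   (fun x => jf b (fun x => Ph (- x)) (fun x => - Ph1 (- x)) (fun x => S (- x)) k (- x)) 0.
  (* Existence shows that each [xget] picks a solution and uniqueness identifies it; for the left
     solution both are transported by reflection. *)
  rewrite /transmission /jost_plus /jost_minus; congr (_ / wronskian _ _ 0).
    case: xgetP => [f _ /= Hf|/(_ _ J1)//].
    exact: (jost_plus_unique b0 Ub k0 Hf J1).
  case: xgetP => [f _ /= /is_jost_minus_opp Hf|/(_ _ (is_jost_plus_opp J2))//].
  have E := jost_plus_unique b0 Ubo k0 Hf J2.
  by apply/funext => x; have := congr1 (fun f => f (- x)) E; rewrite /= opprK.
have p1 := jf_primitive HM kr; have p2 := jf1_primitive HM kr.
have p3 := jf_primitive HN kr; have p4 := jf1_primitive HN kr.
have c1 := cprimitive_cderive1 0 p1 p2.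
have c2 := cprimitive_cderive1 0 (cprimitive_opp p3) (cprimitiveN (cprimitive_opp p4)).
rewrite oppr0 in c2.
rewrite (wronskianE c1 c2) oppr0 jf_wronskian invrN mulrNN invfM.
rewrite (_ : _ ^- 2 = E0); first by ring.
rewrite -[LHS]mul1r -E0e mulfK// expf_neq0//.
by rewrite -normc_eq0 normc_real gt_eqF// normr_gt0 gt_eqF ?expR_gt0.
Qed.

(** On the imaginary axis [- conjc k = k], so the conjugation symmetry makes [msol k] and [wsol k]
    real, and ['i%C * k] is real too. *)
Lemma Wf_real (y : R) : 0 <= y -> y <= 1 -> Im (Wf ('i%C * y%:C)) = 0.
Proof.
move=> y0 y1; set k := 'i%C * y%:C.
have kr : jregion k.
  split; first by rewrite ImM /= mul0r add0r mul1r.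
  by rewrite normcM normc_i mul1r normc_real ger0_norm.
have kk : - conjc k = k by apply: complex_eqP; rewrite !(ReN, ImN) /k /=; ring.
have rm (f : R[i] -> R -> R[i]) : f (- conjc k) = (fun x => conjc (f k x)) -> exists u, f k 0 = u%:C.
  rewrite kk => /(congr1 (fun f => f 0)) /=; case: (f k 0) => u v /= [] h.
  by exists u; apply: complex_eqP => //=; lra.
have [u1 r1] := rm _ (msol_conj HM kr); have [u3 r3] := rm _ (wsol_conj HM kr).
have [u2 r2] := rm _ (msol_conj HN kr); have [u4 r4] := rm _ (wsol_conj HN kr).
by rewrite /Wf /mp /mm /wp /wm r1 r2 r3 r4; exact: Im_real_algebra.
Qed.

Definition approx_const1 : R := 2 / b * (12 + 192 / b ^+ 2) + 8 / b ^+ 2.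
Definition approx_const2 : R := 576 / b ^+ 2 + 384 / b + 192 / b ^+ 2 * (b^-1 + approx_const1) +
  2 * approx_const1.

(** [mp], [mm] and [E0] are replaced by 1, and [wp], [wm] by the half-line integrals of [S]. Each
    replacement costs three orders in [d], two of which come, for the term [2 * y], from
    [y <= d ^+ 2]. *)
Lemma Wf_approx (y : R) : 0 <= y -> y <= d ^+ 2 ->
  normc (Wf ('i%C * y%:C) + (2 * y + (tail S 0 + tail (fun x => S (- x)) 0))%:C) <=
  approx_const2 * d ^+ 3.
Proof.
move=> y0 yd; set k := 'i%C * y%:C; set T1 := tail S 0; set T2 := tail _ 0.
have d2 : d ^+ 2 <= 1 by rewrite expr_le1.
have nk : normc k = y by rewrite normcM normc_i mul1r normc_real ger0_norm.
have kr : jregion k.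
  split; first by rewrite ImM /= mul0r add0r mul1r.
  by rewrite nk (le_trans yd).
have kd : normc k <= d ^+ 2 by rewrite nk.
set c1 := approx_const1.
have a1 : normc (wp k - T1%:C) <= c1 * d ^+ 3 := wsol0_approx HM kr kd.
have a2 : normc (wm k - T2%:C) <= c1 * d ^+ 3 := wsol0_approx HN kr kd.
have c10 : 0 <= c1 * d ^+ 3 := le_trans (normc_ge0 _) a1.
have c1p : 0 <= c1 by rewrite /c1 /approx_const1 !(addr_ge0, mulr_ge0, invr_ge0, exprn_ge0, ltW b0)//.
have d3 : d ^+ 3 <= d ^+ 2 by rewrite exprS ler_piMl ?sqr_ge0.
have tS (Q : R -> R) : measurable_fun setT Q -> (forall x, `|Q x| <= d ^+ 2 * expR (- b * `|x|)) ->
    `|tail Q 0| <= d ^+ 2 / b.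
  move=> mQ hQ; have eQ : edecay b (d ^+ 2) Q.
    split => // x; rewrite (le_trans (hQ x))// ler_wpM2l ?sqr_ge0//; exact: (expR_absle HM).
  by have := normr_tail_le 0 b0 eQ; rewrite mulr0 expR0 mulr1.
have t1 : `|T1| <= d ^+ 2 / b := tS _ (mod_mS HM) (mod_Sd HM).
have t2 : `|T2| <= d ^+ 2 / b := tS _ (mod_mS HN) (mod_Sd HN).
(* For small [k] this sharpens the bound on [wsol k 0] from order one to order two, as needed where
   it multiplies [mp k - 1], which is only of order one. *)
have wb (w : R[i]) (T : R) : normc (w - T%:C) <= c1 * d ^+ 3 -> `|T| <= d ^+ 2 / b ->
    normc w <= (b^-1 + c1) * d ^+ 2.
  move=> h h'; rewrite -(subrK T%:C w) (le_trans (le_normcD _ _))// normc_real.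
  have : c1 * d ^+ 3 <= c1 * d ^+ 2 by rewrite ler_wpM2l.
  lra.
have w1 := wb _ _ a1 t1; have w2 := wb _ _ a2 t2.
have [h1 h2] := normc_msol0 HM kr; have [h3 h4] := normc_msol0 HN kr.
have h5 := normc_wsol0 HM kr; have h6 := normc_wsol0 HN kr.
have hm := normc_mm1 kr.
rewrite -/(mp k) -/(mm k) -/(wp k) -/(wm k) in h1 h2 h3 h4 h5 h6 *.
have i2 : 2 * 'i%C * k = - (2 * y%:C).
  by rewrite /k mulrA -[2 * 'i%C * 'i%C]mulrA -expr2 sqr_i mulrN1 mulNr.
rewrite (_ : _ + _ = - ((2 * y%:C) * (mp k * mm k - 1)) - ((E0 - 1) * (mp k * wm k + mm k * wp k)
    + ((mp k - 1) * wm k + (mm k - 1) * wp k)) - ((wp k - T1%:C) + (wm k - T2%:C))); last first.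
  by rewrite /Wf i2 !realcD realcM realc_nat; ring.
have e1 : normc ((2 * y%:C) * (mp k * mm k - 1)) <= 576 / b ^+ 2 * d ^+ 3.
  rewrite -realc_nat -realcM normcM normc_real ger0_norm ?mulr_ge0//.
  rewrite (le_trans (ler_pM _ _ (ler_wpM2l _ yd) hm)) ?mulr_ge0 ?normc_ge0//.
  by rewrite le_eqVlt; apply/orP; left; apply/eqP; ring.
have e2 : normc ((E0 - 1) * (mp k * wm k + mm k * wp k)) <= 384 / b * d ^+ 3.
  have hE : normc (E0 - 1) <= 4 * d ^+ 2.
    rewrite (_ : E0 - 1 = (expR (-2 * Ph 0) - 1)%:C) ?normc_real; last by rewrite realcB.
    have [hP1 hP2] := normr_Ph_le HM 0; rewrite normr0 mulr0 expR0 mulr1 in hP1.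
    exact: expR_sub1_le2.
  have hw : normc (mp k * wm k + mm k * wp k) <= 2 * (24 * d / b) + 2 * (24 * d / b).
    exact: (normc_MDM h2 h6 h4 h5).
  rewrite normcM (le_trans (ler_pM _ _ hE hw)) ?normc_ge0//.
  by rewrite le_eqVlt; apply/orP; left; apply/eqP; ring.
have e3 : normc ((mp k - 1) * wm k + (mm k - 1) * wp k) <= 192 / b ^+ 2 * (b^-1 + c1) * d ^+ 3.
  apply: (le_trans (normc_MDM h1 w2 h3 w1)).
  by rewrite le_eqVlt; apply/orP; left; apply/eqP; ring.
rewrite (le_trans (le_normcD _ _))// normcN (le_trans (lerD (le_normcD _ _) (le_normcD _ _)))//.
rewrite !normcN (le_trans (lerD (lerD e1 (le_trans (le_normcD _ _) (lerD e2 e3))) (lerD a1 a2)))//.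
by rewrite /approx_const2 -/c1 le_eqVlt; apply/orP; left; apply/eqP; ring.
Qed.

End TwoSides.

End WronskianAnalysis.

(** * The zero of the Wronskian on the imaginary axis *)

Section Pole.
Context {R : realType}.
Implicit Types (k l : R[i]) (x y : R).
Local Arguments Normc.normc : simpl never.

Lemma qdiff_Re_continuous (F : R[i] -> R[i]) y a : qdiff F ('i%C * y%:C) a ->
  {for y, continuous (fun t : R => Re (F ('i%C * t%:C)))}.
Proof.
move=> [N N0 [r r0 H]]; apply/cvgrPdist_le => /= e e0.
pose L := N * r + normc a + 1.
have L0 : 0 < L by rewrite ltr_wpDl// addr_ge0 ?normc_ge0// mulr_ge0// ltW.
near=> t.
have tn : normc ('i%C * t%:C - 'i%C * y%:C) = `|y - t|.
  by rewrite -mulrBr normcM normc_i mul1r -realcB normc_real distrC.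
have tr : `|y - t| < r by near: t; exact: cvgr_dist_lt.
have te : `|y - t| <= e / L by near: t; apply: cvgr_dist_le => //; rewrite divr_gt0.
have := H ('i%C * t%:C); rewrite tn => /(_ tr) h.
have h1 := normr_Re_le (F ('i%C * t%:C) - F ('i%C * y%:C)).
rewrite ReD ReN in h1; rewrite distrC (le_trans h1)//.
rewrite -(subrK (('i%C * t%:C - 'i%C * y%:C) * a) (F _ - F _)).
rewrite (le_trans (le_normcD _ _))// normcM tn (le_trans (lerD h (lexx _)))//.
have -> : N * `|y - t| ^+ 2 + `|y - t| * normc a = `|y - t| * (N * `|y - t| + normc a) by ring.
have h2 : N * `|y - t| + normc a <= L.
  by rewrite /L -addrA lerD ?ler_wpM2l ?(ltW tr)// lerDl.
rewrite (le_trans (ler_wpM2l (normr_ge0 _) h2))//.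
by rewrite -ler_pdivlMr.
Unshelve. all: by end_near. Qed.

Section Zero.
Variables (b d : R) (V Ph Ph1 S : R -> R).
Hypothesis HM : modulated b d V Ph Ph1 S.

Let d1 : d < 1.
Proof. by rewrite (le_lt_trans (mod_d4 HM))// invf_lt1 ?ltr1n. Qed.

Let d21 : d ^+ 2 < 1.
Proof. by rewrite expr_lt1// (mod_d HM). Qed.

(** The real function [g] is [tau - 2 * y] up to an error of at most [tau / 2]: it is at least
    [tau / 4] at [tau / 8] and at most [- tau / 2] at [tau]. The left endpoint is positive because
    the expansions in [k], and with them continuity, hold for [0 < Im k]. *)
Lemma Wf_zero (tau : R) : tau = - (tail S 0 + tail (fun x => S (- x)) 0) -> 0 < tau ->
  tau <= d ^+ 2 -> approx_const2 b * d ^+ 3 <= tau / 2 ->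
  exists kappa : R, [/\ 0 < kappa, kappa <= d ^+ 2, Wf b Ph Ph1 S ('i%C * kappa%:C) = 0 &
    `|2 * kappa - tau| <= approx_const2 b * d ^+ 3].
Proof.
move=> tauE tau0 taud taub.
have [g gW] : exists g : R -> R, forall y, g y = Re (Wf b Ph Ph1 S ('i%C * y%:C)).
  by exists (fun y => Re (Wf b Ph Ph1 S ('i%C * y%:C))).
have le : tau / 8 <= tau by lra.
have gE y : 0 <= y -> y <= d ^+ 2 -> `|g y + (2 * y - tau)| <= approx_const2 b * d ^+ 3.
  move=> y0 yd; rewrite (le_trans _ (Wf_approx HM y0 yd))// tauE opprK gW.
  by have := normr_Re_le (Wf b Ph Ph1 S ('i%C * y%:C) + (2 * y + (tail S 0 + tail (fun x => S (- x)) 0))%:C); rewrite ReD.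
have g1 : 0 <= g (tau / 8).
  have := gE (tau / 8); rewrite ler_norml.
  move: (g (tau / 8)) (approx_const2 b * d ^+ 3) taub => u v hv h.
  have /h h' : 0 <= tau / 8 by lra.
  have /h'/andP[] : tau / 8 <= d ^+ 2 by lra.
  lra.
have g2 : g tau <= 0.
  have := gE tau (ltW tau0) taud; rewrite ler_norml.
  by move: (g tau) (approx_const2 b * d ^+ 3) taub => u v hv /andP[]; lra.
have cg : {within `[tau / 8, tau], continuous g}.
  apply: continuous_in_subspaceT => y; rewrite inE /= in_itv /= => /andP[y1 y2].
  have y0 : 0 < y by lra.
  have i0 : 0 < Im ('i%C * y%:C) by rewrite ImM /= mul0r add0r mul1r.
  have i1 : normc ('i%C * y%:C) < 1.
    by rewrite normcM normc_i mul1r normc_real gtr0_norm// (le_lt_trans y2)// (le_lt_trans taud).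
  have [a _ q] := Wf_qdiff HM i0 i1.
  have -> : g = (fun y => Re (Wf b Ph Ph1 S ('i%C * y%:C))) by apply/funext.
  exact: qdiff_Re_continuous q.
have [|kap] := @IVT R g (tau / 8) tau 0 le cg.
  by rewrite ge_min g2 le_max g1 !orbT.
rewrite in_itv /= => /andP[k1 k2] gk.
have k0 : 0 < kap by lra.
have kd : kap <= d ^+ 2 by lra.
exists kap; split => //.
  apply: complex_eqP; first by rewrite -gW gk.
  by apply: (Wf_real HM (ltW k0)); rewrite (le_trans kd)// ltW.
by have := gE kap (ltW k0) kd; rewrite gk add0r.
Qed.

Lemma Wf_zero_pole (CV : R) (U : R -> R) (kappa : R) :
  (forall x, `|V x| <= CV * expR (- b * `|x|)) -> measurable_fun setT U ->
  {ae @lebesgue_measure R, forall x, U x = V x} -> wconst b * d < 2 ->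
  0 < kappa -> kappa <= d ^+ 2 -> Wf b Ph Ph1 S ('i%C * kappa%:C) = 0 ->
  is_pole (transmission U) ('i%C * kappa%:C).
Proof.
move=> VC mU UV wd k0 kd W0; set k := 'i%C * kappa%:C.
have i0 : 0 < Im k by rewrite ImM /= mul0r add0r mul1r.
have i1 : normc k < 1.
  by rewrite normcM normc_i mul1r normc_real gtr0_norm// (le_lt_trans kd).
have [r r0 rH] := jregion_interior i0 i1.
have [s s0 sH] : exists2 s, 0 < s & forall l, normc (l - k) < s -> normc l < 1.
  exists (1 - normc k); first by rewrite subr_gt0.
  by move=> l h; have := le_normcD (l - k) k; rewrite subrK; lra.
have [a aE aq] := Wf_qdiff HM i0 i1.
(* If [a] were 0, its distance to [2 * 'i%C] would be 2, against [wconst b * d < 2]. *)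
have nz : a != 0.
  apply: contraTneq aE => ->; rewrite sub0r normcN normc_2i -ltNge//.
apply: (simple_zero_pole (c := 2 * 'i%C * (expR (-2 * Ph 0))%:C) (r := Num.min r s) _ _ _ W0 nz aq).
- by rewrite lt_min r0.
- rewrite !mulf_neq0 ?pnatr_eq0//.
    by rewrite -normc_eq0 normc_i oner_neq0.
  by rewrite -normc_eq0 normc_real gt_eqF// normr_gt0 gt_eqF ?expR_gt0.
- by apply: contraTneq i0; rewrite -/k => ->; rewrite ltxx.
- move=> l; rewrite lt_min => /andP[/rH[_ l0] /sH l1].
  by have [u _ qu] := Wf_qdiff HM l0 l1; exists u.
move=> l; rewrite lt_min => /andP[/rH[lr l0] _].
exact: (Wf_transmission HM VC mU UV lr l0).
Qed.

End Zero.

End Pole.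

(** * The du Bois-Reymond lemma *)

Section SmoothStep.
Context {R : realType}.
Implicit Types (f g : R -> R) (x a b c : R).

(** All the derivatives of $e^{-1/x}$ are linear combinations of this family, which is closed under
    differentiation; smoothness at 0 then rests on one estimate, uniform in shape over [m]. *)
Definition flat m x : R := if 0 < x then x^-1 ^+ m * expR (- x^-1) else 0.

Lemma flat_ge0 m x : 0 <= flat m x.
Proof.
rewrite /flat; case: ifPn => // x0.
by rewrite mulr_ge0 ?expR_ge0// exprn_ge0// invr_ge0 ltW.
Qed.

(** With $w = 1/x$, this is $e^w \ge w^{m+2}/(m+2)!$. The exponent 2 is what forces a zero
    derivative at 0. *)
Lemma flat_le m x : flat m x <= (m.+2)`!%:R * x ^+ 2.
Proof.
rewrite /flat; case: ifPn => [x0|_]; last by rewrite mulr_ge0// sqr_ge0.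
have w0 : 0 < x^-1 by rewrite invr_gt0.
rewrite expRN ler_pdivrMr ?expR_gt0//.
have h : x^-1 ^+ m.+2 / (m.+2)`!%:R <= expR x^-1.
  by rewrite (le_trans _ (expR_ge1Dxn m.+1 (ltW w0)))// lerDr.
rewrite (le_trans _ (ler_wpM2l (mulr_ge0 (ler0n _ _) (sqr_ge0 x)) h))//.
have f0 : (m.+2)`!%:R != 0 :> R by rewrite pnatr_eq0 -lt0n fact_gt0.
rewrite !exprS expr0 le_eqVlt; apply/orP; left; apply/eqP.
by field; rewrite f0 gt_eqF.
Qed.

Lemma is_derive_quadratic f x C : (forall y, `|f y - f x| <= C * (y - x) ^+ 2) ->
  is_derive x (1 : R) f 0.
Proof.
move=> H.
have C0 : 0 <= C by have := le_trans (normr_ge0 _) (H (x + 1)); rewrite [x + 1]addrC addrK expr1n mulr1.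
have lim : h^-1 *: (f (h *: (1 : R) + x) - f x) @[h --> (0:R)^'] --> (0 : R).
  apply/cvgrPdist_le => /= e e0; near=> h.
  have h0 : h != 0 by near: h; exact: nbhs_dnbhs_neq.
  rewrite sub0r normrN normrZ normfV ler_pdivrMl ?normr_gt0// [h *: _]mulr1.
  rewrite (le_trans (H _))// addrK -[h ^+ 2]ger0_norm ?sqr_ge0// normrX.
  rewrite [leRHS]mulrC expr2 mulrA ler_wpM2r//.
  have hC : `|h| <= e / (C + 1).
    near: h; apply: dnbhs0_le; rewrite divr_gt0// ltr_wpDl//.
  rewrite ler_pdivlMr ?ltr_wpDl// in hC; by apply: le_trans hC; rewrite mulrC ler_wpM2l// lerDl.
apply: DeriveDef; first by apply/cvg_ex; exists 0.
exact: cvg_lim.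
Unshelve. all: by end_near. Qed.

Lemma flat_is_derive m x : is_derive x (1 : R) (flat m) (flat m.+2 x - m%:R * flat m.+1 x).
Proof.
have [x0|x0|x0] := ltgtP x 0.
- have -> : flat m.+2 x - m%:R * flat m.+1 x = 0.
    by rewrite /flat ltNge (ltW x0) /= mulr0 subr0.
  have D0 : is_derive x (1 : R) (cst (0 : R)) 0 by exact: is_derive_cst.
  apply: near_eq_is_derive D0.
  near=> y; have y0 : y < 0 by near: y; exact: lt_nbhsl.
  by rewrite /flat ltNge (ltW y0).
- pose g (w : R) : R := w ^+ m * expR (- w).
  have D1 : is_derive x (1:R) (fun y : R => y^-1) (- x ^- 2 *: (1 : R)).
    by apply: is_deriveV; rewrite gt_eqF.
  have D2 : is_derive x^-1 (1:R) g (m%:R * x^-1 ^+ m.-1 * expR (- x^-1) - x^-1 ^+ m * expR (- x^-1)).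
    have DX := @is_deriveX _ _ id m x^-1 1 1 (is_derive_id x^-1 (1 : R)).
    rewrite (_ : id ^+ m = fun w : R => w ^+ m) in DX; last first.
      by apply/funext => w; elim: m {g} => [|m IH] //; rewrite exprS [RHS]exprS -IH.
    have DE : is_derive x^-1 (1 : R) (fun w : R => expR (- w)) (- expR (- x^-1)).
      by apply: is_derive_eq; rewrite /GRing.scale /=; ring.
    by apply: is_derive_eq (is_deriveM DX DE) _; rewrite /GRing.scale /=; ring.
  have D3 := is_derive1_comp D2 D1.
  apply: (@near_eq_is_derive _ _ _ (g \o (fun y => y^-1))).
    near=> y; have y0 : 0 < y by near: y; exact: lt_nbhsr.
    by rewrite /flat y0.
  apply: is_derive_eq; rewrite /flat x0 [- _ *: _]mulr1 -exprVn.
  by case: m {g D2 D3} => [|m]; rewrite /= ?exprS; ring.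
rewrite x0; have -> : flat m.+2 0 - m%:R * flat m.+1 0 = 0 by rewrite /flat ltxx mulr0 subr0.
apply: (@is_derive_quadratic _ _ (m.+2)`!%:R) => y.
by rewrite {2}/flat ltxx !subr0 ger0_norm ?flat_ge0// flat_le.
Unshelve. all: by end_near. Qed.

Definition smooth f := forall (n : nat) x, derivable (derive1n n f) x 1.

(** A class of functions closed under differentiation, so that smoothness is an induction on the
    order and requires no formula for higher derivatives. *)
Inductive bump : (R -> R) -> Prop :=
| bump_flat m k : bump (fun x => flat m x * flat k (1 - x))
| bumpD f g : bump f -> bump g -> bump (fun x => f x + g x)
| bumpZ c f : bump f -> bump (fun x => c * f x).

Lemma bump_derive f : bump f ->
  exists2 f', bump f' & forall x, is_derive x (1 : R) f (f' x).
Proof.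
elim=> [m k|{}f g _ [f' bf Df] _ [g' bg Dg]|c {}f _ [f' bf Df]].
- exists (fun x => (flat m.+2 x * flat k (1 - x) + - m%:R * (flat m.+1 x * flat k (1 - x))) +
    (-1 * (flat m x * flat k.+2 (1 - x)) + k%:R * (flat m x * flat k.+1 (1 - x)))).
    by do !(exact: bump_flat || apply: bumpD || apply: bumpZ).
  move=> x.
  have D1 : is_derive x (1 : R) (fun y : R => 1 - y) (- 1).
    by apply: is_derive_eq; rewrite add0r mul1r.
  have D2 := @is_derive1_comp _ (flat k) (fun y => 1 - y) _ _ _ (flat_is_derive k (1 - x)) D1.
  have D := is_deriveM (flat_is_derive m x) D2.
  by apply: is_derive_eq D _; rewrite /GRing.scale /=; ring.
- exists (fun x => f' x + g' x); first exact: bumpD.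
  by move=> x; exact: is_deriveD.
exists (fun x => c * f' x); first exact: bumpZ.
by move=> x; have := is_deriveZ c (Df x).
Qed.

Lemma bump_smooth f : bump f -> smooth f.
Proof.
move=> + n; elim: n f => [|n IH] f bf x.
  by have [f' _ /(_ x)[]] := bump_derive bf.
rewrite derive1Sn; have [f' bf' Df] := bump_derive bf.
have -> : derive1 f = f' by apply/funext => y; rewrite derive1E; have [_ ->] := Df y.
exact: IH.
Qed.

Lemma smooth_derive f f' : (forall x, is_derive x (1 : R) f (f' x)) -> smooth f' -> smooth f.
Proof.
move=> Df sf' [|n] x; first by have [] := Df x.
rewrite derive1Sn.
have -> : derive1 f = f' by apply/funext => y; rewrite derive1E; have [_ ->] := Df y.
exact: sf'.
Qed.

Lemma smooth_is_derive f : smooth f -> forall x, is_derive x (1 : R) f (derive1 f x).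
Proof. by move=> sf x; rewrite derive1E; split => //; exact: (sf 0%N). Qed.

Lemma is_derive_affine f n a x : smooth f ->
  is_derive x (1 : R) (fun x => f (n * (x - a))) (n * derive1 f (n * (x - a))).
Proof.
move=> sf.
have D : is_derive x (1 : R) (fun x : R => n * (x - a)) n.
  have D0 : is_derive x (1 : R) (fun x : R => x - a) 1 by apply: is_derive_eq; rewrite subr0.
  by apply: is_derive_eq (is_deriveZ n D0) _; exact: mulr1.
by apply: is_derive_eq (is_derive1_comp (smooth_is_derive sf _) D) _; rewrite mulrC.
Qed.

Lemma smooth_affine2 f n c1 c2 a b : smooth f ->
  smooth (fun x => c1 * f (n * (x - a)) + c2 * f (n * (x - b))) /\
  forall x, is_derive x (1 : R) (fun x => c1 * f (n * (x - a)) + c2 * f (n * (x - b)))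
   (c1 * n * derive1 f (n * (x - a)) + c2 * n * derive1 f (n * (x - b))).
Proof.
have D f1 d1 d2 x : smooth f1 -> is_derive x (1 : R) (fun x => d1 * f1 (n * (x - a)) + d2 * f1 (n * (x - b)))
   (d1 * n * derive1 f1 (n * (x - a)) + d2 * n * derive1 f1 (n * (x - b))).
  move=> sf; have D1 := is_deriveZ d1 (is_derive_affine n a x sf).
  have D2 := is_deriveZ d2 (is_derive_affine n b x sf).
  by apply: is_derive_eq (is_deriveD D1 D2) _; rewrite /GRing.scale /= !mulrA.
move=> sf; split; last by move=> x; exact: D.
move=> k; elim: k f c1 c2 sf => [|k IH] f c1 c2 sf x.
  by have [] := D f c1 c2 x sf.
rewrite derive1Sn.
have -> : derive1 (fun x => c1 * f (n * (x - a)) + c2 * f (n * (x - b))) =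
   (fun x => c1 * n * derive1 f (n * (x - a)) + c2 * n * derive1 f (n * (x - b))).
  by apply/funext => y; rewrite derive1E; have [_ ->] := D f c1 c2 y sf.
by apply: IH => i y; rewrite -derive1Sn; exact: sf.
Qed.

(* The normalized integral of [flat 0 x * flat 0 (1 - x)]. *)
Lemma smooth_step : exists P : R -> R, exists M,
  [/\ smooth P, (forall x, x <= 0 -> P x = 0), (forall x, 1 <= x -> P x = 1),
     (forall x, 0 <= P x <= 1 /\ 0 <= derive1 P x <= M) &
     forall x, ~~ (0 < x < 1) -> derive1 P x = 0].
Proof.
pose p x := flat 0 x * flat 0 (1 - x).
have bp : bump p by exact: bump_flat.
have cp : continuous p.
  have [p' _ Dp] := bump_derive bp.
  by apply: derivable_continuous_fun => x; have [] := Dp x.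
have f1 x : flat 0 x <= 1.
  rewrite /flat; case: ifPn => // x0; rewrite expr0 mul1r -expR0 ler_expR oppr_le0 invr_ge0 ltW//.
have p0 x : 0 <= p x by rewrite mulr_ge0 ?flat_ge0.
have p1 x : p x <= 1 by rewrite -[leRHS]mul1r ler_pM ?flat_ge0.
have pz x : ~~ (0 < x < 1) -> p x = 0.
  rewrite /p /flat negb_and => /orP[/negbTE ->|]; first by rewrite mul0r.
  by rewrite -subr_gt0 => /negbTE ->; rewrite mulr0.
have bdp : locally_bounded p by move=> M; exists 1 => x _; rewrite ger0_norm.
have FF := integral_primitive 0 (continuous_measurable_fun cp) bdp.
set F := (X in primitive X p) in FF.
have DF x : is_derive x (1 : R) F (p x) by exact: primitive_is_derive FF (cp x).
have F0 : F 0 = 0 by rewrite /F lexx set_itv1 Rintegral_set1.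
have mono : forall x y, x <= y -> F x <= F y by move=> x y xy; exact: (primitive_nondecreasing FF xy).
have pcst a b : a <= b -> (forall x, a <= x -> x <= b -> p x = 0) -> F a = F b.
  move=> ab z; have [_ _ /(_ _ _ ab) h] := FF; apply/esym/eqP; rewrite -subr_eq0 h.
  rewrite (_ : Rintegral _ _ _ = \int[mu]_(x in `[a, b]) (0 : R)); last first.
    by apply: eq_Rintegral => x; rewrite inE /= in_itv /= => /andP[? ?]; rewrite z.
  by rewrite Rintegral_itv_cst// mul0r.
have Fl x : x <= 0 -> F x = 0.
  move=> x0; rewrite -F0; apply: pcst => // y _ y0; apply: pz.
  by rewrite ltNge y0.
have Fr x : 1 <= x -> F x = F 1.
  move=> x1; apply/esym/pcst => // y y1 _; apply: pz.
  by rewrite [y < 1]ltNge y1 andbF.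
(* Otherwise monotonicity would force [F] to vanish on [[0, 1]], and its derivative [p] would vanish
   at [2^-1]. *)
have I0 : 0 < F 1.
  have F2 : F 0 <= F 2^-1 by apply: mono.
  rewrite lt_neqAle -{2}F0 mono// andbT; apply/eqP => F10.
  have Fc x : 0 <= x -> x <= 1 -> F x = 0.
    by move=> x0 x1; apply/eqP; rewrite eq_le {1}F10 mono//= -{1}F0 mono.
  have : p 2^-1 = 0.
    have [_ <-] := DF 2^-1; rewrite (@near_eq_derive _ _ _ _ (cst 0)) ?derive_cst//.
    near=> y; apply: Fc; apply/ltW; near: y; [apply: lt_nbhsr|apply: lt_nbhsl]; lra.
  apply/eqP; rewrite gt_eqF// /p /flat (_ : 1 - 2^-1 = 2^-1); last by lra.
  by rewrite invr_gt0 ltr0n /= expr0 mul1r mulr_gt0 ?expR_gt0.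
pose P x := (F 1)^-1 * F x.
have DP x : is_derive x (1 : R) P ((F 1)^-1 * p x) by exact: (is_deriveZ (F 1)^-1 (DF x)).
have dP : derive1 P = fun x => (F 1)^-1 * p x.
  by apply/funext => x; rewrite derive1E; have [_ ->] := DP x.
have i0 : 0 <= (F 1)^-1 by rewrite invr_ge0 ltW.
exists P, (F 1)^-1; split.
- by apply: smooth_derive DP _; apply: bump_smooth; apply: bumpZ.
- by move=> x x0; rewrite /P (Fl _ x0) mulr0.
- by move=> x x1; rewrite /P (Fr _ x1) mulVf// gt_eqF.
- move=> x; split; last by rewrite dP mulr_ge0//= -[leRHS]mulr1 ler_wpM2l.
  rewrite /P mulrC ler_pdivlMr// mul0r ler_pdivrMr// mul1r.
  have [x0|x0] := leP x 0; first by rewrite (Fl _ x0) lexx ltW.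
  have [x1|x1] := leP 1 x; first by rewrite (Fr _ x1) lexx ltW.
  by rewrite -{1}F0 !mono// ltW.
by move=> x x01; rewrite dP pz// mulr0.
Unshelve. all: by end_near. Qed.

End SmoothStep.

(** * Weak derivatives and primitives *)

Section DuBoisReymond.
Context {R : realType}.
Implicit Types (f g h : R -> R) (x a b c N : R).

Lemma integrable_le (D : set R) f g : measurable D -> measurable_fun setT f ->
  (forall x, D x -> `|f x| <= `|g x|) -> mu.-integrable D (EFin \o g) ->
  mu.-integrable D (EFin \o f).
Proof.
move=> mD mf fg ig; have mf' : measurable_fun D (EFin \o f).
  by apply/measurable_EFinP; exact: measurable_funTS.
by apply: (@le_integrable _ _ _ mu D mD _ (EFin \o g)) => // x Dx /=; rewrite lee_fin fg.
Qed.

Lemma locally_integrable_itv h a b : locally_integrable setT h ->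
  mu.-integrable `[a, b] (EFin \o h).
Proof.
move=> [mh _ /(_ _ _ (@segment_compact R a b))H]; apply/integrableP; split.
  by apply/measurable_EFinP; exact: measurable_funTS.
by apply: le_lt_trans (H _) => //; apply: ge0_le_integral => //;
   apply/measurable_EFinP; apply: measurableT_comp => //; exact: measurable_funTS.
Qed.

Lemma integral_continuous h G : (forall a b, mu.-integrable `[a, b] (EFin \o h)) ->
  (forall a b, a <= b -> G b - G a = \int[mu]_(x in `[a, b]) h x) -> continuous G.
Proof.
move=> ih Gh x; pose a := x - 1; pose b := x + 1.
have ab : a < b by rewrite /a /b; lra.
have xab : x \in `]a, b[ by rewrite in_itv /= /a /b; lra.
have := within_continuous_continuous ab (parameterized_integral_continuous (ltW ab) (ih a b)) xab.
move=> cG; have : {for x, continuous (fun y => G a + parameterized_integral mu a y h)}.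
  by apply: cvgD; [exact: cvg_cst|exact: cG].
rewrite /prop_for /continuous_at.
have E y : a <= y -> G a + parameterized_integral mu a y h = G y.
  by move=> ay; rewrite /parameterized_integral -Gh// addrC subrK.
rewrite E; last by rewrite /a; lra.
apply: cvg_trans; apply: near_eq_cvg.
near=> y; rewrite E//; apply: ltW; near: y; apply: lt_nbhsr; rewrite /a; lra.
Unshelve. all: by end_near. Qed.

Lemma ae_exists_itv (P : R -> Prop) a b : a < b -> {ae @lebesgue_measure R, forall x, P x} ->
  exists2 x, a <= x <= b & P x.
Proof.
move=> ab aeP; apply: contrapT => nP.
have nab : (@lebesgue_measure R).-negligible `[a, b].
  by apply: negligibleS aeP => x /=; rewrite in_itv /= => xab Px; apply: nP; exists x.
have : @lebesgue_measure R `[a, b]%classic = 0%E by exact/negligibleP.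
rewrite lebesgue_measure_itv /= lte_fin ab => /eqP.
by rewrite -EFinD eqe subr_eq0 gt_eqF.
Qed.

Lemma Rintegral_subset_ge0 (A B : set R) f : measurable A -> measurable B -> A `<=` B ->
  (forall x, 0 <= f x) -> mu.-integrable B (EFin \o f) ->
  \int[mu]_(x in A) f x <= \int[mu]_(x in B) f x.
Proof.
move=> mA mB AB f0 iB; rewrite fine_le//.
- by apply: integrable_fin_num => //; exact: integrableS iB.
- exact: integrable_fin_num.
apply: ge0_subset_integral => //; first by have [] := integrableP _ _ _ iB.
by move=> x _; rewrite lee_fin.
Qed.

Lemma davg_Rintegral g a r : locally_integrable setT g -> 0 < r ->
  mu.-integrable (ball a r) (EFin \o (fun x => `|g x - g a|)) /\
  \int[mu]_(x in ball a r) `|g x - g a| = 2 * r * fine (davg g a r).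
Proof.
move=> lg r0.
have mb : measurable (ball a r : set R) by exact: measurable_ball.
have ib : mu.-integrable (ball a r) (EFin \o (fun x => `|g x - g a|)).
  apply: (@integrableS _ _ _ mu `[a - r, a + r]) => //.
    by move=> x; rewrite ball_itv /= !in_itv /= => /andP[/ltW -> /ltW ->].
  suff : mu.-integrable `[a - r, a + r] (EFin \o (fun x => g x - g a)) by move=> /integrable_norm.
  apply: integrableB_EFin => //; first exact: locally_integrable_itv.
  by apply: (@locally_bounded_integrable _ (fun=> g a)); [exact: measurable_cst|move=> M; exists `|g a|].
split => //; rewrite /davg /iavg lebesgue_measure_ball ?(ltW r0)// inver.
rewrite mulrn_eq0 /= gt_eqF// fineM//; last exact: integrable_fin_num.
by rewrite /= mulrA (_ : 2 * r = r *+ 2) ?mulfV ?mul1r// ?mulrn_eq0 ?gt_eqF// mulr_natl.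
Qed.

Lemma compact_support_integrable g (p : R -> R) K c d : locally_integrable setT g ->
  measurable_fun setT p -> (forall x, `|p x| <= K) ->
  (forall x, ~~ (c <= x <= d) -> p x = 0) ->
  mu.-integrable setT (EFin \o (fun x => g x * p x)) /\
  \int[mu]_x (g x * p x) = \int[mu]_(x in `[c, d]) (g x * p x).
Proof.
move=> lg mp pK pz.
have ig : mu.-integrable `[c, d] (EFin \o (fun x => g x * p x)).
  apply: (@integrable_le _ _ (fun x => K * g x)) => //.
  - by apply: measurable_funM => //; case: lg.
  - move=> x _; rewrite mulrC !normrM ler_wpM2r// (le_trans (pK x))//; exact: ler_norm.
  exact/integrableM_cst/locally_integrable_itv.
have E : (fun x => g x * p x) \_ `[c, d] = (fun x => g x * p x).
  apply/funext => x; rewrite patchE; case: ifPn => //.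
  by rewrite notin_setE /= in_itv /= => /negP xa; rewrite pz// mulr0.
split; last by rewrite [RHS]Rintegral_mkcond E.
rewrite -E; have := (@integrable_mkcond _ _ _ (@lebesgue_measure R) `[c, d] _ (measurable_itv _)).1 ig.
by congr (integrable _ _ _); apply/funext => x; rewrite /= !patchE; case: ifP.
Qed.

Lemma approx_unit (P : R -> R) (M N a : R) : smooth P -> 0 < N ->
  (forall x, 0 <= derive1 P x <= M) -> (forall x, ~~ (0 < x < 1) -> derive1 P x = 0) ->
  let p x := N * derive1 P (N * (x - a)) in
  [/\ continuous p, (forall x, `|p x| <= N * M) &
    forall x, ~~ (a <= x <= a + N^-1) -> p x = 0].
Proof.
move=> sP N0 pM pz p; split.
- have : smooth (derive1 P) by move=> k x; rewrite -derive1Sn; exact: sP.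
  move=> sd; apply: (@derivable_continuous_fun _ p) => x.
  by have [] := is_deriveZ N (is_derive_affine N a x sd).
- move=> x; have /andP[h1 h2] := pM (N * (x - a)).
  by rewrite ger0_norm ?mulr_ge0 ?ler_wpM2l// ltW.
move=> x xa; rewrite /p pz ?mulr0//; apply: contra xa => /andP[].
rewrite pmulr_rgt0// subr_gt0 => /ltW ->; rewrite -ltr_pdivlMl// mulr1 ltrBlDl.
by move=> /ltW.
Qed.

(* The mass of the approximate unit [N * p (N * (x - a))] sits in [[a, a + 1/N]]. *)
Lemma lebesgue_pt_approx g (P : R -> R) (M : R) a : locally_integrable setT g ->
  smooth P -> (forall x, x <= 0 -> P x = 0) -> (forall x, 1 <= x -> P x = 1) ->
  (forall x, 0 <= derive1 P x <= M) -> (forall x, ~~ (0 < x < 1) -> derive1 P x = 0) ->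
  lebesgue_pt g a ->
  (\int[mu]_x (g x * (n.+1%:R * derive1 P (n.+1%:R * (x - a))))) @[n --> \oo] --> g a.
Proof.
move=> lg sP P0 P1 pM pz lp.
have M0 : 0 <= M by have /andP[h1 h2] := pM 0; exact: le_trans h1 h2.
apply/cvgrPdist_le => /= e e0.
(* The kernel is at most [N * M] and is supported in the ball of radius [2 / N], of measure [4 / N]:
   the error is at most [4 * M] times the average deviation of [g]. *)
have [dl /= dl0 Hdl] : exists2 dl : R, 0 < dl & forall r, 0 < r -> r < dl ->
    `|fine (davg g a r)| <= e / (4 * M + 1).
  move/fine_cvgP: lp => [_ /cvgrPdist_le /(_ (e / (4 * M + 1)))].
  move=> []; first by rewrite divr_gt0// ltr_wpDl// mulr_ge0.
  move=> dl /= dl0 H; exists dl => // r r0 rd; have := H r.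
  by rewrite /ball_ /= !sub0r !normrN gtr0_norm//; apply.
near=> n.
pose N : R := n.+1%:R.
have N0 : 0 < N by rewrite ltr0n.
have N2 : 2 / N < dl.
  have : dl^-1 * 2 < n%:R by near: n; exact: nbhs_infty_gtr.
  move=> h; rewrite ltr_pdivrMr// -ltr_pdivrMl// (lt_le_trans h)//.
  by rewrite ler_nat.
have aN : a <= a + N^-1 by rewrite lerDl invr_ge0 ltW.
pose p x := N * derive1 P (N * (x - a)).
have Dp x : is_derive x (1 : R) (fun x => P (N * (x - a))) (p x) by exact: is_derive_affine.
have [cp pN pzz] := approx_unit a sP N0 pM pz.
rewrite -/p in cp pN pzz; have mp := continuous_measurable_fun cp.
have ip : \int[mu]_(x in `[a, a + N^-1]) p x = 1.
  have [_ _ <-//] := C1_primitive Dp cp.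
  have -> : a + N^-1 - a = N^-1 by rewrite addrAC subrr add0r.
  by rewrite mulfV ?gt_eqF// (P1 1)// subrr mulr0 (P0 0)// subr0.
have {}pN x : `|p x| <= N * M := pN x.
have bp : locally_bounded p by move=> K; exists (N * M) => x _; exact: pN.
have [ig0 ->] := compact_support_integrable lg mp pN pzz.
have ig : mu.-integrable `[a, a + N^-1] (EFin \o (fun x => g x * p x)).
  exact: integrableS ig0.
have ip' := locally_bounded_integrable a (a + N^-1) mp bp.
have E : \int[mu]_(x in `[a, a + N^-1]) ((g x - g a) * p x) =
    \int[mu]_(x in `[a, a + N^-1]) (g x * p x) - g a.
  rewrite -[X in _ - X]mulr1 -ip -RintegralZl// -RintegralB//.
    by apply: eq_Rintegral => x _; rewrite mulrBl.
  exact: integrableM_cst.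
rewrite distrC -E.
have iE : mu.-integrable `[a, a + N^-1] (EFin \o (fun x => (g x - g a) * p x)).
  rewrite (_ : (fun x => _) = (fun x => g x * p x - g a * p x)); last first.
    by apply/funext => x; rewrite mulrBl.
  by apply: integrableB_EFin => //; exact: integrableM_cst.
rewrite (le_trans (le_normr_Rintegral _ iE))//.
have r0 : 0 < 2 / N by rewrite divr_gt0.
have [ib eb] := davg_Rintegral a lg r0.
have sub : `[a, a + N^-1] `<=` (ball a (2 / N) : set R).
  move=> x; rewrite ball_itv /= !in_itv /= => /andP[h1 h2].
  have : N^-1 < 2 / N by rewrite ltr_pMl ?invr_gt0// ltr1n.
  by move: N^-1 (2 / N) h2 r0 => u v h2 r0 uv; apply/andP; split; lra.
have igb : mu.-integrable `[a, a + N^-1] (EFin \o (fun x => `|g x - g a|)).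
  by apply: integrableS ib => //; exact: measurable_ball.
apply: (@le_trans _ _ (\int[mu]_(x in `[a, a + N^-1]) (N * M * `|g x - g a|))).
  apply: le_Rintegral => //.
  - exact: integrable_norm.
  - exact: integrableM_cst.
  by move=> x _; rewrite normrM mulrC ler_wpM2r.
rewrite RintegralZl//.
apply: (@le_trans _ _ (N * M * (\int[mu]_(x in ball a (2 / N)) `|g x - g a|))).
  by rewrite ler_wpM2l ?mulr_ge0 ?(ltW N0)//; apply: Rintegral_subset_ge0 => //; exact: measurable_ball.
rewrite eb (_ : N * M * _ = 4 * M * fine (davg g a (2 / N))); last by field; rewrite gt_eqF.
have h := Hdl _ r0 N2; have := le_trans (ler_norm _) h.
rewrite ler_pdivlMr; last by rewrite ltr_wpDl// mulr_ge0.
apply: le_trans; rewrite mulrC ler_wpM2l//; last by rewrite lerDl.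
by rewrite fine_ge0// davg_ge0.
Unshelve. all: by end_near. Qed.

Lemma step_cvg (P : R -> R) a x : (forall x, x <= 0 -> P x = 0) -> (forall x, 1 <= x -> P x = 1) ->
  P (n.+1%:R * (x - a)) @[n --> \oo] --> ((a < x)%R%:R : R).
Proof.
move=> P0 P1; apply: cvg_near_cst; have [ax|xa] := ltP a x; near=> n; last first.
  by rewrite P0// mulr_ge0_le0// subr_le0.
rewrite P1// -ler_pdivrMr ?subr_gt0// -natr1 ler_wpDr//.
by near: n; exact: nbhs_infty_ger.
Unshelve. all: by end_near. Qed.

Lemma test_step (P : R -> R) N a b : smooth P -> 0 < N -> a <= b ->
  (forall x, x <= 0 -> P x = 0) -> (forall x, 1 <= x -> P x = 1) ->
  test_function (fun x => P (N * (x - a)) - P (N * (x - b))) /\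
  derive1 (fun x => P (N * (x - a)) - P (N * (x - b))) =
    (fun x => N * derive1 P (N * (x - a)) - N * derive1 P (N * (x - b))).
Proof.
move=> sP N0 ab P0 P1; have [s D] := smooth_affine2 N 1 (-1) a b sP.
have E : (fun x => 1 * P (N * (x - a)) + -1 * P (N * (x - b))) =
         (fun x => P (N * (x - a)) - P (N * (x - b))).
  by apply/funext => x; rewrite mul1r mulN1r.
split; last first.
  apply/funext => x; rewrite derive1E -E; have [_ ->] := D x.
  by rewrite !mul1r mulN1r mulNr.
split; first by rewrite -E.
exists (`|a| + (`|b| + N^-1)) => x.
have ha := ler_norm a; have ha' := ler_norm (- a); rewrite normrN in ha'.
have hb := ler_norm b; have hb' := ler_norm (- b); rewrite normrN in hb'.
have Ni : 0 < N^-1 by rewrite invr_gt0.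
have [x0|x0] := leP 0 x.
  rewrite (ger0_norm x0) => h; rewrite !P1 ?subrr// -ler_pdivrMl// mulr1; lra.
rewrite (ltr0_norm x0) => h; rewrite !P0 ?subrr//; rewrite pmulr_rle0//; lra.
Qed.

(** The test functions rise from 0 to 1 just right of [a] and fall back just right of [b]. As the
    steps steepen, the side of [g] tends to [g a - g b] at Lebesgue points, which are almost all
    points, and the side of [h] tends to minus its integral over [[a, b]]. *)
Lemma weak_antiderivative g h : locally_integrable setT g -> locally_integrable setT h ->
  (forall phi : R -> R, test_function phi ->
    \int[mu]_x (g x * derive1 phi x) = - \int[mu]_x (h x * phi x)) ->
  exists G, (forall a b, a <= b -> G b - G a = \int[mu]_(x in `[a, b]) h x) /\
    {ae @lebesgue_measure R, forall x, g x = G x}.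
Proof.
move=> lg lh H; have [P [M [sP P0 P1 P01 pz]]] := @smooth_step R.
have pM x : 0 <= derive1 P x <= M by case: (P01 x).
have lpt := lebesgue_differentiation lg.
have ih a b : mu.-integrable `[a, b] (EFin \o h) by exact: locally_integrable_itv.
have key a b : a < b -> lebesgue_pt g a -> lebesgue_pt g b ->
    g b - g a = \int[mu]_(x in `[a, b]) h x.
  move=> ab la lb.
  pose phi n x := P (n.+1%:R * (x - a)) - P (n.+1%:R * (x - b)).
  have L : \int[mu]_x (h x * phi n x) @[n --> \oo] --> \int[mu]_(x in `[a, b]) h x.
    have sup n x : ~~ (a <= x <= b + 1) -> phi n x = 0.
      have n0 : 0 < n.+1%:R :> R by rewrite ltr0n.
      rewrite negb_and -!ltNge /phi => /orP[xa|bx].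
        by rewrite !P0 ?subr0// pmulr_rle0// subr_le0 ltW// (lt_trans xa).
      have n1 : 1 <= n.+1%:R :> R by rewrite ler1n.
      by rewrite !P1 ?subrr// -[leLHS]mulr1 ler_pM//; lra.
    have phi1 n x : `|phi n x| <= 1.
      have [/andP[u0 u1] _] := P01 (n.+1%:R * (x - a)).
      have [/andP[v0 v1] _] := P01 (n.+1%:R * (x - b)).
      by rewrite /phi ler_norml; apply/andP; split; lra.
    have mphi n : measurable_fun setT (phi n).
      apply: continuous_measurable_fun; apply: derivable_continuous_fun => x.
      have D1 := is_derive_affine n.+1%:R a x sP; have D2 := is_derive_affine n.+1%:R b x sP.
      by have [] := is_deriveB D1 D2.
    have E n := (compact_support_integrable lh (mphi n) (phi1 n) (sup n)).2.
    under eq_fun do rewrite E.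
    (* All [phi n] are supported in [[a, b + 1]], the domain for dominated convergence. Their limit
       is the indicator of []a, b]]: each step starts at its point, where it is still 0. *)
    have -> : \int[mu]_(x in `[a, b]) h x = \int[mu]_(x in `[a, b + 1]) (h x * \1_`]a, b] x).
      rewrite -Rintegral_itv_obnd_cbnd; last first.
        by apply: integrableS (ih a b) => // x /=; rewrite !in_itv /= => /andP[/ltW -> ->].
      rewrite Rintegral_mkcond [RHS]Rintegral_mkcond; congr (Rintegral _ _ _).
      apply/funext => x; rewrite !patchE indicE !mem_setE /= !in_itv /=.
      have [ax|xa] := ltP a x; last by rewrite mulr0 if_same.
      rewrite (ltW ax) /=; have [xb|bx] := leP x b; last by rewrite mulr0 if_same.
      by rewrite mulr1 (le_trans xb)// lerDl.
    have mh : measurable_fun setT h by case: lh.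
    have m1 : measurable_fun setT (fun x : R => h x * \1_`]a, b] x).
      by apply: measurable_funM => //; exact: measurable_indic.
    apply: fine_cvg; rewrite fineK; last first.
      apply: integrable_fin_num => //.
      apply: (@integrable_le _ _ h) (ih _ _) => //.
      move=> x _; rewrite normrM -[leRHS]mulr1 ler_wpM2l//.
      by rewrite indicE; case: (_ \in _); rewrite ?normr1 ?normr0.
    apply: (@dominated_cvg _ _ _ mu `[a, b + 1] _ (fun n x => (h x * phi n x)%:E) _ (fun x => `|h x|%:E)) => //.
    - move=> n; apply/measurable_EFinP; apply: measurable_funTS.
      by apply: measurable_funM => //; exact: mphi.
    - move=> x _; apply: cvg_EFin; first by near=> n.
      apply: cvgM; first exact: cvg_cst.
      have -> : \1_`]a, b] x = (a < x)%R%:R - (b < x)%R%:R :> R.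
        rewrite indicE mem_setE /= in_itv /= [x <= b]leNgt.
        have [ax|xa] /= := ltP a x; last first.
          by rewrite ltNge (le_trans xa (ltW ab)) subrr.
        by case: ltP; rewrite ?subrr ?subr0.
      by apply: cvgB; exact: step_cvg.
    - exact: integrable_norm (ih _ _).
    by move=> n x _; rewrite lee_fin normrM -[leRHS]mulr1 ler_wpM2l.
  have := cvgB (lebesgue_pt_approx lg sP P0 P1 pM pz lb) (lebesgue_pt_approx lg sP P0 P1 pM pz la).
  set u := (X in X @ _ --> _) => L'.
  suff /(cvg_lim (@Rhausdorff R)) <- : u n @[n --> \oo] --> \int[mu]_(x in `[a, b]) h x.
    by rewrite (cvg_lim (@Rhausdorff R) (L' _)).
  apply: cvg_trans L; apply: near_eq_cvg; near=> n.
  have [t D] := test_step sP (ltr0Sn R n) (ltW ab) P0 P1.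
  have N0 : 0 < n.+1%:R :> R by rewrite ltr0n.
  have ip c : mu.-integrable setT (EFin \o (fun x => g x * (n.+1%:R * derive1 P (n.+1%:R * (x - c))))).
    have [cp pN pzz] := approx_unit c sP N0 pM pz.
    exact: (compact_support_integrable lg (continuous_measurable_fun cp) pN pzz).1.
  have := H _ t; rewrite D => E; rewrite -[LHS]opprK -E.
  rewrite -[RHS]opprB; congr (- _); rewrite -RintegralB//.
  by apply: eq_Rintegral => x _; rewrite mulrBr.
(* The base point of the primitive has to be a Lebesgue point itself, so that [key] links it to
   every other one. *)
have [a0 _ la0] := ae_exists_itv ltr01 lpt.
pose F x := if a0 <= x then \int[mu]_(y in `[a0, x]) h y
             else - \int[mu]_(y in `[x, a0]) h y.
have inc a b : a <= b -> F b - F a = \int[mu]_(x in `[a, b]) h x by exact: integral_increment.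
have F0 : F a0 = 0 by rewrite /F lexx set_itv1 Rintegral_set1.
exists (fun x => g a0 + F x); split.
  by move=> a b ab; rewrite opprD addrACA subrr add0r; exact: inc.
apply: ae_mono lpt => x lx; have [xa|ax|->] := ltgtP x a0.
- by have := key _ _ xa lx la0; rewrite -(inc _ _ (ltW xa)) -/F F0 sub0r; lra.
- by have := key _ _ ax la0 lx; rewrite -(inc _ _ (ltW ax)) -/F F0 subr0; lra.
by rewrite F0 addr0.
Unshelve. all: by end_near. Qed.

Lemma increments_locally_bounded h G : (forall a b, mu.-integrable `[a, b] (EFin \o h)) ->
  (forall a b, a <= b -> G b - G a = \int[mu]_(x in `[a, b]) h x) -> locally_bounded G.
Proof.
move=> ih Gh M; pose I := \int[mu]_(x in `[- M, M]) `|h x|; exists (`|G (- M)| + I) => x.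
rewrite ler_norml => /andP[Mx xM].
rewrite -(subrK (G (- M)) (G x)) addrC (le_trans (ler_normD _ _))// lerD2l Gh//.
rewrite (le_trans (le_normr_Rintegral _ (ih _ _)))//; apply: Rintegral_subset_ge0 => //.
  by move=> y /=; rewrite !in_itv /= => /andP[-> /le_trans]; apply.
by have /integrable_norm := ih (- M) M.
Qed.

Lemma weak_derivative_parts (g h : R -> R[i]) : weak_derivative g h ->
  (exists G1, (forall a b, a <= b -> G1 b - G1 a = \int[mu]_(x in `[a, b]) Re (h x)) /\
    {ae @lebesgue_measure R, forall x, Re (g x) = G1 x}) /\
  (exists G2, (forall a b, a <= b -> G2 b - G2 a = \int[mu]_(x in `[a, b]) Im (h x)) /\
    {ae @lebesgue_measure R, forall x, Im (g x) = G2 x}).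
Proof.
move=> [[lg1 lg2] [lh1 lh2] H]; split; apply: weak_antiderivative => // phi /H [].
- move=> h1 _; transitivity (\int[mu]_x Re (g x * (phi^`()%classic x)%:C)).
    by apply: eq_Rintegral => x _; rewrite ReM /= mulr0 subr0.
  rewrite h1; congr (- _); apply: eq_Rintegral => x _; by rewrite ReM /= mulr0 subr0.
move=> _ h2; transitivity (\int[mu]_x Im (g x * (phi^`()%classic x)%:C)).
  by apply: eq_Rintegral => x _; rewrite ImM /= mulr0 add0r.
rewrite h2; congr (- _); apply: eq_Rintegral => x _; by rewrite ImM /= mulr0 add0r.
Qed.

Lemma weak_derivative_bounded (g h : R -> R[i]) : weak_derivative g h ->
  exists G, [/\ cmeasurable G, clocally_bounded G & {ae @lebesgue_measure R, forall x, g x = G x}].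
Proof.
move=> wd; have [[G1 [h1 e1]] [G2 [h2 e2]]] := weak_derivative_parts wd.
have [_ [lh1 lh2] _] := wd.
have i1 a b : mu.-integrable `[a, b] (EFin \o (fun x => Re (h x))) by exact: locally_integrable_itv.
have i2 a b : mu.-integrable `[a, b] (EFin \o (fun x => Im (h x))) by exact: locally_integrable_itv.
exists (fun x => G1 x +i* G2 x); split.
- split; apply: continuous_measurable_fun; [exact: integral_continuous i1 h1|exact: integral_continuous i2 h2].
- by split; [exact: increments_locally_bounded i1 h1|exact: increments_locally_bounded i2 h2].
by apply: ae_mono2 e1 e2 => x; case: (g x) => /= a b -> ->.
Qed.

(** Besides identifying [g] almost everywhere with a primitive, this exchanges its weak derivative
    for a locally bounded representative, as [primitive] requires. *)
Lemma weak_derivative_primitive (g h h' : R -> R[i]) : weak_derivative g h ->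
  cmeasurable h' -> clocally_bounded h' -> {ae @lebesgue_measure R, forall x, h x = h' x} ->
  exists G, cprimitive G h' /\ {ae @lebesgue_measure R, forall x, g x = G x}.
Proof.
move=> wd [m1 m2] [b1 b2] hh; have [[G1 [h1 e1]] [G2 [h2 e2]]] := weak_derivative_parts wd.
have [_ [[mh1 _ _] [mh2 _ _]] _] := wd.
exists (fun x => G1 x +i* G2 x); split; last first.
  by apply: ae_mono2 e1 e2 => x; case: (g x) => /= a b -> ->.
split; split => // a b ab /=.
  by rewrite h1//; apply: Rintegral_ae_eq => //; apply: ae_mono hh => x ->.
by rewrite h2//; apply: Rintegral_ae_eq => //; apply: ae_mono hh => x ->.
Qed.

End DuBoisReymond.

(** * Eigenfunctions *)

Section Eigenfunctions.
Context {R : realType}.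
Implicit Types (u v z : R -> R[i]) (f g h y : R -> R) (x K : R).
Local Arguments Normc.normc : simpl never.

Lemma integral_two_tails f b N : 0 < b -> measurable_fun setT f ->
  (forall x, `|f x| <= N * expR (- b * `|x|)) ->
  mu.-integrable setT (EFin \o f) /\
  \int[mu]_x f x = tail f 0 + tail (fun x => f (- x)) 0.
Proof.
move=> b0 mf fN.
have N0 : 0 <= N by have := le_trans (normr_ge0 _) (fN 0); rewrite normr0 mulr0 expR0 mulr1.
have ed : edecay b N f.
  split => // x; rewrite (le_trans (fN x))// ler_wpM2l// ler_expR !mulNr lerN2.
  by rewrite ler_wpM2l ?ler_norm// ltW.
have edo : edecay b N (fun x => f (- x)).
  split; first exact: measurableT_comp mf (@oppr_measurable R setT).
  move=> x; rewrite (le_trans (fN _))// ler_wpM2l// ler_expR !mulNr lerN2 normrN.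
  by rewrite ler_wpM2l ?ler_norm// ltW.
have i1 := edecay_integrable 0 b0 ed.
have [i2] := Rintegral_opp (measurable_itv `[0%R, +oo[) (edecay_integrable 0 b0 edo).
have ff : (fun x => f (- - x)) = f by apply/funext => x; rewrite opprK.
rewrite ff oppR_itv_cy oppr0 => e2; rewrite ff oppR_itv_cy oppr0 in i2.
have i1' : mu.-integrable `]0, +oo[ (EFin \o f).
  by apply: integrableS i1 => // x /=; rewrite !in_itv /= !andbT => /ltW.
have E : f = (fun x => (f \_ `]0, +oo[) x + (f \_ `]-oo, 0]) x).
  apply/funext => x; rewrite !patchE !mem_setE /= !in_itv /= andbT.
  by case: ltP; rewrite ?addr0 ?add0r.
have j1 : mu.-integrable setT (EFin \o (f \_ `]0, +oo[)).
  have := (@integrable_mkcond _ _ _ (@lebesgue_measure R) _ _ (measurable_itv `]0%R, +oo[)).1 i1'.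
  by congr (integrable _ _ _); apply/funext => x; rewrite /= !patchE; case: ifP.
have j2 : mu.-integrable setT (EFin \o (f \_ `]-oo, 0])).
  have := (@integrable_mkcond _ _ _ (@lebesgue_measure R) _ _ (measurable_itv `]-oo, 0%R])).1 i2.
  by congr (integrable _ _ _); apply/funext => x; rewrite /= !patchE; case: ifP.
split; first by rewrite E; exact: integrableD_EFin.
rewrite [in LHS]E RintegralD// -!Rintegral_mkcond.
by rewrite Rintegral_itv_obnd_cbnd// /tail e2.
Qed.

Lemma locally_bounded_locally_integrable f : measurable_fun setT f -> locally_bounded f ->
  locally_integrable setT f.
Proof.
move=> mf bf; split => //; first exact: openT.
move=> K _ cK; have [M [_ /(_ (M + 1))]] := compact_bounded cK.
rewrite ltrDl => /(_ ltr01) KM.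
have /integrableP[_] := locally_bounded_integrable (- (M + 1)) (M + 1) mf bf.
apply: le_lt_trans; apply: ge0_subset_integral => //.
- exact: compact_measurable.
- by apply: measurable_funTS; apply/measurable_EFinP; exact: measurableT_comp.
by move=> x /KM; rewrite /= in_itv /= ler_norml.
Qed.

Lemma test_function_parts f g phi : primitive g f -> test_function phi ->
  \int[mu]_x (g x * derive1 phi x) = - \int[mu]_x (f x * phi x).
Proof.
move=> gf [sphi [M0 phi0]]; have Dphi := smooth_is_derive sphi.
have cphi' : continuous (derive1 phi).
  by apply: (@derivable_continuous_fun _ (derive1 phi)) => x; have := sphi 1%N x.
have pphi := C1_primitive Dphi cphi'.
pose K := `|M0| + 1.
have K0 : 0 <= K by rewrite addr_ge0.
have out x : ~~ (- K <= x <= K) -> M0 < `|x|.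
  rewrite -ler_norml -ltNge; apply: le_lt_trans.
  by rewrite (le_trans (ler_norm _))// lerDl.
have z x : ~~ (- K <= x <= K) -> phi x = 0 by move=> /out /phi0.
have z' x : ~~ (- K <= x <= K) -> derive1 phi x = 0.
  move=> /out xM; rewrite derive1E (@near_eq_derive _ _ _ _ (cst 0)) ?derive_cst//.
  near=> y; apply: phi0; near: y.
  exact: (@norm_continuous _ R^o x _ (lt_nbhsr xM)).
have zK : phi K = 0 /\ phi (- K) = 0.
  have h : M0 < `|K| by rewrite ger0_norm// ltr_pwDr// ler_norm.
  by split; apply: phi0; rewrite ?normrN.
have bnd p : locally_bounded p -> (forall x, ~~ (- K <= x <= K) -> p x = 0) ->
    exists C, forall x, `|p x| <= C.
  move=> /(_ K)[C hC] pz; exists `|C| => x.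
  have [h|/pz ->] := boolP (- K <= x <= K); last by rewrite normr0.
  by rewrite (le_trans (hC _ _)) ?ler_norml// ler_norm.
have [C hC] := bnd _ (primitive_bounded pphi) z.
have [C' hC'] : exists C, forall x, `|derive1 phi x| <= C.
  by apply: bnd z'; case: pphi.
have lg := locally_bounded_locally_integrable (primitive_measurable gf) (primitive_bounded gf).
have [mf bf _] := gf; have lf := locally_bounded_locally_integrable mf bf.
have [ig ->] := compact_support_integrable lg (continuous_measurable_fun cphi') hC' z'.
have [if_ ->] := compact_support_integrable lf (primitive_measurable pphi) hC z.
have [_ _ /(_ (- K) K)] := primitiveM gf pphi.
have -> : - K <= K by rewrite ge0_cp.
move=> /(_ isT); rewrite zK.1 zK.2 !mulr0 subrr => /esym.
have sub : `[- K, K] `<=` [set: R] by [].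
rewrite RintegralD//; [|exact: integrableS if_|exact: integrableS ig].
by move=> /eqP; rewrite addr_eq0 => /eqP ->; rewrite opprK.
Unshelve. all: by end_near. Qed.

Lemma cprimitive_weak_derivative u v : cprimitive u v -> weak_derivative u v.
Proof.
move=> [p1 p2]; have [m1 b1 _] := p1; have [m2 b2 _] := p2.
split.
- split; apply: locally_bounded_locally_integrable;
   [exact: primitive_measurable p1|exact: primitive_bounded p1
   |exact: primitive_measurable p2|exact: primitive_bounded p2].
- by split; apply: locally_bounded_locally_integrable.
move=> phi tphi; apply: complex_eqP; rewrite ?ReN ?ImN /=.
  have E1 : \int[mu]_x Re (u x * (derive1 phi x)%:C) = \int[mu]_x (Re (u x) * derive1 phi x).
    by apply: eq_Rintegral => x _; rewrite ReM /= mulr0 subr0.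
  have E2 : \int[mu]_x Re (v x * (phi x)%:C) = \int[mu]_x (Re (v x) * phi x).
    by apply: eq_Rintegral => x _; rewrite ReM /= mulr0 subr0.
  by rewrite E1 E2; exact: test_function_parts.
have E1 : \int[mu]_x Im (u x * (derive1 phi x)%:C) = \int[mu]_x (Im (u x) * derive1 phi x).
  by apply: eq_Rintegral => x _; rewrite ImM /= mulr0 add0r.
have E2 : \int[mu]_x Im (v x * (phi x)%:C) = \int[mu]_x (Im (v x) * phi x).
  by apply: eq_Rintegral => x _; rewrite ImM /= mulr0 add0r.
by rewrite E1 E2; exact: test_function_parts.
Qed.

Lemma L2_decay u B b : 0 < b -> cmeasurable u ->
  (forall x, normc (u x) <= B * expR (- b * `|x|)) -> L2 u.
Proof.
move=> b0 mu_ uB; split => //; have [m1 m2] := mu_.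
have mn : measurable_fun setT (fun x => normc (u x) ^+ 2).
  rewrite (_ : (fun x => _) = (fun x => Re (u x) * Re (u x) + Im (u x) * Im (u x))).
    by apply: measurable_funD; exact: measurable_funM.
  by apply/funext => x; rewrite normc_sqr.
have b20 : 0 < 2 * b by rewrite mulr_gt0.
have [|/integrableP[_ +] _] := @integral_two_tails _ (2 * b) (B ^+ 2) b20 mn.
- move=> x; rewrite ger0_norm ?sqr_ge0//.
  rewrite (_ : - (2 * b) * `|x| = 2%:R * (- b * `|x|)) ?expRM_natl; last by ring.
  by rewrite -exprMn ler_sqr ?nnegrE ?normc_ge0//; exact: le_trans (normc_ge0 _) (uB x).
apply: le_lt_trans; rewrite le_eqVlt; apply/orP; left; apply/eqP.
by apply: eq_integral => x _ /=; rewrite ger0_norm ?sqr_ge0.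
Qed.

(** * The equation $u'' = (V - E)u$ with bounded $V$ *)

Section System.
Variables (V : R -> R) (C E : R).
Hypothesis mV : measurable_fun setT V.
Hypothesis VC : forall x, `|V x| <= C.

Definition odesol u u1 := cprimitive u u1 /\
  cprimitive u1 (fun x => (V x - E)%:C * u x).

(** Gronwall's argument: $N = y^2 + y_1^2$ satisfies $|N'| \le L N$, so $e^{-Lx}N$ decreases to the
    right of 0 and $e^{Lx}N$ increases to the left of it, both from or towards the value 0. *)
Lemma real_ode_unique y y1 : primitive y y1 -> primitive y1 (fun x => (V x - E) * y x) ->
  y 0 = 0 -> y1 0 = 0 -> forall x, y x = 0.
Proof.
move=> py py1 y0 y10; pose L := 1 + (C + `|E|).
pose N x := y x * y x + y1 x * y1 x.
have N0 x : 0 <= N x by rewrite addr_ge0// -expr2 sqr_ge0.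
have pN := primitiveD (primitiveM py py) (primitiveM py1 py1).
set N' := (X in primitive _ X) in pN.
have N'E x : N' x = 2 * y x * y1 x * (1 + (V x - E)) by rewrite /N'; ring.
have N'L x : `|N' x| <= L * N x.
  rewrite N'E normrM mulrC ler_pM//.
    rewrite (le_trans (ler_normD _ _))// normr1 lerD2l (le_trans (ler_normB _ _))// lerD2r//.
  have := sqr_ge0 (y x - y1 x); have := sqr_ge0 (y x + y1 x).
  by rewrite /N ler_norml => h1 h2; apply/andP; split; lra.
have NE x : N x = 0 -> y x = 0.
  move=> /eqP; rewrite paddr_eq0 -?expr2 ?sqr_ge0// => /andP[/eqP h _].
  by apply/eqP; rewrite -sqrf_eq0 h.
have NE0 : N 0 = 0 by rewrite /N y0 y10 !mulr0 addr0.
move=> x; apply: NE; apply/eqP; rewrite eq_le N0 andbT.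
have [x0|/ltW x0] := leP 0 x.
  have pA := primitiveN (primitiveM (expR_lin_primitive (- L)) pN).
  have := primitive_nondecreasing pA x0.
  rewrite -/(N x) -/(N 0) NE0 mulr0 lerN2 => h.
  have : expR (- L * x) * N x <= 0.
    apply: h => t _; rewrite oppr_ge0 -mulrA mulNr mulrCA -mulrN -mulrDr.
    rewrite mulr_ge0_le0 ?expR_ge0//.
    by have := N'L t; rewrite ler_norml => /andP[_ h]; rewrite addrC subr_le0.
  by rewrite pmulr_rle0// expR_gt0.
have pA := primitiveM (expR_lin_primitive L) pN.
have := primitive_nondecreasing pA x0.
rewrite -/(N x) -/(N 0) NE0 mulr0 => h.
have : expR (L * x) * N x <= 0.
  apply: h => t _; rewrite -mulrA mulrCA -mulrDr mulr_ge0 ?expR_ge0//.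
  by have := N'L t; rewrite ler_norml => /andP[h _]; rewrite -lerBlDl sub0r.
by rewrite pmulr_rle0// expR_gt0.
Qed.

Lemma ode_unique u u1 : odesol u u1 -> u 0 = 0 -> u1 0 = 0 -> u = fun=> 0.
Proof.
move=> [[p1 p2] [q1 q2]] u0 u10; apply/funext => x; apply: complex_eqP => /=.
  apply: (real_ode_unique p1); rewrite ?u0 ?u10//.
  by apply: primitive_eq q1 => t //; rewrite ReM /= mul0r subr0.
apply: (real_ode_unique p2); rewrite ?u0 ?u10//.
by apply: primitive_eq q2 => t //; rewrite ImM /= mul0r addr0.
Qed.

(** A vanishing Wronskian makes the Cauchy data at 0 proportional. The ratio is read off [u 0], or
    off [u1 0] if [u 0 = 0]; both cannot vanish since [u] is not identically zero. *)
Lemma odesol_proportional u u1 v v1 : odesol u u1 -> odesol v v1 ->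
  u 0 * v1 0 - v 0 * u1 0 = 0 -> (exists x, u x != 0) ->
  exists c, v = (fun x => c * u x) /\ v1 = (fun x => c * u1 x).
Proof.
move=> su sv W0 [x0 ux0].
have [c [e e1]] : exists c, v 0 = c * u 0 /\ v1 0 = c * u1 0.
  have [u0|u0] := eqVneq (u 0) 0.
    have [u10|u10] := eqVneq (u1 0) 0.
      by move: ux0; rewrite (ode_unique su u0 u10) eqxx.
    exists (v1 0 / u1 0); rewrite divfK// u0 mulr0; split => //.
    move/eqP: W0; rewrite u0 mul0r sub0r oppr_eq0 mulf_eq0 (negbTE u10) orbF.
    by move/eqP.
  exists (v 0 / u 0); rewrite divfK//; split => //.
  move/eqP: W0; rewrite subr_eq0 => /eqP W0.
  by rewrite mulrAC -W0 mulrAC divff// mul1r.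
have s : odesol (fun x => v x - c * u x) (fun x => v1 x - c * u1 x).
  case: su sv => [p q] [p' q']; split; first exact: cprimitiveB p' (cprimitiveZ c p).
  by apply: cprimitive_eq (cprimitiveB q' (cprimitiveZ c q)) => x //=; ring.
have z := ode_unique s _ _; rewrite e e1 !subrr in z; have {}z := z erefl erefl.
have vE : v = fun x => c * u x.
  by apply/funext => x; apply/eqP; rewrite -subr_eq0 -[X in X == _]/((fun x => v x - c * u x) x) z.
exists c; split => //.
have [_ pz] := s.
have p0 : cprimitive (fun x => v1 x - c * u1 x) (fun=> 0).
  apply: cprimitive_eq pz => x //.
  by rewrite -[X in _ * X]/((fun x => v x - c * u x) x) z mulr0.
apply/funext => x; apply/eqP; rewrite -subr_eq0.
by rewrite (cprimitive0_cst x 0 p0) e1 subrr.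
Qed.

Lemma odesol_wronskian u u1 v v1 x : odesol u u1 -> odesol v v1 ->
  u x * v1 x - v x * u1 x = u 0 * v1 0 - v 0 * u1 0.
Proof.
move=> [p q] [p' q']; have H := cprimitiveB (cprimitiveM p q') (cprimitiveM p' q).
apply: (@cprimitive0_cst _ (fun x => u x * v1 x - v x * u1 x)).
by apply: cprimitive_eq H => t //; ring.
Qed.

Lemma measurable_normc_sqr u : cmeasurable u ->
  measurable_fun setT (fun x => (normc (u x) ^+ 2)%:E).
Proof.
move=> [m1 m2]; apply/measurable_EFinP.
rewrite (_ : (fun x => _) = (fun x => Re (u x) * Re (u x) + Im (u x) * Im (u x))).
  by apply: measurable_funD; exact: measurable_funM.
by apply/funext => x; rewrite normc_sqr.
Qed.

(** The constant [normc c] is dominated by the sum of the four integrable squares, while a positive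
    constant has infinite integral over the line. *)
Lemma L2_wronskian0 u u1 v v1 c : L2 u -> L2 u1 -> L2 v -> L2 v1 ->
  (forall x, u x * v1 x - v x * u1 x = c) -> c = 0.
Proof.
move=> [m1 i1] [m2 i2] [m3 i3] [m4 i4] H; apply/eqP; rewrite -normc_eq0; apply/eqP.
have {}m1 := measurable_normc_sqr m1; have {}m2 := measurable_normc_sqr m2.
have {}m3 := measurable_normc_sqr m3; have {}m4 := measurable_normc_sqr m4.
have nn w x : (0 <= (normc (w x) ^+ 2)%:E :> \bar R)%E by rewrite lee_fin sqr_ge0.
apply/eqP; rewrite eq_le normc_ge0 andbT leNgt; apply/negP => c0.
have : (\int[mu]_(x in [set: R]) (cst (normc c)%:E x) < +oo)%E.
  apply: (@le_lt_trans _ _ (\int[mu]_x ((normc (u x) ^+ 2)%:E + ((normc (v1 x) ^+ 2)%:E +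
      ((normc (v x) ^+ 2)%:E + (normc (u1 x) ^+ 2)%:E))))%E).
    apply: ge0_le_integral => //.
    - by move=> x _; rewrite lee_fin normc_ge0.
    - by do !(apply: emeasurable_funD => //).
    move=> x _; rewrite -!EFinD lee_fin -(H x) (le_trans (le_normcD _ _))// normcN !normcM.
    have := sqr_ge0 (normc (u x) - normc (v1 x)); have := sqr_ge0 (normc (v x) - normc (u1 x)).
    move: (normc (u x)) (normc (v1 x)) (normc (v x)) (normc (u1 x)) (sqr_ge0 (normc (u x))) => a b c' d.
    have := sqr_ge0 a; have := sqr_ge0 b; have := sqr_ge0 c'; have := sqr_ge0 d; lra.
  rewrite ge0_integralD//; last 2 first.
  - by move=> x _; rewrite !adde_ge0.
  - by do !(apply: emeasurable_funD => //).
  rewrite ge0_integralD//; last 2 first.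
  - by move=> x _; rewrite !adde_ge0.
  - by do !(apply: emeasurable_funD => //).
  apply: lte_add_pinfty => //; apply: lte_add_pinfty => //.
  by rewrite ge0_integralD//; exact: lte_add_pinfty.
have mT : @lebesgue_measure R setT = +oo%E by rewrite -set_itvNyy lebesgue_measure_itv.
rewrite integral_cst// [X in (_ * X)%E](_ : _ = @lebesgue_measure R setT)//.
rewrite mT mulry gtr0_sg// mul1e.
by rewrite ltxx.
Qed.

Lemma cprimitive_ae_eq u (f g : R -> R[i]) : cprimitive u f -> cmeasurable g -> clocally_bounded g ->
  {ae @lebesgue_measure R, forall x, f x = g x} -> cprimitive u g.
Proof.
move=> [[m1 _ h1] [m2 _ h2]] [g1 g2] [b1 b2] fg; split; split => // a b ab.
  by rewrite h1//; apply: Rintegral_ae_eq => //; apply: ae_mono fg => x ->.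
by rewrite h2//; apply: Rintegral_ae_eq => //; apply: ae_mono fg => x ->.
Qed.

Lemma L2_ae_eq u v : L2 u -> cmeasurable v -> {ae @lebesgue_measure R, forall x, u x = v x} -> L2 v.
Proof.
move=> [mu_ iu] mv uv; split => //; rewrite (le_lt_trans _ iu)// le_eqVlt.
apply/orP; left; apply/eqP; apply: ae_eq_integral => //.
- exact: measurable_normc_sqr.
- exact: measurable_normc_sqr.
by apply: ae_mono uv => x -> _.
Qed.

(** A bootstrap: [v] has a locally bounded representative because it is weakly differentiable, hence
    so has [v2 = (V - E) v], then [v1] is a primitive of it, and [v] a primitive of [v1]. *)
Lemma schroedinger_odesol U v : {ae @lebesgue_measure R, forall x, U x = V x} ->
  schroedinger U v (fun x => E%:C * v x) ->
  exists G G1, [/\ odesol G G1, L2 G, L2 G1 & {ae @lebesgue_measure R, forall x, v x = G x}].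
Proof.
move=> UV [v1 [v2 [[Lv w1] [Lv1 w2] _ eqv]]].
have [G0 [mG0 bG0 vG0]] := weak_derivative_bounded w1.
have mVE : cmeasurable (fun x => (V x - E)%:C).
  by apply: cmeasurable_real; exact: measurable_funB.
have bVE : clocally_bounded (fun x => (V x - E)%:C).
  split; last by move=> M; exists 0 => x _ /=; rewrite normr0.
  by move=> M; exists (C + `|E|) => x _ /=; rewrite (le_trans (ler_normB _ _))// lerD2r.
have v2G0 : {ae @lebesgue_measure R, forall x, v2 x = (V x - E)%:C * G0 x}.
  have ve := ae_mono2 (fun x => @conj _ _) vG0 eqv.
  apply: ae_mono2 UV ve => x Ux [vx e].
  by rewrite -vx realcB -Ux mulrBl -e opprD opprK addrCA subrr addr0.
have [G1 [p1 e1]] := weak_derivative_primitive w2 (cmeasurableM mVE mG0)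
   (clocally_boundedM bVE bG0) v2G0.
have [G [p e]] := weak_derivative_primitive w1 (cprimitive_measurable p1) (cprimitive_bounded p1) e1.
have mG := cprimitive_measurable p; have bG := cprimitive_bounded p.
exists G, G1; split => //.
- split => //; apply: cprimitive_ae_eq p1 _ _ _.
  + exact: cmeasurableM.
  + exact: clocally_boundedM.
  by apply: ae_mono2 vG0 e => x <- <-.
- exact: L2_ae_eq Lv mG e.
exact: L2_ae_eq Lv1 (cprimitive_measurable p1) e1.
Qed.

Lemma eigenfunction_unique U u v : {ae @lebesgue_measure R, forall x, U x = V x} ->
  eigenfunction U E u -> eigenfunction U E v ->
  exists c : R[i], {ae @lebesgue_measure R, forall x, v x = c * u x}.
Proof.
move=> UV [su u0] [sv _].
have [G [G1 [oG LG LG1 uG]]] := schroedinger_odesol UV su.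
have [F [F1 [oF LF LF1 vF]]] := schroedinger_odesol UV sv.
have W0 : G 0 * F1 0 - F 0 * G1 0 = 0.
  by apply: (L2_wronskian0 LG LG1 LF LF1) => x; exact: odesol_wronskian.
have [|c [FG _]] := odesol_proportional oG oF W0.
  apply: contrapT => nG; apply: u0; apply: ae_mono uG => x ->.
  by apply/eqP; apply: contrapT => /negP Gx; apply: nG; exists x.
by exists c; apply: ae_mono2 uG vF => x -> ->; rewrite FG.
Qed.

Lemma odesol_eigenfunction U u u1 B kappa : {ae @lebesgue_measure R, forall x, U x = V x} ->
  odesol u u1 -> 0 < kappa ->
  (forall x, normc (u x) <= B * expR (- kappa * `|x|)) ->
  (forall x, normc (u1 x) <= B * expR (- kappa * `|x|)) ->
  (forall x, 0 < x -> u x != 0) -> eigenfunction U E u.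
Proof.
move=> UV [p p1] k0 uB u1B un; have mVE : cmeasurable (fun x => (V x - E)%:C).
  by apply: cmeasurable_real; exact: measurable_funB.
split; last first.
  move=> /(ae_exists_itv (ltr1n R 2)) [x /andP[x1 _]] /eqP; apply/negP; apply: un.
  exact: lt_le_trans x1.
exists u1, (fun x => (V x - E)%:C * u x); split.
- by split; [exact: L2_decay k0 (cprimitive_measurable p) uB|exact: cprimitive_weak_derivative].
- by split; [exact: L2_decay k0 (cprimitive_measurable p1) u1B|exact: cprimitive_weak_derivative].
- apply: (@L2_decay _ ((C + `|E|) * B) kappa) => //.
    exact: cmeasurableM (cprimitive_measurable p).
  move=> x; rewrite normcM normc_real -mulrA ler_pM ?normc_ge0//.
  by rewrite (le_trans (ler_normB _ _))// lerD2r.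
by apply: ae_mono UV => x ->; rewrite realcB; ring.
Qed.

End System.

(** * The Jost solutions at a zero of the Wronskian *)

Section JostEigenfunction.
Variables (b d : R) (V Ph Ph1 S : R -> R).
Hypothesis HM : modulated b d V Ph Ph1 S.
Variable kappa : R.
Hypotheses (k0 : 0 < kappa) (kd : kappa <= d ^+ 2).
Local Notation k := ('i%C * kappa%:C).

Let b0 : 0 < b. Proof. by case: HM. Qed.
Let d0 : 0 <= d. Proof. by case: HM. Qed.
Let d1 : d <= 1.
Proof. by rewrite (le_trans (mod_d4 HM))// invf_le1 ?ler1n. Qed.
Let k1 : kappa <= 1.
Proof. by rewrite (le_trans kd)// expr_le1. Qed.

Lemma jregion_imaginary : jregion k.
Proof.
split; first by rewrite ImM /= mul0r add0r mul1r ltW.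
by rewrite normcM normc_i mul1r normc_real gtr0_norm.
Qed.

Lemma jf_odesol : odesol V (- kappa ^+ 2) (jf b Ph Ph1 S k) (jf1 b Ph Ph1 S k).
Proof.
have kr := jregion_imaginary.
split; first exact: (jf_primitive HM kr).
apply: cprimitive_eq (jf1_primitive HM kr) => x //.
by rewrite exprMn sqr_i realcB realcN realcX mulN1r.
Qed.

(** For [0 < x] the bound on [msol k x - 1] is at most [expR (- b * x)], strictly below 1. *)
Lemma jf_neq0 x : 0 < x -> jf b Ph Ph1 S k x != 0.
Proof.
move=> x0; have kr := jregion_imaginary.
rewrite /jf /jenv !mulf_neq0 ?cexp_neq0//.
  by rewrite -normc_eq0 normc_real gt_eqF// normr_gt0 gt_eqF ?expR_gt0.
have [_ /(_ x)] := cdecay_Bwsol HM kr.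
have c1 : 96 * d / b ^+ 2 <= 1.
  by rewrite ler_pdivrMr ?exprn_gt0// mul1r mulrC -ler_pdivlMr//; exact: mod_db HM.
have e1 : expR (- b * x) < 1 by rewrite expR_lt1 mulNr oppr_lt0 mulr_gt0.
apply: contraTneq => /eqP; rewrite /msol addrC addr_eq0 => /eqP ->.
rewrite normcN (_ : normc 1 = 1) -?ltNge; last by rewrite (_ : 1 = 1%:C) ?normc_real ?normr1.
by rewrite (le_lt_trans _ e1)// ler_piMl// expR_ge0.
Qed.

Lemma jf_le x : 0 <= x ->
  normc (jf b Ph Ph1 S k x) <= (8 + 96 / b) * expR (- kappa * `|x|) /\
  normc (jf1 b Ph Ph1 S k x) <= (8 + 96 / b) * expR (- kappa * `|x|).
Proof.
move=> x0; have kr := jregion_imaginary; rewrite (ger0_norm x0).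
have e1 : expR (- b * x) <= 1 by rewrite expR_le1 mulNr oppr_le0 mulr_ge0// ltW.
have env : normc (jenv Ph k x) <= 2 * expR (- kappa * x).
  rewrite /jenv normcM normc_real normc_cexp ger0_norm ?expR_ge0//.
  have [_ hP] := normr_Ph_le HM x; have hP2 : Ph x <= 2^-1.
    by rewrite (le_trans (ler_norm _))// (le_trans hP)// lef_pV2 ?posrE// ler_nat.
  rewrite ler_pM ?expR_ge0 ?expR_half_le2//.
  by rewrite (_ : Re _ = - kappa * x)// ReM /=; ring.
have hm : normc (msol b Ph Ph1 S k x) <= 2.
  by rewrite (le_trans (normc_msol_le HM x kr))//; lra.
have hp : normc (jp b Ph Ph1 S k x) <= 48 / b.
  rewrite (le_trans (normc_jp_le HM x kr))// -[leRHS]mulr1 ler_pM//.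
    by rewrite divr_ge0 ?mulr_ge0// ltW.
  by rewrite ler_wpM2r ?invr_ge0 ?(ltW b0)// ler_piMr.
have hk : normc ((Ph1 x)%:C + 'i%C * k) <= 2.
  rewrite (le_trans (le_normcD _ _))// !normcM !normc_i !normc_real !mul1r (gtr0_norm k0).
  rewrite -[leRHS](_ : 1 + 1 = 2)// lerD// (le_trans (mod_Ph1d HM x))//.
  by rewrite -[leRHS]mulr1 ler_pM ?expR_ge0// expR_le1 mulNr oppr_le0 mulr_ge0// ltW.
have bi : 0 <= b^-1 by rewrite invr_ge0 ltW.
have e0 := expR_ge0 (- kappa * x).
split.
  rewrite /jf normcM (le_trans (ler_pM _ _ env hm)) ?normc_ge0// mulrAC ler_wpM2r//; lra.
have h : normc (((Ph1 x)%:C + 'i%C * k) * msol b Ph Ph1 S k x + jp b Ph Ph1 S k x) <= 2 * 2 + 48 / b.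
  by rewrite (le_trans (le_normcD _ _))// lerD// normcM ler_pM ?normc_ge0.
rewrite /jf1 normcM (le_trans (ler_pM _ _ env h)) ?normc_ge0//.
by rewrite le_eqVlt; apply/orP; left; apply/eqP; ring.
Qed.

End JostEigenfunction.

Lemma Wf_eigenfunction b d (V Ph Ph1 S : R -> R) CV U kappa : modulated b d V Ph Ph1 S ->
  measurable_fun setT V -> (forall x, `|V x| <= CV) ->
  {ae @lebesgue_measure R, forall x, U x = V x} ->
  0 < kappa -> kappa <= d ^+ 2 -> Wf b Ph Ph1 S ('i%C * kappa%:C) = 0 ->
  simple_eigenvalue U (- kappa ^+ 2) /\
  exists u B, eigenfunction U (- kappa ^+ 2) u /\
    forall x, normc (u x) <= B * expR (- kappa * `|x|).
Proof.
move=> HM mV VC UV k0 kd W0.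
have HN := modulated_opp HM.
pose k := 'i%C * kappa%:C.
pose u := jf b Ph Ph1 S k; pose u1 := jf1 b Ph Ph1 S k.
pose f := jf b (fun x => Ph (- x)) (fun x => - Ph1 (- x)) (fun x => S (- x)) k.
pose f1 := jf1 b (fun x => Ph (- x)) (fun x => - Ph1 (- x)) (fun x => S (- x)) k.
have ou : odesol V (- kappa ^+ 2) u u1 := jf_odesol HM k0 kd.
have [pf pf1] : odesol (fun x => V (- x)) (- kappa ^+ 2) f f1 := jf_odesol HN k0 kd.
have om : odesol V (- kappa ^+ 2) (fun x => f (- x)) (fun x => - f1 (- x)).
  split; first exact: cprimitive_opp.
  apply: cprimitive_eq (cprimitiveN (cprimitive_opp pf1)) => x //.
  by rewrite opprK opprK.
(* Writing the right solution as a multiple of the left one gives its decay at $-\infty$; its decay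
   at $+\infty$ is built in. *)
have [||c [uE u1E]] := odesol_proportional VC om ou.
- rewrite oppr0; have := @jf_wronskian R b Ph Ph1 S k; rewrite W0 mulr0 oppr0 -/u -/u1 -/f -/f1 => h.
  have sw (z w : R[i]) : z - w = 0 -> w - z = 0.
    by move=> /eqP; rewrite subr_eq0 => /eqP ->; rewrite subrr.
  exact: sw h.
- by exists (-1); rewrite opprK; exact: (jf_neq0 HN k0 kd).
pose B := (8 + 96 / b) * (1 + normc c).
have dec w w1 x : (0 <= x -> normc (w x) <= (8 + 96 / b) * expR (- kappa * `|x|)) ->
  (0 <= - x -> normc (w1 (- x)) <= (8 + 96 / b) * expR (- kappa * `|- x|)) ->
  w x = c * w1 (- x) \/ w x = c * - w1 (- x) ->
  normc (w x) <= B * expR (- kappa * `|x|).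
  have B0 : 0 <= 8 + 96 / b by rewrite addr_ge0// divr_ge0// ltW//; case: HM.
  have e0 := expR_ge0 (- kappa * `|x|).
  move=> h1 h2 h3; have [x0|/ltW x0] := leP 0 x.
    rewrite (le_trans (h1 x0))// ler_wpM2r// /B ler_peMr// lerDl normc_ge0//.
  have -> : normc (w x) = normc c * normc (w1 (- x)).
    by case: h3 => ->; rewrite normcM ?normcN.
  rewrite normrN oppr_ge0 in h2; rewrite (le_trans (ler_wpM2l (normc_ge0 c) (h2 x0)))//.
  by rewrite mulrA ler_wpM2r// mulrC /B ler_wpM2l// lerDr.
have uB x : normc (u x) <= B * expR (- kappa * `|x|).
  apply: (dec u f); [by move=> /(jf_le HM k0 kd)[]|by move=> /(jf_le HN k0 kd)[]|].
  by left; rewrite uE.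
have u1B x : normc (u1 x) <= B * expR (- kappa * `|x|).
  apply: (dec u1 f1); [by move=> /(jf_le HM k0 kd)[]|by move=> /(jf_le HN k0 kd)[]|].
  by right; rewrite u1E.
have eu : eigenfunction U (- kappa ^+ 2) u.
  by apply: (odesol_eigenfunction mV VC UV ou k0 uB u1B); exact: (jf_neq0 HM k0 kd).
split; last by exists u, B.
split; [by exists u|move=> v w ev ew].
exact: (eigenfunction_unique mV VC UV ev ew).
Qed.

End Eigenfunctions.

(** * Oscillating potentials *)

Section FunctionSeries.
Context {R : realType}.
Implicit Types (F f g : nat -> R -> R) (s : nat -> R) (x : R).

(** [D] is the set of points where the sequence is Cauchy. Multiplying by its indicator gives a
    sequence that converges everywhere, with limit 0 off [D], which is also the default value of
    [limn] there. *)
Lemma measurable_limn f : (forall n, measurable_fun setT (f n)) ->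
  measurable_fun setT (fun x => limn (f^~ x)).
Proof.
move=> mf; pose D : set R := \bigcap_k \bigcup_N \bigcap_(n in [set n | (N <= n)%N])
  [set x | `|f n x - f N x| <= k.+1%:R^-1].
have mD : measurable D.
  apply: bigcap_measurableType => k _; apply: bigcupT_measurable => N.
  apply: bigcap_measurableType => n _.
  have mg : measurable_fun setT (fun x => `|f n x - f N x|).
    by apply: measurableT_comp => //; exact: measurable_funB.
  rewrite (_ : [set x | _] = setT `&` (fun x => `|f n x - f N x|) @^-1` `]-oo, k.+1%:R^-1]).
    exact: mg.
  by rewrite setTI; apply/seteqP; split => x /=; rewrite in_itv.
have DP x : D x <-> cvgn (f^~ x).
  split=> [Dx|cx k _].
    apply: cauchy_cvg; apply: cauchy_exP => e e0.
    have [k _ ke] : exists2 k : nat, True & k.+1%:R^-1 < e.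
      have : \forall k \near \oo, k.+1%:R^-1 < e by exact: (near_infty_natSinv_lt (PosNum e0)).
      by case=> k _ /(_ k (leqnn k)) /=; exists k.
    have [N _ HN] := Dx k I; exists (f N x); exists N => // n Nn.
    by rewrite /ball /= distrC (le_lt_trans (HN n Nn)).
  have k0 : 0 < k.+1%:R^-1 / 2 :> R by rewrite divr_gt0 ?invr_gt0.
  move/cvgrPdist_lt: (cx) => /(_ _ k0)[N _ HN].
  exists N => // n /= Nn; have h1 := HN n Nn; have h2 := HN N (leqnn N).
  rewrite -(subrK (limn (f^~ x)) (f n x)) -addrA (le_trans (ler_normD _ _))//.
  by rewrite [leRHS]splitr lerD// ltW// distrC.
apply: (@measurable_fun_cvg _ _ _ _ (fun n x => f n x * \1_D x)).
  by move=> n; apply: measurable_funM => //; exact: measurable_indic.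
move=> x _; rewrite indicE; have [/set_mem/DP cx|xD] := boolP (x \in D).
  by under eq_fun do rewrite mulr1.
under eq_fun do rewrite mulr0.
rewrite dvgP; first exact: cvg_cst.
by move/DP => Dx; move: xD; rewrite notin_setE.
Qed.

Lemma normr_integral_decay (h : R -> R) b N : 0 < b -> measurable_fun setT h ->
  (forall x, `|h x| <= N * expR (- b * `|x|)) -> `|\int[mu]_x h x| <= 2 * N / b.
Proof.
move=> b0 mh hN; have [_ ->] := integral_two_tails b0 mh hN.
have N0 : 0 <= N by have := le_trans (normr_ge0 _) (hN 0); rewrite normr0 mulr0 expR0 mulr1.
have ed (k : R -> R) : measurable_fun setT k -> (forall x, `|k x| <= N * expR (- b * `|x|)) ->
    `|tail k 0| <= N / b.
  move=> mk kN; have ek : edecay b N k.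
    split => // x; rewrite (le_trans (kN x))// ler_wpM2l// ler_expR !mulNr lerN2.
    by rewrite ler_wpM2l ?ler_norm// ltW.
  by have := normr_tail_le 0 b0 ek; rewrite mulr0 expR0 mulr1.
rewrite (le_trans (ler_normD _ _))// (_ : 2 * N / b = N / b + N / b); last by ring.
apply: lerD; apply: ed => //; last by move=> x; have := hN (- x); rewrite normrN.
exact: measurableT_comp mh (@oppr_measurable R setT).
Qed.

Lemma integral_derivative0 (G g : R -> R) b N M : 0 < b -> primitive G g ->
  (forall x, `|G x| <= N * expR (- b * `|x|)) -> (forall x, `|g x| <= M * expR (- b * `|x|)) ->
  \int[mu]_x g x = 0.
Proof.
move=> b0 Gg GN gM; have [mg _ _] := Gg; have [_ ->] := integral_two_tails b0 mg gM.
have ed x : 0 <= x -> N * expR (- b * `|x|) <= N * expR (- b * x) by move=> x0; rewrite ger0_norm.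
have M0 : 0 <= M by have := le_trans (normr_ge0 _) (gM 0); rewrite normr0 mulr0 expR0 mulr1.
have eM x : M * expR (- b * `|x|) <= M * expR (- b * x).
  by rewrite ler_wpM2l// ler_expR !mulNr lerN2 ler_wpM2l ?ler_norm// ltW.
have e1 : edecay b M g by split => // x; rewrite (le_trans (gM x)).
have e2 : edecay b M (fun x => g (- x)).
  split; first exact: measurableT_comp mg (@oppr_measurable R setT).
  by move=> x; rewrite (le_trans (gM _))// normrN.
rewrite (tail_eq 0 b0 e1 (primitiveN Gg)); last first.
  by apply: (edecay_cvg0 (N := N) b0) => x x0; rewrite normrN (le_trans (GN x))// ed.
rewrite (tail_eq 0 b0 e2 (primitive_opp Gg)); last first.
  by apply: (edecay_cvg0 (N := N) b0) => x x0; rewrite (le_trans (GN _))// normrN ed.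
by rewrite oppr0 addNr.
Qed.

Definition fsum f x := limn (series (f^~ x)).

Lemma eq_fsum f g x : (forall j, f j x = g j x) -> fsum f x = fsum g x.
Proof. by move=> fg; congr (limn (series _)); apply/funext => j; exact: fg. Qed.

Lemma measurable_series f n : (forall n, measurable_fun setT (f n)) ->
  measurable_fun setT (fun x => series (f^~ x) n).
Proof. by move=> mf; exact: measurable_sum. Qed.

Lemma measurable_fsum f : (forall n, measurable_fun setT (f n)) -> measurable_fun setT (fsum f).
Proof. by move=> mf; apply: measurable_limn => n; exact: measurable_series. Qed.

Section Dominated.
Variables (s : nat -> R) (s0 : forall j, 0 <= s j) (cs : cvgn (series s)).
Local Notation Sg := (limn (series s)).

Lemma fsum_cvg f x B : (forall j, `|f j x| <= s j * B) -> cvgn (series (f^~ x)).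
Proof.
move=> fB; apply: (normal_series_cvg fB).
by rewrite (_ : (fun n => s n * B) = (fun n => B *: s n)); [exact: is_cvg_seriesZ|
  apply/funext => n; exact: mulrC].
Qed.

Lemma fsum_tail f x n B : (forall j, `|f j x| <= s j * B) ->
  `|fsum f x - series (f^~ x) n| <= (Sg - series s n) * B.
Proof.
move=> fB.
have E : (fun n => s n * B) = (fun n => B *: s n) by apply/funext => m; exact: mulrC.
have cB : cvgn (series (fun n => s n * B)) by rewrite E; exact: is_cvg_seriesZ.
rewrite (le_trans (normal_series_tail n fB cB))// E lim_seriesZ// mulrBl /series /=.
by rewrite -scaler_sumr /GRing.scale /= -[B * limn _]mulrC -[B * \sum_(_ <= _ < _) _]mulrC.
Qed.

Lemma fsum_le f x B : (forall j, `|f j x| <= s j * B) -> `|fsum f x| <= Sg * B.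
Proof. by move=> /(fsum_tail 0); rewrite /series /= !big_geq// !subr0. Qed.

Lemma fsumD f g x B B' : (forall j, `|f j x| <= s j * B) -> (forall j, `|g j x| <= s j * B') ->
  fsum (fun j x => f j x + g j x) x = fsum f x + fsum g x.
Proof.
move=> fB gB; rewrite /fsum -lim_seriesD//; [exact: fsum_cvg fB|exact: fsum_cvg gB].
Qed.

Lemma fsumZ f x B c : (forall j, `|f j x| <= s j * B) ->
  fsum (fun j x => c * f j x) x = c * fsum f x.
Proof. by move=> fB; exact: (lim_seriesZ c (fsum_cvg fB)). Qed.

Lemma tail_ge0 n : 0 <= Sg - series s n.
Proof. by rewrite subr_ge0; apply: nondecreasing_cvgn_le => //; exact: nondecreasing_series. Qed.

Lemma tail_small e : 0 < e -> exists n, Sg - series s n <= e.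
Proof.
move=> e0; move/cvgrPdist_le: (cs) => /(_ _ e0)[N _ /(_ N (leqnn N)) h]; exists N.
by rewrite (le_trans (ler_norm _)).
Qed.

Lemma le_small (a c K : R) : (forall n, a <= c + (Sg - series s n) * K) -> a <= c.
Proof.
move=> H; apply/ler_addgt0Pl => e e0.
have K1 : 0 < `|K| + 1 by rewrite ltr_wpDl.
have [n hn] := tail_small (divr_gt0 e0 K1).
rewrite (le_trans (H n))// addrC lerD2r (le_trans (ler_wpM2l (tail_ge0 n) (ler_norm K)))//.
rewrite -(divfK (lt0r_neq0 K1) e); apply: ler_pM => //; first exact: tail_ge0.
by rewrite lerDl.
Qed.

Lemma sum_Rintegral (D : set R) f n : measurable D ->
  (forall j, mu.-integrable D (EFin \o f j)) ->
  \int[mu]_(x in D) series (f^~ x) n = series (fun j => \int[mu]_(x in D) f j x) n /\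
  mu.-integrable D (EFin \o (fun x => series (f^~ x) n)).
Proof.
move=> mD fi; elim: n => [|n [IH1 IH2]].
  rewrite /series /= big_geq//; split.
    rewrite (_ : (fun x => _) = (fun=> 0)) ?Rintegral0//; last by apply/funext => x; rewrite big_geq.
    by rewrite /Rintegral integral0.
  by rewrite (_ : _ \o _ = cst 0%E); [exact: integrable0|apply/funext => x; rewrite /= big_geq].
have E : (fun x => series (f^~ x) n.+1) = (fun x => series (f^~ x) n + f n x).
  by apply/funext => x; rewrite seriesSr.
rewrite E seriesSr -IH1; split; last exact: integrableD_EFin.
exact: RintegralD.
Qed.

Lemma fsum_primitive F f A B : (forall j, primitive (F j) (f j)) ->
  (forall j x, `|F j x| <= s j * A) -> (forall j x, `|f j x| <= s j * B) ->
  primitive (fsum F) (fsum f).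
Proof.
move=> pF FA fB.
have mf : measurable_fun setT (fsum f) by apply: measurable_fsum => n; case: (pF n).
have bf : locally_bounded (fsum f) by move=> M; exists (Sg * B) => x _; exact: fsum_le.
split => // a b ab.
apply/eqP; rewrite -subr_eq0 -normr_le0; apply: (@le_small _ _ (2 * A + B * (b - a))) => n.
rewrite add0r.
have fi j : mu.-integrable `[a, b] (EFin \o f j).
  by case: (pF j) => m1 b1 _; exact: locally_bounded_integrable.
have [i1 i2] := sum_Rintegral n (measurable_itv `[a, b]) fi.
have Fn : series (F^~ b) n - series (F^~ a) n = \int[mu]_(x in `[a, b]) series (f^~ x) n.
  rewrite i1 /series /= -sumrB; apply: eq_bigr => j _.
  by case: (pF j) => _ _ /(_ _ _ ab).
rewrite (_ : fsum F b - fsum F a - _ = (fsum F b - series (F^~ b) n) - (fsum F a - series (F^~ a) n)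
   - (\int[mu]_(x in `[a, b]) (fsum f x) - \int[mu]_(x in `[a, b]) series (f^~ x) n)); last first.
  by rewrite -Fn; ring.
have fsi : mu.-integrable `[a, b] (EFin \o fsum f) by exact: locally_bounded_integrable.
have hb := fsum_tail n (FA^~ b); have ha := fsum_tail n (FA^~ a).
have hI : `|\int[mu]_(x in `[a, b]) (fsum f x) - \int[mu]_(x in `[a, b]) series (f^~ x) n| <=
    (Sg - series s n) * B * (b - a).
  rewrite -RintegralB//; apply: normr_Rintegral_itv_le => //.
  - apply: measurable_funB => //; apply: measurable_series => j; by case: (pF j).
  - move=> M; exists ((Sg - series s n) * B) => x _; exact: fsum_tail.
  by move=> x _; exact: fsum_tail.
rewrite (le_trans (ler_normB _ _))// (le_trans (lerD (ler_normB _ _) hI))//.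
rewrite (le_trans (lerD (lerD hb ha) (lexx _)))// le_eqVlt; apply/orP; left; apply/eqP; ring.
Qed.

(** The pointwise bound [B] controls only the remainder of the series and drops out in the limit;
    what survives is the bound [E] on the integrals, which oscillation makes smaller. *)
Lemma fsum_integral_le (h : nat -> R -> R) (b B E : R) : 0 < b -> 0 <= E -> (forall j, measurable_fun setT (h j)) ->
  (forall j x, `|h j x| <= s j * (B * expR (- b * `|x|))) ->
  (forall j, `|\int[mu]_x h j x| <= s j * E) ->
  `|\int[mu]_x fsum h x| <= Sg * E.
Proof.
move=> b0 E0 mh hB hE.
have hB' j x : `|h j x| <= (s j * B) * expR (- b * `|x|) by rewrite -mulrA.
have hi j := (integral_two_tails b0 (mh j) (hB' j)).1.
have mf := measurable_fsum mh.
apply: (@le_small _ _ (2 * B / b)) => n.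
have [e1 e2] := sum_Rintegral n measurableT hi.
have dB x : `|fsum h x - series (h^~ x) n| <= ((Sg - series s n) * B) * expR (- b * `|x|).
  by rewrite -mulrA; exact: fsum_tail.
have md : measurable_fun setT (fun x => fsum h x - series (h^~ x) n).
  by apply: measurable_funB => //; exact: measurable_series.
have [di _] := integral_two_tails b0 md dB.
have fi : mu.-integrable setT (EFin \o fsum h).
  rewrite (_ : fsum h = (fun x => (fsum h x - series (h^~ x) n) + series (h^~ x) n)).
    exact: integrableD_EFin.
  by apply/funext => x; rewrite subrK.
have -> : \int[mu]_x fsum h x = series (fun j => \int[mu]_x h j x) n +
    \int[mu]_x (fsum h x - series (h^~ x) n).
  by rewrite RintegralB// e1 addrC subrK.
rewrite (le_trans (ler_normD _ _))//; apply: lerD; last first.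
  by rewrite (le_trans (normr_integral_decay b0 md dB))// le_eqVlt; apply/orP; left; apply/eqP; ring.
rewrite /series /= (le_trans (ler_norm_sum _ _ _))//.
rewrite (le_trans (ler_sum _ (fun j _ => hE j)))// -mulr_suml.
by rewrite ler_wpM2r// -subr_ge0; exact: tail_ge0.
Qed.

End Dominated.

Lemma fsum_single (G : R -> R) m x :
  fsum (fun j x => if j == m then G x else 0) x = G x.
Proof.
rewrite /fsum; apply: cvg_lim => //; apply: cvg_near_cst; near=> n.
have mn : (m < n)%N by near: n; exact: nbhs_infty_gt.
rewrite /series /= big_mkord (bigD1 (Ordinal mn)) //= eqxx big1 ?addr0// => i.
by rewrite -val_eqE /= => /negbTE ->.
Unshelve. all: by end_near. Qed.

End FunctionSeries.

(** * Integrals against an oscillating factor *)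

Section Oscillation.
Context {R : realType}.
Implicit Types (F f : R -> R[i]) (w x b : R).
Local Arguments Normc.normc : simpl never.
Local Arguments cexp : simpl never.

Definition osc w x : R[i] := cexp ('i%C * w%:C * x%:C).

Lemma normc_osc w x : normc (osc w x) = 1.
Proof. by rewrite normc_cexp (_ : Re _ = 0) ?expR0//=; ring. Qed.

Lemma cmeasurable_osc w : cmeasurable (osc w).
Proof. exact: cprimitive_measurable (cprimitive_cexp _). Qed.

Lemma oscD v w x : osc v x * osc w x = osc (v + w) x.
Proof. by rewrite /osc -cexpD; congr cexp; rewrite realcD; ring. Qed.

Lemma osc_conj w x : conjc (osc w x) = osc (- w) x.
Proof.
rewrite /osc conjc_cexp; congr cexp.
by apply: complex_eqP; rewrite /= ?ReM ?ImM /=; ring.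
Qed.

Lemma iw_neq0 w : w != 0 -> 'i%C * w%:C != 0 :> R[i].
Proof.
by move=> w0; rewrite -normc_eq0 normcM normc_i mul1r normc_real normr_eq0.
Qed.

Lemma cprimitive_conj F f : cprimitive F f ->
  cprimitive (fun x => conjc (F x)) (fun x => conjc (f x)).
Proof.
move=> [p1 p2]; split; first by apply: primitive_eq p1 => x; case: (F x) (f x) => [? ?] [].
by apply: primitive_eq (primitiveN p2) => x; [case: (F x)|case: (f x)].
Qed.

(* Integration by parts against the oscillating factor. *)
Lemma osc_integral F f w b N M : 0 < b -> w != 0 -> cprimitive F f ->
  (forall x, normc (F x) <= N * expR (- b * `|x|)) ->
  (forall x, normc (f x) <= M * expR (- b * `|x|)) ->
  `|\int[mu]_x Re (F x * osc w x)| <= 2 * M / b * `|w|^-1.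
Proof.
move=> b0 w0 pF FN fM; pose tau : R[i] := ('i%C * w%:C)^-1.
have tn : normc tau = `|w|^-1.
  by rewrite /tau Normc.normcV normcM normc_i mul1r normc_real.
have iw := iw_neq0 w0; have mF := cprimitive_measurable pF.
have mf : cmeasurable f by case: pF => [[m1 _ _] [m2 _ _]].
have mo := cmeasurable_osc w.
have pG := cprimitiveZ tau (cprimitiveM pF (cprimitive_cexp ('i%C * w%:C))).
have [pR _] : cprimitive (fun x => tau * (F x * osc w x)) (fun x => F x * osc w x + tau * (f x * osc w x)).
  apply: cprimitive_eq pG => x //; rewrite -/(osc w x).
  rewrite mulrDr addrC; congr (_ + _); rewrite mulrCA; congr (_ * _).
  by rewrite mulrA mulVf// mul1r.
have h1 x : normc (F x * osc w x) <= N * expR (- b * `|x|) by rewrite normcM normc_osc mulr1.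
have h2 x : normc (tau * (f x * osc w x)) <= (`|w|^-1 * M) * expR (- b * `|x|).
  by rewrite !normcM normc_osc mulr1 tn -mulrA ler_wpM2l ?invr_ge0.
have i0 : \int[mu]_x Re (F x * osc w x + tau * (f x * osc w x)) = 0.
  apply: (integral_derivative0 (N := `|w|^-1 * N) (M := N + `|w|^-1 * M) b0 pR) => x.
    rewrite (le_trans (normr_Re_le _))// normcM tn -mulrA ler_wpM2l ?invr_ge0//.
  by rewrite (le_trans (normr_Re_le _))// (le_trans (le_normcD _ _))// mulrDl lerD.
have [m1 _] := cmeasurableM mF mo.
have [m2 _] := cmeasurableM (cmeasurable_cst tau) (cmeasurableM mf mo).
have [j1 _] := integral_two_tails b0 m1 (fun x => le_trans (normr_Re_le _) (h1 x)).
have k2 x := le_trans (normr_Re_le _) (h2 x).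
have [j2 _] := integral_two_tails b0 m2 k2.
have E : \int[mu]_x Re (F x * osc w x) = - \int[mu]_x Re (tau * (f x * osc w x)).
  apply/eqP; rewrite -addr_eq0 -RintegralD// -i0; apply/eqP.
  by apply: eq_Rintegral => x _; rewrite ReD.
rewrite E normrN (le_trans (normr_integral_decay b0 m2 k2))//.
by rewrite le_eqVlt; apply/orP; left; apply/eqP; ring.
Qed.

End Oscillation.

(** * The phase, the reduced potential and its integral *)

Section Waves.
Context {R : realType}.
Implicit Types (x : R) (a : nat -> R[i]).
Local Arguments Normc.normc : simpl never.
Local Arguments osc : simpl never.

(** An everywhere-defined representative of one coefficient together with its first three
    derivatives. All bounds hold at every point, the third derivative being merely measurable. *)
Record profile (b s : R) (Q : nat -> R -> R[i]) : Prop := Profile {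
  profile_primitive : forall l, (l < 3)%N -> cprimitive (Q l) (Q l.+1);
  profile_le : forall l x, (l < 4)%N -> normc (Q l x) <= s * expR (- b * `|x|) }.

Variables (b : R) (s : nat -> R) (Q : nat -> nat -> R -> R[i]) (w : nat -> R) (t : R).
Hypotheses (b0 : 0 < b) (s0 : forall j, 0 <= s j) (cs : cvgn (series s)).
Hypothesis HQ : forall j, profile b (s j) (Q j).
Hypothesis w0 : forall j, w j != 0.
Hypothesis wt : forall j, `|w j|^-1 <= t.
Local Notation Sg := (limn (series s)).

Definition tau j : R[i] := ('i%C * (w j)%:C)^-1.

(** The indices [j] and [- j] are conjugate and are summed together as twice a real part; [a0] to
    [a3] weigh the successive derivatives of the profile. *)
Definition wave a0 a1 a2 a3 j x : R :=
  2 * Re ((a0 j * Q j 0 x + a1 j * Q j 1 x + a2 j * Q j 2 x + a3 j * Q j 3 x) * osc (w j) x).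

Lemma t_ge0 : 0 <= t.
Proof. by rewrite (le_trans _ (wt 0%N))// invr_ge0. Qed.

Lemma normc_tau j : normc (tau j) <= t.
Proof. by rewrite /tau Normc.normcV normcM normc_i mul1r normc_real. Qed.

Lemma cmeasurable_profile j l : (l < 4)%N -> cmeasurable (Q j l).
Proof.
case: l => [|l] l3.
  exact: cprimitive_measurable (profile_primitive (HQ j) (isT : (0 < 3)%N)).
by have [[m1 _ _] [m2 _ _]] := profile_primitive (HQ j) l3.
Qed.

Lemma measurable_wave a0 a1 a2 a3 j : measurable_fun setT (wave a0 a1 a2 a3 j).
Proof.
apply: measurable_funM => //.
have mc (c : R[i]) := cmeasurable_cst c.
have [m _] := cmeasurableM (cmeasurableD (cmeasurableD (cmeasurableD
  (cmeasurableM (mc (a0 j)) (cmeasurable_profile j (isT : (0 < 4)%N)))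
  (cmeasurableM (mc (a1 j)) (cmeasurable_profile j (isT : (1 < 4)%N))))
  (cmeasurableM (mc (a2 j)) (cmeasurable_profile j (isT : (2 < 4)%N))))
  (cmeasurableM (mc (a3 j)) (cmeasurable_profile j (isT : (3 < 4)%N)))) (cmeasurable_osc (w j)).
exact: m.
Qed.

Lemma wave_le a0 a1 a2 a3 (A0 A1 A2 A3 : R) j x : normc (a0 j) <= A0 ->
  normc (a1 j) <= A1 -> normc (a2 j) <= A2 -> normc (a3 j) <= A3 ->
  `|wave a0 a1 a2 a3 j x| <= s j * (2 * (A0 + A1 + A2 + A3) * expR (- b * `|x|)).
Proof.
move=> h0 h1 h2 h3; rewrite /wave normrM ger0_norm//.
rewrite (le_trans (ler_wpM2l _ (normr_Re_le _)))// normcM normc_osc mulr1.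
rewrite (_ : s j * _ = 2 * ((A0 + A1 + A2 + A3) * (s j * expR (- b * `|x|)))); last by ring.
have h (c : R[i]) A l : (l < 4)%N -> normc c <= A ->
    normc (c * Q j l x) <= A * (s j * expR (- b * `|x|)).
  by move=> l4 cA; rewrite normcM ler_pM ?normc_ge0//; exact: profile_le.
rewrite ler_wpM2l// !mulrDl.
apply: (le_trans (le_normcD _ _)); apply: lerD; last exact: h.
apply: (le_trans (le_normcD _ _)); apply: lerD; last exact: h.
by apply: (le_trans (le_normcD _ _)); apply: lerD; exact: h.
Qed.

(** Differentiation multiplies each coefficient by $i w_j$ and shifts it to the next derivative. The
    third derivative of the profile cannot be differentiated again, whence [a3 j = 0]. *)
Lemma wave_primitive a0 a1 a2 b0' b1 b2 j : b0' j = 'i%C * (w j)%:C * a0 j ->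
  b1 j = a0 j + 'i%C * (w j)%:C * a1 j -> b2 j = a1 j + 'i%C * (w j)%:C * a2 j ->
  forall a3, a3 j = 0 -> primitive (wave a0 a1 a2 a3 j) (wave b0' b1 b2 a2 j).
Proof.
move=> e0 e1 e2 a3 e3.
have p0 := profile_primitive (HQ j) (isT : (0 < 3)%N).
have p1 := profile_primitive (HQ j) (isT : (1 < 3)%N).
have p2 := profile_primitive (HQ j) (isT : (2 < 3)%N).
have [pR _] := cprimitiveM (cprimitiveD (cprimitiveD (cprimitiveZ (a0 j) p0) (cprimitiveZ (a1 j) p1))
  (cprimitiveZ (a2 j) p2)) (cprimitive_cexp ('i%C * (w j)%:C)).
apply: primitive_eq (primitiveZ 2 pR) => x; rewrite /wave -/(osc (w j) x).
  by rewrite e3 mul0r addr0.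
congr (2 * Re _); rewrite e0 e1 e2.
move: (Q j 0 x) (Q j 1 x) (Q j 2 x) (Q j 3 x) (osc (w j) x) (a0 j) (a1 j) (a2 j) ('i%C * (w j)%:C).
by move=> q0 q1 q2 q3 o A0 A1 A2 I; ring.
Qed.

Definition coef (c : R) k j : R[i] := c%:C * tau j ^+ k.

Lemma coefS c k j : 'i%C * (w j)%:C * coef c k.+1 j = coef c k j.
Proof.
rewrite /coef exprS mulrCA; congr (_ * _); rewrite mulrA mulfV ?mul1r//.
exact: iw_neq0.
Qed.

Lemma coefD c d k j : coef c k j + coef d k j = coef (c + d) k j.
Proof. by rewrite /coef realcD mulrDl. Qed.

Lemma coefZ n k j : coef n%:R k j = n%:R * coef 1 k j.
Proof. by rewrite /coef realc_nat mul1r. Qed.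

Lemma coef0 k j : coef 0 k j = 0. Proof. exact: mul0r. Qed.

Lemma normc_coef c k j : normc (coef c k j) <= `|c| * t ^+ k.
Proof.
rewrite /coef normcM normc_real ler_wpM2l//.
elim: k => [|k IH]; first by rewrite !expr0 (_ : 1 = 1%:C) ?normc_real ?normr1.
by rewrite !exprS normcM ler_pM ?normc_ge0// normc_tau.
Qed.

(* Two integrations by parts against the oscillations, cut off at order 3 in the
   wavelength: [wPh' = wPh1], [wPh1' = wPh2] and [wV - wPh2 = wD = O(t ^+ 2)]. *)
Definition wV := wave (coef 1 0) (coef 0 0) (coef 0 0) (coef 0 0).
Definition wPh := wave (coef 1 2) (coef (-2) 3) (coef 0 0) (coef 0 0).
Definition wPh1 := wave (coef 1 1) (coef (-1) 2) (coef (-2) 3) (coef 0 0).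
Definition wPh2 := wave (coef 1 0) (coef 0 0) (coef (-3) 2) (coef (-2) 3).
Definition wD := wave (coef 0 0) (coef 0 0) (coef 3 2) (coef 2 3).
(** The leading part of [wPh1], of order [t]; its square carries the effective potential. *)
Definition wg := wave (coef 1 1) (coef 0 0) (coef 0 0) (coef 0 0).

Hypothesis t1 : t <= 1.

Let t0 := t_ge0.
Lemma t_powers : [/\ 0 <= t, t <= 1, t ^+ 2 <= t & t ^+ 3 <= t ^+ 2].
Proof. by split => //; [rewrite expr2 ler_piMr|rewrite [leLHS]exprS ler_piMl ?sqr_ge0]. Qed.

Let wave_coef_le c0 k0 c1 k1 c2 k2 c3 k3 B :
  2 * (`|c0| * t ^+ k0 + `|c1| * t ^+ k1 + `|c2| * t ^+ k2 + `|c3| * t ^+ k3) <= B ->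
  forall j x, `|wave (coef c0 k0) (coef c1 k1) (coef c2 k2) (coef c3 k3) j x| <=
    s j * (B * expR (- b * `|x|)).
Proof.
move=> h j x; rewrite (le_trans (wave_le _ (normc_coef _ _ _) (normc_coef _ _ _)
  (normc_coef _ _ _) (normc_coef _ _ _)))// ler_wpM2l//.
by rewrite ler_wpM2r ?expR_ge0.
Qed.

Let nn (k : nat) : `|k%:R| = k%:R :> R. Proof. exact: normr_nat. Qed.
Let nN (k : nat) : `|- k%:R| = k%:R :> R. Proof. by rewrite normrN normr_nat. Qed.

Lemma wV_le j x : `|wV j x| <= s j * (2 * expR (- b * `|x|)).
Proof. by have [? ? ? ?] := t_powers; apply: wave_coef_le; rewrite ?normr0 normr1 expr0; lra. Qed.

Lemma wPh_le j x : `|wPh j x| <= s j * (6 * t ^+ 2 * expR (- b * `|x|)).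
Proof. by have [? ? ? ?] := t_powers; apply: wave_coef_le; rewrite ?normr0 nN normr1; lra. Qed.

Lemma wPh1_le j x : `|wPh1 j x| <= s j * (8 * t * expR (- b * `|x|)).
Proof. by have [? ? ? ?] := t_powers; apply: wave_coef_le; rewrite ?normr0 nN normrN normr1 expr1; lra. Qed.

Lemma wPh2_le j x : `|wPh2 j x| <= s j * (12 * expR (- b * `|x|)).
Proof. by have [? ? ? ?] := t_powers; apply: wave_coef_le; rewrite ?normr0 !nN normr1 expr0; lra. Qed.

Lemma wD_le j x : `|wD j x| <= s j * (10 * t ^+ 2 * expR (- b * `|x|)).
Proof. by have [? ? ? ?] := t_powers; apply: wave_coef_le; rewrite ?normr0 !nn; lra. Qed.

Lemma wg_le j x : `|wg j x| <= s j * (2 * t * expR (- b * `|x|)).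
Proof. by have [? ? ? ?] := t_powers; apply: wave_coef_le; rewrite ?normr0 normr1 expr1; lra. Qed.

Lemma wPh1Bg_le j x : `|wPh1 j x - wg j x| <= s j * (6 * t ^+ 2 * expR (- b * `|x|)).
Proof.
have -> : wPh1 j x - wg j x = wave (coef 0 0) (coef (-1) 2) (coef (-2) 3) (coef 0 0) j x.
  rewrite /wPh1 /wg /wave -mulrBr; congr (2 * _); rewrite -ReN -ReD; congr Re.
  rewrite !coef0.
  move: (Q j 0 x) (Q j 1 x) (Q j 2 x) (Q j 3 x) (osc (w j) x) (coef _ _ _) (coef _ _ _) (coef _ _ _).
  by move=> q0 q1 q2 q3 o A0 A1 A2; ring.
by have [? ? ? ?] := t_powers; apply: wave_coef_le; rewrite ?normr0 nN normrN normr1; lra.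
Qed.

Let E0 x : 0 <= expR (- b * `|x|). Proof. exact: expR_ge0. Qed.
Let E1 x : expR (- b * `|x|) <= 1.
Proof. by rewrite expR_le1 mulNr oppr_le0 mulr_ge0// ltW. Qed.
Let EE x : expR (- b * `|x|) * expR (- b * `|x|) <= expR (- b * `|x|).
Proof. by rewrite ler_piMr. Qed.
Let Sg0 : 0 <= Sg.
Proof. by have := tail_ge0 s0 cs 0; rewrite /series /= big_geq// subr0. Qed.

Let bd (f : nat -> R -> R) (B : R) : (forall j x, `|f j x| <= s j * (B * expR (- b * `|x|))) ->
  forall j x, `|f j x| <= s j * `|B|.
Proof.
move=> fB j x; rewrite (le_trans (fB j x))// ler_wpM2l// (le_trans (ler_norm _))//.
by rewrite normrM [X in _ * X]ger0_norm// ler_piMr.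
Qed.

(** With $\tau = 1/(iw)$, integrating $Q e^{iwx}$ twice means applying $(iw + \partial)^{-2} =
    \tau^2 - 2\tau^3\partial + \dots$ to $Q$. [wPh] keeps these two terms, so that its second
    derivative stops at $Q'''$. *)
Lemma Ph_primitive : primitive (fsum wPh) (fsum wPh1).
Proof.
apply: (fsum_primitive s0 cs _ (bd wPh_le) (bd wPh1_le)) => j.
apply: wave_primitive; rewrite ?coefS ?coef0 ?mulr0 ?addr0//.
by rewrite coefD; congr coef; ring.
Qed.

Lemma Ph1_primitive : primitive (fsum wPh1) (fsum wPh2).
Proof.
apply: (fsum_primitive s0 cs _ (bd wPh1_le) (bd wPh2_le)) => j.
apply: wave_primitive; rewrite ?coefS ?coefD ?coef0//.
  by rewrite (_ : 1 - 1 = 0) ?coef0// subrr.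
by congr coef; ring.
Qed.

Lemma VBPh2 x : fsum wV x - fsum wPh2 x = fsum wD x.
Proof.
apply/eqP; rewrite subr_eq -(fsumD cs (fun j => wD_le j x) (fun j => wPh2_le j x)); apply/eqP.
congr (fsum _ x); apply/funext => j; apply/funext => y.
rewrite /wV /wD /wPh2 /wave -mulrDr -ReD; congr (2 * Re _); rewrite !coef0.
rewrite (_ : coef (-3) 2 j = - coef 3 2 j); last by rewrite /coef realcN mulNr.
rewrite (_ : coef (-2) 3 j = - coef 2 3 j); last by rewrite /coef realcN mulNr.
move: (Q j 0 y) (Q j 1 y) (Q j 2 y) (Q j 3 y) (osc (w j) y) (coef _ _ _) (coef _ _ _) (coef _ _ _).
by move=> q0 q1 q2 q3 o A0 A1 A2; ring.
Qed.

(** The equation $\mathrm{Ph}'' = V - S - (\mathrm{Ph}')^2$ solved for $S$, as $V - \mathrm{Ph}''$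
    is [fsum wD]. *)
Definition Spot x := fsum wD x - fsum wPh1 x ^+ 2.

Lemma Spot_le x : `|Spot x| <= (10 * Sg + 64 * Sg ^+ 2) * t ^+ 2 * expR (- b * `|x|).
Proof.
rewrite /Spot (le_trans (ler_normB _ _))// normrX.
have h1 := fsum_le cs (fun j => wD_le j x); have h2 := fsum_le cs (fun j => wPh1_le j x).
have h3 : `|fsum wPh1 x| ^+ 2 <= 64 * Sg ^+ 2 * t ^+ 2 * expR (- b * `|x|).
  rewrite (le_trans (ler_pM _ _ h2 h2))//.
  apply: (@le_trans _ _ (64 * Sg ^+ 2 * t ^+ 2 * (expR (- b * `|x|) * expR (- b * `|x|)))).
    by rewrite le_eqVlt; apply/orP; left; apply/eqP; ring.
  by rewrite ler_wpM2l// !mulr_ge0// sqr_ge0.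
rewrite (le_trans (lerD h1 h3))// le_eqVlt; apply/orP; left; apply/eqP; ring.
Qed.

(** Pointwise [wD] is only of order [t ^+ 2]. But $\tau^2 Q'' + \tau^3 Q'''$ is the amplitude of the
    derivative of $\tau^3 Q'' e^{iwx}$, so [wD] is three times a derivative, of zero integral, minus
    [Y], of order [t ^+ 3]. *)
Lemma integral_wD : `|\int[mu]_x fsum wD x| <= Sg * (4 * t ^+ 3 / b).
Proof.
apply: (fsum_integral_le s0 cs b0 _ _ wD_le); first by rewrite divr_ge0 ?mulr_ge0 ?exprn_ge0// ltW.
  by move=> j; exact: measurable_wave.
move=> j.
pose X := wave (coef 0 0) (coef 0 0) (coef 1 3) (coef 0 0).
pose X' := wave (coef 0 0) (coef 0 0) (coef 1 2) (coef 1 3).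
pose Y := wave (coef 0 0) (coef 0 0) (coef 0 0) (coef 1 3).
have pX : primitive (X j) (X' j).
  by apply: wave_primitive; rewrite ?coefS ?coef0 ?mulr0 ?add0r.
have XB x : `|X j x| <= s j * (2 * t ^+ 3) * expR (- b * `|x|).
  by rewrite -mulrA; have [? ? ? ?] := t_powers; apply: wave_coef_le; rewrite ?normr0 normr1; lra.
have X'B x : `|X' j x| <= s j * (2 * (t ^+ 2 + t ^+ 3)) * expR (- b * `|x|).
  by rewrite -mulrA; have [? ? ? ?] := t_powers; apply: wave_coef_le; rewrite ?normr0 normr1; lra.
have YB x : `|Y j x| <= s j * (2 * t ^+ 3) * expR (- b * `|x|).
  by rewrite -mulrA; have [? ? ? ?] := t_powers; apply: wave_coef_le; rewrite ?normr0 normr1; lra.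
have [iX' _] := integral_two_tails b0 (measurable_wave _ _ _ _ _) X'B.
have [iY _] := integral_two_tails b0 (measurable_wave _ _ _ _ _) YB.
have E : wD j = (fun x => 3 * X' j x - Y j x).
  apply/funext => x; rewrite /wD /X' /Y /wave.
  rewrite (_ : 3 * (2 * _) = 2 * (3 * Re ((coef 0 0 j * Q j 0 x + coef 0 0 j * Q j 1 x + coef 1 2 j * Q j 2 x +
       coef 1 3 j * Q j 3 x) * osc (w j) x))); last by ring.
  rewrite -mulrBr; congr (2 * _).
  have R3 (z : R[i]) : 3 * Re z = Re (3 * z).
    by rewrite (_ : 3 = 3%:C) ?ReM /= ?mul0r ?subr0// realc_nat.
  rewrite R3 -ReN -ReD; congr Re; rewrite !coef0 (coefZ 3) (coefZ 2).
  move: (Q j 0 x) (Q j 1 x) (Q j 2 x) (Q j 3 x) (osc (w j) x) (coef _ _ _) (coef _ _ _).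
  by move=> q0 q1 q2 q3 o A0 A1; ring.
rewrite E RintegralB//; last exact: integrableM_cst.
rewrite RintegralZl// (integral_derivative0 b0 pX XB X'B) mulr0 sub0r normrN.
rewrite (le_trans (normr_integral_decay b0 (measurable_wave _ _ _ _ _) YB))//.
by rewrite le_eqVlt; apply/orP; left; apply/eqP; ring.
Qed.

(** The mean of [wg j x ^+ 2] over the fast phase. *)
Definition wL j x : R := 2 * normc (Q j 0 x) ^+ 2 / w j ^+ 2.

Lemma wL_ge0 j x : 0 <= wL j x.
Proof. exact: (divr_ge0 (mulr_ge0 (ler0n _ _) (sqr_ge0 _)) (sqr_ge0 _)). Qed.

Let invw2 j : (w j ^+ 2)^-1 <= t ^+ 2.
Proof.
have h : (w j ^+ 2)^-1 = `|w j|^-1 ^+ 2 by rewrite exprVn real_normK// num_real.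
by rewrite h ler_sqr ?nnegrE ?invr_ge0.
Qed.

Lemma wL_le j x : wL j x <= s j * s j * (2 * t ^+ 2 * expR (- b * `|x|)).
Proof.
have h := profile_le (HQ j) x (isT : (0 < 4)%N).
have h2 : normc (Q j 0 x) ^+ 2 <= s j * s j * expR (- b * `|x|).
  by rewrite (le_trans (ler_pM (normc_ge0 _) (normc_ge0 _) h h))// mulrACA ler_wpM2l// mulr_ge0.
have h3 := mulr_ge0 (ler0n R 2) (sqr_ge0 (normc (Q j 0 x))).
rewrite /wL (le_trans (ler_pM h3 _ (ler_wpM2l _ h2) (invw2 j)))//.
  by rewrite invr_ge0 sqr_ge0.
by rewrite le_eqVlt; apply/orP; left; apply/eqP; ring.
Qed.

Lemma measurable_wL j : measurable_fun setT (wL j).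
Proof.
apply: measurable_funM => //; apply: measurable_funM => //.
have [m1 m2] := cmeasurable_profile j (isT : (0 < 4)%N).
rewrite (_ : (fun x => _) = (fun x => Re (Q j 0 x) * Re (Q j 0 x) + Im (Q j 0 x) * Im (Q j 0 x))).
  by apply: measurable_funD; exact: measurable_funM.
by apply/funext => x; rewrite normc_sqr.
Qed.

Hypothesis wD_sum : forall j l, w j + w l != 0 /\ `|w j + w l|^-1 <= t.
Hypothesis wD_dif : forall j l, l != j -> w j - w l != 0 /\ `|w j - w l|^-1 <= t.

Let osc_pair (F f : R -> R[i]) v j l : v != 0 -> `|v|^-1 <= t -> cprimitive F f ->
  (forall x, normc (F x) <= s j * s l * t ^+ 2 * expR (- b * `|x|)) ->
  (forall x, normc (f x) <= 2 * (s j * s l * t ^+ 2) * expR (- b * `|x|)) ->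
  mu.-integrable setT (EFin \o (fun x => 2 * Re (F x * osc v x))) /\
  `|\int[mu]_x (2 * Re (F x * osc v x))| <= s l * (s j * (8 * t ^+ 3 / b)).
Proof.
move=> v0 vt pF FN fN; have [m _] := cmeasurableM (cprimitive_measurable pF) (cmeasurable_osc v).
have FB x : `|Re (F x * osc v x)| <= s j * s l * t ^+ 2 * expR (- b * `|x|).
  by rewrite (le_trans (normr_Re_le _))// normcM normc_osc mulr1.
have [i _] := integral_two_tails b0 m FB.
split; first exact: integrableM_cst.
rewrite RintegralZl// normrM ger0_norm//.
have h := osc_integral b0 v0 pF FN fN.
have n0 : 0 <= 2 * (2 * (s j * s l * t ^+ 2)) / b by rewrite divr_ge0 ?mulr_ge0 ?sqr_ge0// ltW.
rewrite (le_trans (ler_wpM2l _ (le_trans h (ler_wpM2l n0 vt))))//.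
by rewrite le_eqVlt; apply/orP; left; apply/eqP; ring.
Qed.

(** A product of two real parts splits into a wave of frequency [w j + w l] and one of frequency
    [w j - w l]. Both gain an order [t] by parts, unless [l = j]: then the difference frequency is 0
    and its wave is exactly [wL j]. *)
Lemma wg_pair j l :
  `|\int[mu]_x (wg j x * wg l x - if l == j then wL j x else 0)| <=
  s l * (s j * (16 * t ^+ 3 / b)).
Proof.
have p0 k := profile_primitive (HQ k) (isT : (0 < 3)%N).
pose P k x := tau k * Q k 0 x; pose P' k x := tau k * Q k 1 x.
have pP k : cprimitive (P k) (P' k) by exact: cprimitiveZ.
have PE k l' x : (l' < 4)%N -> normc (tau k * Q k l' x) <= s k * t * expR (- b * `|x|).
  move=> l4; rewrite normcM mulrAC mulrC ler_pM ?normc_ge0 ?normc_tau//.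
  exact: (profile_le (HQ k)).
have prod (a c : R) (z z' : R[i]) x : normc z <= s j * t * expR (- b * `|x|) ->
    normc z' <= s l * t * expR (- b * `|x|) ->
    normc (z * z') <= s j * s l * t ^+ 2 * expR (- b * `|x|).
  move=> h h'; rewrite normcM (le_trans (ler_pM _ _ h h')) ?normc_ge0//.
  rewrite (_ : s j * t * _ * _ = s j * s l * t ^+ 2 * (expR (- b * `|x|) * expR (- b * `|x|))); last by ring.
  by rewrite ler_wpM2l// !mulr_ge0// sqr_ge0.
have sum2 (z z' : R[i]) x : normc z <= s j * s l * t ^+ 2 * expR (- b * `|x|) ->
    normc z' <= s j * s l * t ^+ 2 * expR (- b * `|x|) ->
    normc (z + z') <= 2 * (s j * s l * t ^+ 2) * expR (- b * `|x|).
  by move=> h h'; rewrite (le_trans (le_normcD _ _))//; lra.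
have [i1 e1] : mu.-integrable setT (EFin \o (fun x => 2 * Re (P j x * P l x * osc (w j + w l) x))) /\
    `|\int[mu]_x (2 * Re (P j x * P l x * osc (w j + w l) x))| <= s l * (s j * (8 * t ^+ 3 / b)).
  have [v0 vt] := wD_sum j l; apply: (osc_pair v0 vt (cprimitiveM (pP j) (pP l))) => x.
    by apply: prod => //; exact: PE.
  by apply: sum2; apply: prod => //; exact: PE.
have E x : wg j x * wg l x = 2 * Re (P j x * P l x * osc (w j + w l) x) +
    2 * Re (P j x * conjc (P l x) * osc (w j - w l) x).
  rewrite /wg /wave !coef0 /coef !mul0r !addr0 !expr1 !mul1r -!oscD -osc_conj /P.
  move: (tau j * Q j 0 x) (tau l * Q l 0 x) (osc (w j) x) (osc (w l) x).
  by move=> [p1 p2] [q1 q2] [a1 a2] [c1 c2] /=; ring.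
have up : s l * (s j * (8 * t ^+ 3 / b)) <= s l * (s j * (16 * t ^+ 3 / b)).
  rewrite !ler_wpM2l// ler_pM2r ?invr_gt0// ler_wpM2r ?exprn_ge0// ler_nat//.
have [lj|lj] := eqVneq l j.
  apply: le_trans up; apply: le_trans e1; rewrite le_eqVlt; apply/orP; left; apply/eqP.
  congr (`|_|); apply: eq_Rintegral => x _; rewrite E lj subrr.
  suff -> : 2 * Re (P j x * conjc (P j x) * osc 0 x) = wL j x by rewrite addrK.
  rewrite /osc mulr0 mul0r cexp0 mulr1.
  have -> : Re (P j x * conjc (P j x)) = normc (P j x) ^+ 2.
    by rewrite normc_sqr; case: (P j x) => ? ? /=; ring.
  rewrite /P normcM exprMn /tau Normc.normcV normcM normc_i mul1r normc_real exprVn real_normK ?num_real//.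
  by rewrite /wL; ring.
have [v0 vt] := wD_dif lj.
have [i2 e2] : mu.-integrable setT (EFin \o (fun x => 2 * Re (P j x * conjc (P l x) * osc (w j - w l) x))) /\
    `|\int[mu]_x (2 * Re (P j x * conjc (P l x) * osc (w j - w l) x))| <= s l * (s j * (8 * t ^+ 3 / b)).
  apply: (osc_pair v0 vt (cprimitiveM (pP j) (cprimitive_conj (pP l)))) => x.
    by apply: prod => //; rewrite ?normc_conj; exact: PE.
  by apply: sum2; apply: prod => //; rewrite ?normc_conj; exact: PE.
have -> : \int[mu]_x (wg j x * wg l x - 0) =
    \int[mu]_x (2 * Re (P j x * P l x * osc (w j + w l) x)) +
    \int[mu]_x (2 * Re (P j x * conjc (P l x) * osc (w j - w l) x)).
  by rewrite -RintegralD//; apply: eq_Rintegral => x _; rewrite subr0 E.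
rewrite (le_trans (ler_normD _ _))// (le_trans (lerD e1 e2))//.
by rewrite le_eqVlt; apply/orP; left; apply/eqP; ring.
Qed.

Let wL_sum_le j x : `|wL j x| <= s j * (Sg * (2 * t ^+ 2) * expR (- b * `|x|)).
Proof.
rewrite ger0_norm ?wL_ge0// (le_trans (wL_le j x))// -mulrA -[in leRHS]mulrA mulrA.
rewrite -mulrA -mulrA ler_wpM2l// ler_wpM2r ?mulr_ge0 ?sqr_ge0//.
rewrite (le_trans _ (nondecreasing_cvgn_le _ cs j.+1))//; last exact: nondecreasing_series.
by rewrite seriesSr lerDr; apply: sumr_ge0.
Qed.

(** The square is a double series, handled by two applications of [fsum_integral_le]: over [l] for
    fixed [j], then over [j]. *)
Lemma integral_square_wg :
  `|\int[mu]_x (fsum wg x ^+ 2 - fsum wL x)| <= Sg * (Sg * (16 * t ^+ 3 / b)).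
Proof.
have c0 : 0 <= 16 * t ^+ 3 / b by rewrite divr_ge0 ?mulr_ge0 ?exprn_ge0// ltW.
have mg j : measurable_fun setT (wg j) by exact: measurable_wave.
have mfg : measurable_fun setT (fsum wg) := measurable_fsum mg.
pose d j l x := wg j x * wg l x - if l == j then wL j x else 0.
have md j l : measurable_fun setT (d j l).
  apply: measurable_funB; first exact: measurable_funM.
  by case: eqVneq => _ //; exact: measurable_wL.
have dB j l x : `|d j l x| <= s l * (s j * (6 * t ^+ 2) * expR (- b * `|x|)).
  have h : `|wg j x * wg l x| <= s l * (s j * (4 * t ^+ 2) * expR (- b * `|x|)).
    rewrite normrM (le_trans (ler_pM _ _ (wg_le j x) (wg_le l x)))//.
    apply: (@le_trans _ _ (s l * (s j * (4 * t ^+ 2) * (expR (- b * `|x|) * expR (- b * `|x|))))).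
      by rewrite le_eqVlt; apply/orP; left; apply/eqP; ring.
    by rewrite !ler_wpM2l// !mulr_ge0// sqr_ge0.
  have h' : `|if l == j then wL j x else 0| <= s l * (s j * (2 * t ^+ 2) * expR (- b * `|x|)).
    case: eqVneq => [->|_].
      rewrite ger0_norm ?wL_ge0// (le_trans (wL_le j x))// le_eqVlt; apply/orP; left; apply/eqP; ring.
    by rewrite normr0 !mulr_ge0// sqr_ge0.
  rewrite (le_trans (ler_normB _ _))// (le_trans (lerD h h'))//.
  by rewrite le_eqVlt; apply/orP; left; apply/eqP; ring.
have dS j : fsum (d j) = fun x => fsum wg x * wg j x - wL j x.
  (* The diagonal term is written as a series with a single nonzero entry, so that it can be
     subtracted termwise. *)
  apply/funext => x; rewrite -[wL j x](fsum_single (wL j) j x) mulrC.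
  rewrite -(fsumZ cs (wg j x) (fun l => wg_le l x)).
  have h1 l : `|wg j x * wg l x| <= s l * (`|wg j x| * (2 * t * expR (- b * `|x|))).
    by rewrite normrM mulrCA ler_wpM2l//; exact: wg_le.
  have h2 l : `|-1 * (if l == j then wL j x else 0)| <= s l * (s j * (2 * t ^+ 2 * expR (- b * `|x|))).
    rewrite mulN1r normrN; case: eqVneq => [->|_]; last by rewrite normr0 !mulr_ge0// sqr_ge0.
    by rewrite ger0_norm ?wL_ge0// mulrA wL_le.
  have h3 l : `|if l == j then wL j x else 0| <= s l * (s j * (2 * t ^+ 2 * expR (- b * `|x|))).
    by have := h2 l; rewrite mulN1r normrN.
  rewrite -mulN1r -(fsumZ cs (-1) h3) -(fsumD cs h1 h2).
  by apply: eq_fsum => l; rewrite /d mulN1r.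
have key j : `|\int[mu]_x (fsum wg x * wg j x - wL j x)| <= s j * (Sg * (16 * t ^+ 3 / b)).
  rewrite -dS mulrCA; apply: (fsum_integral_le s0 cs b0 _ (md j) (dB j)) => [|l].
    by rewrite mulr_ge0.
  exact: wg_pair.
have mk j : measurable_fun setT (fun x => fsum wg x * wg j x - wL j x).
  by apply: measurable_funB; [exact: measurable_funM|exact: measurable_wL].
have kB j x : `|fsum wg x * wg j x - wL j x| <= s j * (Sg * (6 * t ^+ 2) * expR (- b * `|x|)).
  rewrite -[X in `|X|]/((fun x => fsum wg x * wg j x - wL j x) x) -dS.
  rewrite (le_trans (fsum_le cs (fun l => dB j l x)))// le_eqVlt; apply/orP; left; apply/eqP; ring.
have -> : \int[mu]_x (fsum wg x ^+ 2 - fsum wL x) =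
    \int[mu]_x fsum (fun j x => fsum wg x * wg j x - wL j x) x.
  apply: eq_Rintegral => x _; rewrite expr2 -(fsumZ cs (fsum wg x) (fun l => wg_le l x)).
  have h1 j : `|fsum wg x * wg j x| <= s j * (`|fsum wg x| * (2 * t * expR (- b * `|x|))).
    by rewrite normrM mulrCA ler_wpM2l//; exact: wg_le.
  have h3 j : `|wL j x| <= s j * (Sg * (2 * t ^+ 2 * expR (- b * `|x|))).
    by rewrite [X in _ * X]mulrA; exact: wL_sum_le.
  have h2 j : `|-1 * wL j x| <= s j * (Sg * (2 * t ^+ 2 * expR (- b * `|x|))).
    by rewrite mulN1r normrN.
  rewrite -mulN1r -(fsumZ cs (-1) h3) -(fsumD cs h1 h2).
  by apply: eq_fsum => l; rewrite mulN1r.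
by apply: (fsum_integral_le s0 cs b0 _ mk kB key); rewrite mulr_ge0.
Qed.

Lemma fsum_wL_ge0 x : 0 <= fsum wL x.
Proof.
apply: limr_ge; first exact: (fsum_cvg cs (fun j => wL_sum_le j x)).
by near=> n; apply: sumr_ge0 => j _; exact: wL_ge0.
Unshelve. all: by end_near. Qed.

(** Replacing [wPh1] by [wg] under the square costs $6t^2 \cdot 10t$ pointwise, hence $120$ times
    $t^3/b$ after integration; the remaining 16 comes from [integral_square_wg] and the 4 from
    [integral_wD]. *)
Lemma integral_Spot : `|\int[mu]_x Spot x + \int[mu]_x fsum wL x| <=
  (4 * Sg + 136 * Sg ^+ 2) / b * t ^+ 3.
Proof.
have mw a0 a1 a2 a3 : measurable_fun setT (fsum (wave a0 a1 a2 a3)).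
  by apply: measurable_fsum => j; exact: measurable_wave.
have mL : measurable_fun setT (fsum wL) by apply: measurable_fsum => j; exact: measurable_wL.
have DB x : `|fsum wD x| <= Sg * (10 * t ^+ 2) * expR (- b * `|x|).
  by rewrite -mulrA; exact: (fsum_le cs (fun j => wD_le j x)).
have LB x : `|fsum wL x| <= Sg * (Sg * (2 * t ^+ 2)) * expR (- b * `|x|).
  by rewrite -mulrA; exact: (fsum_le cs (fun j => wL_sum_le j x)).
have gB x : `|fsum wg x| <= Sg * (2 * t * expR (- b * `|x|)) by exact: (fsum_le cs (fun j => wg_le j x)).
have PB x : `|fsum wPh1 x| <= Sg * (8 * t * expR (- b * `|x|)).
  exact: (fsum_le cs (fun j => wPh1_le j x)).
have rB x : `|fsum wPh1 x - fsum wg x| <= Sg * (6 * t ^+ 2 * expR (- b * `|x|)).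
  have h2 j : `|-1 * wg j x| <= s j * (2 * t * expR (- b * `|x|)).
    by rewrite mulN1r normrN; exact: wg_le.
  rewrite -mulN1r -(fsumZ cs (-1) (fun j => wg_le j x)) -(fsumD cs (fun j => wPh1_le j x) h2).
  apply: (fsum_le cs) => j; rewrite mulN1r; exact: wPh1Bg_le.
have sq (u B : R) x : `|u| <= B * expR (- b * `|x|) -> 0 <= B -> `|u ^+ 2| <= B ^+ 2 * expR (- b * `|x|).
  move=> h B0; rewrite normrX (le_trans (ler_pM _ _ h h))//.
  by rewrite mulrACA -expr2 ler_wpM2l// sqr_ge0.
have PB2 x : `|fsum wPh1 x ^+ 2| <= (Sg * (8 * t)) ^+ 2 * expR (- b * `|x|).
  by apply: sq; rewrite ?mulr_ge0// -mulrA.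
have gB2 x : `|fsum wg x ^+ 2| <= (Sg * (2 * t)) ^+ 2 * expR (- b * `|x|).
  by apply: sq; rewrite ?mulr_ge0// -mulrA.
have mP2 : measurable_fun setT (fun x => fsum wPh1 x ^+ 2) by apply: measurable_funX; exact: mw.
have mg2 : measurable_fun setT (fun x => fsum wg x ^+ 2) by apply: measurable_funX; exact: mw.
have [iD _] := integral_two_tails b0 (mw _ _ _ _) DB.
have [iL _] := integral_two_tails b0 mL LB.
have [iP _] := integral_two_tails b0 mP2 PB2.
have [ig _] := integral_two_tails b0 mg2 gB2.
have dB x : `|fsum wPh1 x ^+ 2 - fsum wg x ^+ 2| <= 60 * Sg ^+ 2 * t ^+ 3 * expR (- b * `|x|).
  rewrite subr_sqr normrM (le_trans (ler_pM _ _ (rB x) (le_trans (ler_normD _ _) (lerD (PB x) (gB x)))))//.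
  apply: (@le_trans _ _ (60 * Sg ^+ 2 * t ^+ 3 * (expR (- b * `|x|) * expR (- b * `|x|)))).
    by rewrite le_eqVlt; apply/orP; left; apply/eqP; ring.
  by rewrite ler_wpM2l// !mulr_ge0 ?exprn_ge0.
have hd := normr_integral_decay b0 (measurable_funB mP2 mg2) dB.
rewrite RintegralB// in hd.
have hg := integral_square_wg; rewrite RintegralB// in hg.
have hD := integral_wD.
have -> : \int[mu]_x Spot x = \int[mu]_x fsum wD x - \int[mu]_x fsum wPh1 x ^+ 2.
  by rewrite -RintegralB.
have comb (A p g l a1 a2 a3 : R) : `|A| <= a1 -> `|p - g| <= a2 -> `|g - l| <= a3 ->
    `|A - p + l| <= a1 + a2 + a3.
  by rewrite !ler_norml => /andP[? ?] /andP[? ?] /andP[? ?]; apply/andP; split; lra.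
apply: (le_trans (comb _ _ _ _ _ _ _ hD hd hg)).
by rewrite le_eqVlt; apply/orP; left; apply/eqP; ring.
Qed.

End Waves.

(** * Everywhere-defined representatives of Sobolev functions *)

Section Representatives.
Context {R : realType}.
Implicit Types (g h : R -> R[i]) (x s b : R).
Local Arguments Normc.normc : simpl never.

Lemma continuous_ae_le (f g : R -> R) : continuous f -> continuous g ->
  {ae @lebesgue_measure R, forall x, f x <= g x} -> forall x, f x <= g x.
Proof.
move=> cf cg fg x; rewrite leNgt; apply/negP => gf.
have : \forall y \near x, 0 < f y - g y.
  have : {for x, continuous (fun y => f y - g y)} by apply: cvgB; [exact: cf|exact: cg].
  by move=> /cvgr_gt; apply; rewrite subr_gt0.
move=> [e /= e0 He].
have ltx : x < x + e / 2 by rewrite ltrDl divr_gt0.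
have [y /andP[xy yx] fy] := ae_exists_itv ltx fg.
have /He : ball x e y by rewrite /ball /= distrC ger0_norm ?subr_ge0//; lra.
by rewrite subr_gt0 ltNge fy.
Qed.

Lemma continuous_edecay b : continuous (fun x : R => expR (- b * `|x|)).
Proof.
move=> x; apply: continuous_comp; last exact: continuous_expR.
by apply: cvgM; [exact: cvg_cst|exact: norm_continuous].
Qed.

Lemma cprimitive_ae_normc_le F f b s : 0 <= s -> cprimitive F f ->
  {ae @lebesgue_measure R, forall x, normc (F x) <= s * expR (- b * `|x|)} ->
  forall x, normc (F x) <= s * expR (- b * `|x|).
Proof.
move=> s0 [p1 p2] H x; have c1 := primitive_continuous p1; have c2 := primitive_continuous p2.
rewrite -ler_sqr ?nnegrE ?normc_ge0 ?mulr_ge0 ?expR_ge0//.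
move: x; apply: continuous_ae_le.
- rewrite (_ : (fun x => _) = (fun x => Re (F x) * Re (F x) + Im (F x) * Im (F x))).
    by move=> x; apply: cvgD; apply: cvgM; do ?[exact: c1|exact: c2].
  by apply/funext => x; rewrite normc_sqr.
- move=> x; rewrite (_ : (fun x => _) = (fun x => (s * expR (- b * `|x|)) * (s * expR (- b * `|x|))))//.
  by apply: cvgM; (apply: cvgM; [exact: cvg_cst|exact: continuous_edecay]).
by apply: ae_mono H => x h; rewrite ler_sqr ?nnegrE ?normc_ge0 ?mulr_ge0 ?expR_ge0.
Qed.

Lemma lebesgue_measure_setT_gt0 : (0 < @lebesgue_measure R setT)%E.
Proof.
have mT : @lebesgue_measure R setT = +oo%E by rewrite -set_itvNyy lebesgue_measure_itv.
by have := ltry (0 : R); rewrite -mT.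
Qed.

Lemma Linf_norm_ge0 b g : (0 <= Linf_norm b g)%E.
Proof.
apply: ess_sup_gee; first exact: lebesgue_measure_setT_gt0.
by apply: aeW => x; rewrite lee_fin mulr_ge0 ?expR_ge0 ?normc_ge0.
Qed.

Lemma Wninf_norm_ge0 n b g : (0 <= Wninf_norm n b g)%E.
Proof.
by apply: le_ereal_inf_tmp => _ [h [_ _ ->]]; apply: sume_ge0 => l _; exact: Linf_norm_ge0.
Qed.

Lemma Linf_norm_le b g s : (Linf_norm b g <= s%:E)%E ->
  {ae @lebesgue_measure R, forall x, normc (g x) <= s * expR (- b * `|x|)}.
Proof.
move=> /ess_supP; apply: ae_mono => x; rewrite lee_fin => h.
by rewrite mulNr expRN ler_pdivlMr ?expR_gt0// mulrC.
Qed.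

(* Modifies [g] on a null set so that the bound holds at every point. *)
Definition truncation b s g x : R[i] :=
  if normc (g x) ^+ 2 <= (s * expR (- b * `|x|)) ^+ 2 then g x else 0.

Lemma truncation_le b s g x : 0 <= s -> normc (truncation b s g x) <= s * expR (- b * `|x|).
Proof.
move=> s0; rewrite /truncation; case: ifPn => [|_].
  by rewrite ler_sqr ?nnegrE ?normc_ge0 ?mulr_ge0 ?expR_ge0.
by rewrite Normc.normc0 mulr_ge0 ?expR_ge0.
Qed.

Lemma cmeasurable_truncation b s g : cmeasurable g -> cmeasurable (truncation b s g).
Proof.
move=> [m1 m2].
have mb : measurable_fun setT (fun x => normc (g x) ^+ 2 <= (s * expR (- b * `|x|)) ^+ 2).
  apply: measurable_fun_ler.
    by apply/measurable_EFinP; apply: measurable_normc_sqr.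
  apply: measurable_funX; apply: measurable_funM => //.
  exact: (continuous_measurable_fun (@continuous_edecay b)).
split.
  rewrite (_ : (fun x => _) = (fun x => if normc (g x) ^+ 2 <= (s * expR (- b * `|x|)) ^+ 2 then Re (g x) else 0)).
    exact: measurable_fun_ifT.
  by apply/funext => x; rewrite /truncation; case: ifP.
rewrite (_ : (fun x => _) = (fun x => if normc (g x) ^+ 2 <= (s * expR (- b * `|x|)) ^+ 2 then Im (g x) else 0)).
  exact: measurable_fun_ifT.
by apply/funext => x; rewrite /truncation; case: ifP.
Qed.

Lemma cdecay_clocally_bounded b s g : 0 < b -> (forall x, normc (g x) <= s * expR (- b * `|x|)) ->
  clocally_bounded g.
Proof.
move=> b0 gs; have s0 : 0 <= s.
  by have := le_trans (normc_ge0 _) (gs 0); rewrite normr0 mulr0 expR0 mulr1.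
have h x : normc (g x) <= s.
  by rewrite (le_trans (gs x))// ler_piMr// expR_le1 mulNr oppr_le0 mulr_ge0// ltW.
split=> M; exists s => x _; [exact: le_trans (normr_Re_le _) (h x)|exact: le_trans (normr_Im_le _) (h x)].
Qed.

Lemma Wninf_norm_measurable n b g : (0 < n)%N -> (Wninf_norm n b g < +oo)%E -> cmeasurable g.
Proof.
move=> n0 /ereal_inf_lt[_ [h [<- wd _]] _]; have [[[m1 _ _] [m2 _ _]] _ _] := wd 0%N n0.
by split.
Qed.

(** The strict inequality provides a chain of weak derivatives below the infimum. The top one is
    truncated so that its bound holds everywhere; the lower ones are obtained by integrating down,
    and their bounds pass from almost everywhere to everywhere by continuity. *)
Lemma profile_exists b s g : 0 < b -> (Wninf_norm 3 b g < s%:E)%E ->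
  exists Q, profile b s Q /\ {ae @lebesgue_measure R, forall x, g x = Q 0 x}.
Proof.
move=> b0 /ereal_inf_lt[_ [h [<- wd ->]] hs].
have s0 : 0 <= s.
  rewrite -lee_fin; apply: le_trans (ltW hs); apply: sume_ge0 => l _; exact: Linf_norm_ge0.
have hl l : (l < 4)%N -> {ae @lebesgue_measure R, forall x, normc (h l x) <= s * expR (- b * `|x|)}.
  move=> l4; apply: Linf_norm_le; apply: le_trans (ltW hs).
  rewrite (bigD1 (Ordinal l4))//= leeDl//; apply: sume_ge0 => i _; exact: Linf_norm_ge0.
pose Q3 := truncation b s (h 3%N).
have [_ [[m1 _ _] [m2 _ _]] _] := wd 2%N isT.
have mQ3 : cmeasurable Q3 by apply: cmeasurable_truncation.
have Q3s x : normc (Q3 x) <= s * expR (- b * `|x|) by exact: truncation_le.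
have Q3h : {ae @lebesgue_measure R, forall x, h 3%N x = Q3 x}.
  apply: ae_mono (hl 3%N isT) => x hx; rewrite /Q3 /truncation ifT//.
  by rewrite ler_sqr ?nnegrE ?normc_ge0 ?mulr_ge0 ?expR_ge0.
have step l (P : R -> R[i]) : (l < 3)%N -> cmeasurable P ->
    (forall x, normc (P x) <= s * expR (- b * `|x|)) ->
    {ae @lebesgue_measure R, forall x, h l.+1 x = P x} ->
    exists P', [/\ cprimitive P' P, (forall x, normc (P' x) <= s * expR (- b * `|x|)) &
      {ae @lebesgue_measure R, forall x, h l x = P' x}].
  move=> l3 mP Ps hP.
  have [P' [p' e']] := weak_derivative_primitive (wd l l3) mP (cdecay_clocally_bounded b0 Ps) hP.
  exists P'; split => //; apply: cprimitive_ae_normc_le p' _ => //.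
  by apply: ae_mono2 (hl l (ltn_trans l3 (isT : (3 < 4)%N))) e' => x hx <-.
have [Q2 [p2 Q2s Q2h]] := step 2%N Q3 isT mQ3 Q3s Q3h.
have [Q1 [p1 Q1s Q1h]] := step 1%N Q2 isT (cprimitive_measurable p2) Q2s Q2h.
have [Q0 [p0 Q0s Q0h]] := step 0%N Q1 isT (cprimitive_measurable p1) Q1s Q1h.
exists (fun l => nth Q3 [:: Q0; Q1; Q2] l); split => //.
by split => [[|[|[|l]]]|[|[|[|[|l]]]] x].
Qed.

End Representatives.

(** * Profiles of the coefficients [q j] *)

Section Potential.
Context {R : realType}.
Variables (q : int -> R -> R[i]) (lambda : int -> R) (theta beta : R).
Hypothesis HV : hypotheses_V q lambda theta beta.
Local Arguments Normc.normc : simpl never.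
Local Notation jj n := (Posz (n.+1)).

Let th0 : 0 < theta. Proof. by case: HV. Qed.
Let b0 : 0 < beta. Proof. by case: HV. Qed.

Lemma Wninf_norm_lty j : j != 0 -> (Wninf_norm 3 beta (q j) < +oo)%E.
Proof.
move=> j0; apply: le_lt_trans (hypV_sum HV); apply: esum_ge.
exists [set j]; first by split; [exact: finite_set1|move=> _ ->].
by rewrite fsbig_set1.
Qed.

Lemma summable_norms : exists s : nat -> R, [/\ (forall n, 0 <= s n), cvgn (series s) &
  forall n, (Wninf_norm 3 beta (q (jj n)) < (s n)%:E)%E].
Proof.
pose W n := Wninf_norm 3 beta (q (jj n)).
have W0 n : (0 <= W n)%E by exact: Wninf_norm_ge0.
have Wf n : W n \is a fin_num by rewrite ge0_fin_numE//; exact: Wninf_norm_lty.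
pose T := (\esum_(j in nonzero_int) Wninf_norm 3 beta (q j))%E.
have T0 : (0 <= T)%E by apply: esum_ge0 => j _; exact: Wninf_norm_ge0.
have Tf : T \is a fin_num by rewrite ge0_fin_numE//; exact: hypV_sum HV.
have bound N : series (fine \o W) N <= fine T.
  rewrite -lee_fin fineK// /series /= -sumEFin.
  rewrite (eq_bigr W); last by move=> n _; rewrite fineK.
  apply: esum_ge; exists [set` [seq jj n | n <- iota 0 N]].
    split; first exact: finite_seq.
    by move=> j /= /mapP[n _ ->].
  rewrite -fsbig_seq//; last by rewrite map_inj_uniq ?iota_uniq// => m n [].
  by rewrite big_map /index_iota subn0.
(* The geometric term keeps the series summable and makes the comparison with the norm strict, as
   [profile_exists] requires. *)
exists (fun n => fine (W n) + geometric 1 (2^-1) n); split.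
- by move=> n; rewrite addr_ge0 ?fine_ge0// /geometric /= mul1r exprn_ge0.
- apply: is_cvg_seriesD; last by apply: is_cvg_geometric_series; rewrite ger0_norm// invf_lt1// ltr1n.
  apply: nondecreasing_is_cvgn.
    by apply: nondecreasing_series => n _ _; rewrite fine_ge0.
  by exists (fine T) => _ [N _ <-].
move=> n; rewrite -/(W n) -[ltLHS]fineK// lte_fin ltrDl /geometric /= mul1r exprn_gt0//.
Qed.

Lemma profiles_exist : exists (s : nat -> R) (Q : nat -> nat -> R -> R[i]), [/\ (forall n, 0 <= s n), cvgn (series s),
  (forall n, profile beta (s n) (Q n)) &
  {ae @lebesgue_measure R, forall x, forall n, q (jj n) x = Q n 0 x /\
    q (- jj n) x = conjc (Q n 0 x)}].
Proof.
have [s [s0 cs sW]] := summable_norms.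
have [Q HQ] := choice (fun n => profile_exists b0 (sW n)).
exists s, Q; split => //; first by move=> n; case: (HQ n).
apply: ae_foralln => n; have [_ e] := HQ n.
by apply: ae_mono2 e (hypV_conj HV (isT : jj n != 0)) => x <- <-.
Qed.

End Potential.

(** * Elementary inequalities for the small parameter *)

Lemma perturbed_bounds {R : realFieldType} (S I C e : R) : C * e <= 1 -> C * e <= I / 2 ->
  `|S + e ^+ 2 * I| <= C * e ^+ 3 -> e ^+ 2 * (I / 2) <= - S /\ - S <= e ^+ 2 * (I + 1).
Proof.
move=> c1 cI.
have h1 : e ^+ 2 * (C * e) <= e ^+ 2 * 1 by rewrite ler_wpM2l ?sqr_ge0.
have h2 : e ^+ 2 * (C * e) <= e ^+ 2 * (I / 2) by rewrite ler_wpM2l ?sqr_ge0.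
have -> : C * e ^+ 3 = e ^+ 2 * (C * e) by ring.
rewrite ler_norml => /andP[? ?].
by split; lra.
Qed.

Lemma weight_bounds {R : realFieldType} (S : R) : 0 <= S ->
  [/\ S * 6 <= 64 * (S + 1) ^+ 2, S * 8 <= 8 * (S + 1) & 10 * S + 64 * S ^+ 2 <= 64 * (S + 1) ^+ 2].
Proof. by move=> S0; have := sqr_ge0 S => S2; split; lra. Qed.

Lemma small_parameter {R : realFieldType} (l : seq (R * R)) : all (fun p => 0 < p.2) l ->
  exists2 e0, 0 < e0 & forall e, 0 < e -> e < e0 -> all (fun p => p.1 * e < p.2) l.
Proof.
elim: l => [_|[c r] l IH /= /andP[r0 /IH[e0 e00 He0]]]; first by exists 1.
exists (Num.min e0 (r / (`|c| + 1))).
  by rewrite lt_min e00 divr_gt0// ltr_wpDl.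
move=> e ep; rewrite lt_min ltr_pdivlMr ?ltr_wpDl// => /andP[/(He0 _ ep) -> h].
rewrite andbT; apply: le_lt_trans h; rewrite mulrC ler_wpM2l ?ltW//.
by rewrite (le_lt_trans (ler_norm c))// ltrDl.
Qed.

Lemma pure_imaginary_sqr {R : realType} (x : R) : (- x ^+ 2)%:C = ('i%C * x%:C) ^+ 2.
Proof. by rewrite exprMn complex.sqr_i mulN1r rmorphN rmorphXn. Qed.

Lemma energy_error {R : realFieldType} (k J e K : R) : 0 <= J -> 0 < e -> e < 1 -> 0 <= K ->
  `|k - e ^+ 2 / 2 * J| <= K * e ^+ 3 ->
  `|- k ^+ 2 + e ^+ 4 / 4 * J ^+ 2| <= K * (J + K) * e ^+ 5.
Proof.
move=> J0 e0 e1 K0 h.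
have -> : - k ^+ 2 + e ^+ 4 / 4 * J ^+ 2 =
    - ((k - e ^+ 2 / 2 * J) * ((k - e ^+ 2 / 2 * J) + e ^+ 2 * J)) by field.
have -> : K * (J + K) * e ^+ 5 = K * e ^+ 3 * (e ^+ 2 * K + e ^+ 2 * J) by ring.
rewrite normrN normrM ler_pM//; apply: le_trans (ler_normD _ _) _; apply: lerD.
  apply: le_trans h _; rewrite mulrC ler_wpM2r// exprS ler_piMl ?sqr_ge0// ltW//.
by rewrite ger0_norm// mulr_ge0 ?sqr_ge0.
Qed.

(** * The rescaled potential and the choice of constants *)

Section Potential.
Context {R : realType}.
Variables (q : int -> R -> R[i]) (lambda : int -> R) (theta beta : R).
Hypothesis HV : hypotheses_V q lambda theta beta.
Local Arguments Normc.normc : simpl never.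
Local Arguments osc : simpl never.
Local Notation jj n := (Posz (n.+1)).
Local Notation om n := (2 * pi * lambda (jj n)).

Let th0 : 0 < theta. Proof. by case: HV. Qed.
Let b0 : 0 < beta. Proof. by case: HV. Qed.

Lemma sum_nonzeroE (a : int -> R) :
  sum_nonzero a = limn (series (fun n => a (jj n) + a (- jj n))).
Proof. by congr (limn _); apply/funext => N; rewrite /series /= big_add1. Qed.

Lemma lambda_opp n : lambda (- jj n) = - lambda (jj n).
Proof. exact: (hypV_odd HV). Qed.

Lemma wave_argument (v y : R) : cexp ('i%C * (v * y)%:C) = osc v y.
Proof. by rewrite /osc rmorphM mulrA. Qed.

Lemma pi2_gt0 : 0 < 2 * pi :> R.
Proof. by rewrite mulr_gt0// pi_gt0. Qed.

Lemma frequency_le n : 2 * pi * theta <= `|om n|.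
Proof. by rewrite normrM gtr0_norm ?pi2_gt0// ler_pM2l ?pi2_gt0// (hypV_low HV). Qed.

Lemma frequency_inv_le n : `|om n|^-1 <= (2 * pi * theta)^-1.
Proof.
have p0 : 0 < 2 * pi * theta by rewrite mulr_gt0 ?pi2_gt0.
have h := frequency_le n; by rewrite lef_pV2// posrE// (lt_le_trans p0).
Qed.

(** A sum of two positive-index frequencies is a difference of frequencies with indices of opposite
    sign, hence distinct even when [n = m]. *)
Lemma frequency_sum_le n m : 2 * pi * theta <= `|om n + om m|.
Proof.
rewrite -mulrDr normrM gtr0_norm ?pi2_gt0// ler_pM2l ?pi2_gt0//.
by rewrite -[lambda (jj m)]opprK -lambda_opp; apply: (hypV_sep HV).
Qed.

Lemma frequency_dif_le n m : m != n -> 2 * pi * theta <= `|om n - om m|.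
Proof.
move=> mn; rewrite -mulrBr normrM gtr0_norm ?pi2_gt0// ler_pM2l ?pi2_gt0//.
by apply: (hypV_sep HV) => //; apply: contra mn => /eqP[->].
Qed.

Lemma scaled_frequency (v eps : R) : 0 < eps -> 2 * pi * theta <= `|v| ->
  v / eps != 0 /\ `|v / eps|^-1 <= eps / (2 * pi * theta).
Proof.
move=> e0 h; have p0 : 0 < 2 * pi * theta by rewrite mulr_gt0 ?pi2_gt0.
have v0 : 0 < `|v| by exact: lt_le_trans h.
split; first by rewrite mulf_neq0 ?invr_eq0 ?(gt_eqF e0)// -normr_gt0.
rewrite normrM normfV (gtr0_norm e0) invfM invrK mulrC ler_pM2l//.
by rewrite lef_pV2// posrE.
Qed.

Section Profiles.
Variables (s : nat -> R) (Q : nat -> nat -> R -> R[i]).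
Hypotheses (s0 : forall n, 0 <= s n) (cs : cvgn (series s)).
Hypothesis HQ : forall n, profile beta (s n) (Q n).
Hypothesis Qq : {ae @lebesgue_measure R, forall x, forall n, q (jj n) x = Q n 0 x /\
    q (- jj n) x = conjc (Q n 0 x)}.
Variable eps : R.
Hypothesis e0 : 0 < eps.
Local Notation t := (eps / (2 * pi * theta)).
Local Notation w := (fun n => om n / eps).

Lemma q_eps_wave : {ae @lebesgue_measure R, forall x, q_eps q lambda eps x = fsum (wV Q w) x}.
Proof.
apply: ae_mono Qq => x qQ; rewrite /q_eps /potential /= sum_nonzeroE.
congr (limn (series _)); apply/funext => n; have [-> ->] := qQ n.
rewrite /wV /wave !coef0 !mul0r !addr0 /coef expr0 mulr1 mul1r.
rewrite lambda_opp !wave_argument (_ : osc (2 * pi * - _) _ = conjc (osc (om n) (x / eps))); last first.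
  by rewrite osc_conj mulrN.
rewrite -rmorphM /=.
have -> : osc (om n) (x / eps) = osc (om n / eps) x.
  by rewrite -!wave_argument (mulrC x) mulrA.
have Re_conjc (z : R[i]) : Re (conjc z) = Re z by case: z.
by rewrite Re_conjc; ring.
Qed.

Lemma measurable_q j : j != 0 -> cmeasurable (q j).
Proof. by move=> j0; apply: (@Wninf_norm_measurable _ 3 beta) => //; exact: (Wninf_norm_lty HV). Qed.

(** The Volterra integrands contain [q_eps] itself and not its representative; since the series may
    diverge on a null set, measurability is that of [limn]. *)
Lemma measurable_q_eps : measurable_fun setT (q_eps q lambda eps).
Proof.
rewrite (_ : q_eps q lambda eps = (fun x => limn (series (fun n =>
   Re (q (jj n) x * osc (om n / eps) x) + Re (q (- jj n) x * osc (- om n / eps) x))))).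
  apply: measurable_limn => N; apply: measurable_series => n; apply: measurable_funD.
    by have [m _] := cmeasurableM (measurable_q (isT : jj n != 0)) (cmeasurable_osc (om n / eps)).
  by have [m _] := cmeasurableM (measurable_q (isT : - jj n != 0)) (cmeasurable_osc (- om n / eps)).
apply/funext => x; rewrite /q_eps /potential /= sum_nonzeroE.
congr (limn (series _)); apply/funext => n.
by rewrite lambda_opp -!wave_argument (mulrC x) !mulrA !mulrN.
Qed.

Let wL_abs n x : `|wL Q (fun n => om n) n x| <=
  s n * (limn (series s) * (2 * (2 * pi * theta)^-1 ^+ 2 * expR (- beta * `|x|))).
Proof.
rewrite ger0_norm ?wL_ge0//; apply: le_trans (wL_le b0 s0 HQ frequency_inv_le n x) _.
rewrite -mulrA ler_wpM2l// ler_wpM2r//.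
  exact: (mulr_ge0 (mulr_ge0 (ler0n _ _) (sqr_ge0 _)) (expR_ge0 _)).
apply: le_trans (nondecreasing_cvgn_le _ cs n.+1); last exact: nondecreasing_series.
by rewrite /series /= big_nat_recr//= lerDr sumr_ge0.
Qed.

(** The 2 in [wL] counts [j] and [- j], and the $4\pi^2$ is absorbed by the angular frequencies. *)
Lemma Lambda_eff_wL : {ae @lebesgue_measure R, forall x,
  Lambda_eff q lambda x = fsum (wL Q (fun n => om n)) x}.
Proof.
apply: ae_mono Qq => x qQ; rewrite /Lambda_eff sum_nonzeroE.
have p0 : (4 * pi ^+ 2 : R) != 0 by rewrite mulf_neq0 ?expf_neq0 ?gt_eqF ?pi_gt0.
apply: (mulfI p0); rewrite mulrA divff// mul1r.
rewrite -(fsumZ cs _ (wL_abs^~ x)).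
congr (limn (series _)); apply/funext => n; have [-> ->] := qQ n.
rewrite normc_conj lambda_opp sqrrN /wL.
have l0 : lambda (jj n) != 0.
  by rewrite -normr_gt0 (lt_le_trans th0)// (hypV_low HV).
have pi0 : pi != 0 :> R by rewrite gt_eqF ?pi_gt0.
move: (normc _) (lambda _) l0 pi pi0 {p0} => c l l0 p p0.
by field; rewrite ?l0 ?p0.
Qed.

Lemma integral_Lambda_eff : \int[mu]_x Lambda_eff q lambda x = \int[mu]_x fsum (wL Q (fun n => om n)) x.
Proof.
rewrite /Rintegral; congr fine; apply: ae_eq_integral => //.
- apply/measurable_EFinP.
  rewrite (_ : Lambda_eff q lambda = (fun x => (4 * pi ^+ 2)^-1 * limn (series (fun n =>
    normc (q (jj n) x) ^+ 2 / lambda (jj n) ^+ 2 +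
    normc (q (- jj n) x) ^+ 2 / lambda (- jj n) ^+ 2)))); last first.
    by apply/funext => x; rewrite /Lambda_eff sum_nonzeroE.
  apply: measurable_funM => //; apply: measurable_limn => N; apply: measurable_series => n.
  by apply: measurable_funD; apply: measurable_funM => //; apply/measurable_EFinP; apply: measurable_normc_sqr; apply: measurable_q.
- by apply/measurable_EFinP; apply: measurable_fsum => n; apply: measurable_wL HQ _.
- by apply: ae_mono Lambda_eff_wL => x h _; rewrite h.
Qed.

Lemma fsum_wL_scaled x : fsum (wL Q w) x = eps ^+ 2 * fsum (wL Q (fun n => om n)) x.
Proof.
rewrite -(fsumZ cs _ (wL_abs^~ x)); apply: eq_fsum => n.
by rewrite /wL expr_div_n invf_div mulrA [RHS]mulrC mulrAC mulrA.
Qed.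

Lemma fsum_wL_integrable : mu.-integrable setT (EFin \o fsum (wL Q (fun n => om n))).
Proof.
pose N := limn (series s) * (limn (series s) * (2 * (2 * pi * theta)^-1 ^+ 2)).
have bd x : `|fsum (wL Q (fun n => om n)) x| <= N * expR (- beta * `|x|).
  by rewrite (le_trans (fsum_le cs (wL_abs^~ x)))// /N !mulrA.
have m : measurable_fun setT (fsum (wL Q (fun n => om n))).
  by apply: measurable_fsum => n; exact: measurable_wL HQ _.
by have [] := integral_two_tails b0 m bd.
Qed.

Lemma integral_wL_scaled : \int[mu]_x fsum (wL Q w) x = eps ^+ 2 * \int[mu]_x Lambda_eff q lambda x.
Proof.
rewrite integral_Lambda_eff -(RintegralZl _ _ fsum_wL_integrable)//.
by apply: eq_Rintegral => x _; exact: fsum_wL_scaled.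
Qed.

(** A nonnegative function of zero integral vanishes almost everywhere. Then every term of the
    series, and with it every [q j], vanishes at almost every [x], and so does the potential. *)
Lemma integral_Lambda_eff_gt0 :
  ~ {ae @lebesgue_measure R, forall x : R, forall y : R, potential q lambda x y = 0} ->
  0 < \int[mu]_x Lambda_eff q lambda x.
Proof.
move=> q0; rewrite integral_Lambda_eff; have L0 := fsum_wL_ge0 b0 s0 cs HQ frequency_inv_le.
rewrite lt_neqAle Rintegral_ge0 ?andbT; last by move=> x _; exact: L0.
apply/negP => /eqP/esym I0; apply: q0.
have m : measurable_fun setT (EFin \o fsum (wL Q (fun n => om n))).
  by case/integrableP : fsum_wL_integrable.
have : (\int[mu]_x `|(fsum (wL Q (fun n => om n)) x)%:E|)%E = 0%E.
  under eq_integral do rewrite gee0_abs ?lee_fin ?L0//.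
  have /fineK <- := integrable_fin_num measurableT fsum_wL_integrable.
  by rewrite -/(Rintegral _ _ _) I0.
move/(ae_eq_integral_abs mu measurableT m) => z.
apply: (ae_mono2 _ Qq z) => x qQ /(_ I) [fz] y.
have Q0 n : Q n 0 x = 0.
  have c := fsum_cvg cs (wL_abs^~ x).
  have : series ((wL Q (fun n => om n))^~ x) n.+1 <= 0.
    rewrite -fz; apply: nondecreasing_cvgn_le => //.
    by apply: nondecreasing_series => i _ _; exact: wL_ge0.
  rewrite /series /= big_nat_recr//= => h.
  have {h} : wL Q (fun n => om n) n x <= 0.
    by apply: le_trans h; rewrite lerDr sumr_ge0// => i _; exact: wL_ge0.
  have l0 : 0 < om n ^+ 2.
    by rewrite exprn_even_gt0//= -normr_gt0 (lt_le_trans _ (frequency_le n))// mulr_gt0 ?pi2_gt0.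
  rewrite /wL pmulr_lle0 ?invr_gt0// pmulr_rle0// => h.
  apply/eqP; rewrite -normc_eq0 -sqrf_eq0; apply/eqP/le_anti.
  by rewrite h sqr_ge0.
have term j : j != 0 -> q j x = 0.
  case: j => [[|n]|n] //= _; first by have [-> _] := qQ n.
  by rewrite NegzE; have [_ ->] := qQ n; rewrite Q0 conjc0.
rewrite /potential /= !sum_nonzeroE; apply/eqP; rewrite eq_complex /=.
have s00 : limn (series (fun _ : nat => 0 : R)) = 0.
  rewrite (_ : series _ = (fun=> 0)) ?lim_cst//.
  by apply/funext => N; rewrite /series /= big1.
apply/andP; split; apply/eqP; rewrite -[RHS]s00; congr (limn (series _));
  by apply/funext => n; rewrite !term// !mul0r /= addr0.
Qed.

Local Notation Sg := (limn (series s)).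
Local Notation t0 := ((2 * pi * theta)^-1).
Local Notation I := (\int[mu]_x Lambda_eff q lambda x).

(** [d = Cd * eps] has to dominate the phase bounds, through [8 * (Sg + 1) * t0], and to satisfy
    [tau0 <= d ^+ 2]: since [I + 1 <= Cd] and [1 <= Cd], one has
    [eps ^+ 2 * (I + 1) <= (Cd * eps) ^+ 2]. *)
Definition Cd : R := 8 * (Sg + 1) * t0 + I + 1.
Definition Ctau : R := (4 * Sg + 136 * Sg ^+ 2) / beta * t0 ^+ 3.

Let Sg0 : 0 <= Sg.
Proof.
apply: le_trans (nondecreasing_cvgn_le _ cs 0%N); first by rewrite /series /= big_geq.
exact: nondecreasing_series.
Qed.

Let t00 : 0 < t0. Proof. by rewrite invr_gt0 mulr_gt0 ?pi2_gt0. Qed.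

Let wle n : w n != 0 /\ `|w n|^-1 <= t.
Proof. exact: scaled_frequency e0 (frequency_le n). Qed.

Lemma q_eps_modulated : 0 <= I -> t <= 1 -> Cd * eps <= 4^-1 -> Cd * eps <= beta ^+ 2 / 96 ->
  modulated beta (Cd * eps) (fsum (wV Q w)) (fsum (wPh Q w)) (fsum (wPh1 Q w)) (Spot Q w).
Proof.
move=> I0 t1 d4 d96; have wn0 n := (wle n).1; have wnt n := (wle n).2.
have et : t = t0 * eps by rewrite mulrC.
have dt : 8 * (Sg + 1) * t <= Cd * eps.
  by rewrite et mulrA ler_wpM2r ?(ltW e0)// /Cd -addrA lerDl addr_ge0.
have tt0 : 0 <= t by rewrite et mulr_ge0 ?ltW.
have t8 : 0 <= 8 * (Sg + 1) * t by exact: (mulr_ge0 (mulr_ge0 (ler0n _ 8) (addr_ge0 Sg0 ler01)) tt0).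
have dd0 : 0 <= Cd * eps by exact: le_trans dt.
have dt2 : 64 * (Sg + 1) ^+ 2 * t ^+ 2 <= (Cd * eps) ^+ 2.
  have -> : 64 * (Sg + 1) ^+ 2 * t ^+ 2 = (8 * (Sg + 1) * t) ^+ 2 by ring.
  by rewrite ler_sqr ?nnegrE.
have [c6 c8 c10] := weight_bounds Sg0.
split=> //.
- exact: Ph_primitive b0 s0 cs HQ wn0 wnt t1.
- have -> : (fun x => fsum (wV Q w) x - Spot Q w x - fsum (wPh1 Q w) x ^+ 2) = fsum (wPh2 Q w).
    by apply/funext => x; rewrite /Spot -(VBPh2 s0 cs HQ wnt t1); ring.
  exact: Ph1_primitive b0 s0 cs HQ wn0 wnt t1.
- apply: measurable_funB; first by apply: measurable_fsum => n; exact: measurable_wave HQ _ _ _ _ _.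
  by apply: measurable_funX; apply: measurable_fsum => n; exact: measurable_wave HQ _ _ _ _ _.
- move=> x; apply: le_trans (fsum_le cs (fun n => wPh_le s0 HQ wnt t1 n x)) _.
  rewrite mulrA ler_wpM2r ?expR_ge0//; apply: le_trans dt2.
  by rewrite [leLHS]mulrA ler_wpM2r ?sqr_ge0.
- move=> x; apply: le_trans (fsum_le cs (fun n => wPh1_le s0 HQ wnt t1 n x)) _.
  rewrite mulrA ler_wpM2r ?expR_ge0//; apply: le_trans dt.
  by rewrite [leLHS]mulrA ler_wpM2r.
- move=> x; apply: le_trans (Spot_le b0 s0 cs HQ wnt t1 x) _.
  rewrite ler_wpM2r ?expR_ge0//; apply: le_trans dt2.
  by rewrite ler_wpM2r ?sqr_ge0.
Qed.

Lemma integral_Spot_approx : t <= 1 -> `|\int[mu]_x Spot Q w x + eps ^+ 2 * I| <= Ctau * eps ^+ 3.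
Proof.
move=> t1; have wn0 n := (wle n).1; have wnt n := (wle n).2.
have h := integral_Spot b0 s0 cs HQ wn0 wnt t1 _ _.
rewrite -integral_wL_scaled; apply: le_trans (h _ _) _.
- by move=> j l; rewrite -mulrDl; exact: scaled_frequency e0 (frequency_sum_le j l).
- by move=> j l lj; rewrite -mulrBl; exact: scaled_frequency e0 (frequency_dif_le lj).
by rewrite /Ctau (mulrC eps) exprMn mulrA.
Qed.

Lemma q_eps_bound_state : 0 < I -> eps < 1 -> t0 * eps < 1 -> Cd * eps < 4^-1 ->
  Cd * eps < beta ^+ 2 / 96 -> Cd * eps < beta / 2 -> Ctau * eps < 1 -> Ctau * eps < I / 2 ->
  approx_const2 beta * Cd ^+ 3 * eps < I / 4 -> wconst beta * Cd * eps < 2 ->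
  exists kappa : R, [/\ 0 < kappa < beta / 2,
    is_pole (transmission (q_eps q lambda eps)) ('i%C * kappa%:C),
    simple_eigenvalue (q_eps q lambda eps) (- kappa ^+ 2),
    exists (u : R -> R[i]) (B : R), eigenfunction (q_eps q lambda eps) (- kappa ^+ 2) u /\
      forall x, normc (u x) <= B * expR (- kappa * `|x|) &
    `|2 * kappa - eps ^+ 2 * I| <= (approx_const2 beta * Cd ^+ 3 + Ctau) * eps ^+ 3].
Proof.
move=> I0 e1 te d4 d96 db c1 cI ca cw.
have t1 : t <= 1 by rewrite mulrC ltW.
have wn0 n := (wle n).1; have wnt n := (wle n).2.
have HM := q_eps_modulated (ltW I0) t1 (ltW d4) (ltW d96).
have [_ Sint] := integral_two_tails b0 (mod_mS HM) (mod_Sd HM).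
have Sa := integral_Spot_approx t1.
have CI : I + 1 <= Cd.
  by rewrite /Cd -addrA lerDr !mulr_ge0 ?(ltW t00)// addr_ge0.
set tau0 : R := - \int[mu]_x Spot Q w x.
(* The lower bound makes [tau0] positive and larger than the cubic error of the Wronskian; the upper
   one brings it below [d ^+ 2]. *)
have [t_lo t_hi] : eps ^+ 2 * (I / 2) <= tau0 /\ tau0 <= eps ^+ 2 * (I + 1).
  exact: perturbed_bounds (ltW c1) (ltW cI) Sa.
have tau_gt0 : 0 < tau0 by apply: lt_le_trans t_lo; rewrite mulr_gt0 ?exprn_gt0 ?divr_gt0.
have Cd0 : 0 <= Cd by apply: le_trans CI; rewrite addr_ge0 ?ltW.
have tau_d : tau0 <= (Cd * eps) ^+ 2.
  apply: le_trans t_hi _; rewrite exprMn mulrC ler_wpM2r ?sqr_ge0//.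
  apply: (le_trans CI); rewrite expr2 ler_peMr//; apply: le_trans CI; rewrite lerDr ltW//.
have ca' : approx_const2 beta * (Cd * eps) ^+ 3 <= tau0 / 2.
  have -> : approx_const2 beta * (Cd * eps) ^+ 3 = eps ^+ 2 * (approx_const2 beta * Cd ^+ 3 * eps) by ring.
  apply: (@le_trans _ _ (eps ^+ 2 * (I / 4))); first by rewrite ler_wpM2l ?sqr_ge0 ?ltW.
  have -> : eps ^+ 2 * (I / 4) = eps ^+ 2 * (I / 2) / 2 by field.
  by rewrite ler_pM2r ?invr_gt0.
have tauE : tau0 = - (tail (Spot Q w) 0 + tail (fun x => Spot Q w (- x)) 0).
  by rewrite /tau0 Sint.
have [kappa [k0 kd W0 kt]] := Wf_zero HM tauE tau_gt0 tau_d ca'.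
have Vb x : `|fsum (wV Q w) x| <= Sg * 2 * expR (- beta * `|x|).
  by rewrite (le_trans (fsum_le cs (fun n => wV_le s0 HQ wnt t1 n x)))// mulrA.
have Vb' x : `|fsum (wV Q w) x| <= Sg * 2.
  rewrite (le_trans (Vb x))// ler_piMr ?mulr_ge0// expR_le1 mulNr oppr_le0 mulr_ge0//.
  exact: ltW.
have mV : measurable_fun setT (fsum (wV Q w)).
  by apply: measurable_fsum => n; exact: measurable_wave HQ _ _ _ _ _.
have [se [u [B uB]]] := Wf_eigenfunction HM mV Vb' q_eps_wave k0 kd W0.
exists kappa; split => //.
(* [kappa <= d ^+ 2 <= d < beta / 2] keeps the pole inside the strip where the Jost solutions are
   defined. *)
- rewrite k0/=; apply: le_lt_trans kd (le_lt_trans _ db).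
  have d0 : 0 <= Cd * eps by exact: (mulr_ge0 Cd0 (ltW e0)).
  have d1 : Cd * eps <= 1 by rewrite (le_trans (ltW d4))// invf_le1// ler1n.
  by rewrite expr2 ler_piMr.
- apply: (Wf_zero_pole HM Vb measurable_q_eps q_eps_wave _ k0 kd W0).
  by rewrite mulrA.
- by exists u, B.
- have -> : (approx_const2 beta * Cd ^+ 3 + Ctau) * eps ^+ 3 =
    approx_const2 beta * (Cd * eps) ^+ 3 + Ctau * eps ^+ 3 by ring.
  have -> : 2 * kappa - eps ^+ 2 * I = (2 * kappa - tau0) - (\int[mu]_x Spot Q w x + eps ^+ 2 * I).
    by rewrite /tau0; ring.
  exact: le_trans (ler_normB _ _) (lerD kt Sa).
Qed.

End Profiles.
End Potential.

Theorem corollary3p7 (R : realType) (q : int -> R -> R[i]) (lambda : int -> R)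
    (theta beta : R)
    (HV : hypotheses_V q lambda theta beta)
    (q_neq0 : ~ {ae @lebesgue_measure R, forall x : R, forall y : R,
                   potential q lambda x y = 0}) :
  let I : R := \int[@lebesgue_measure R]_x Lambda_eff q lambda x in
  exists (eps0 : R) (k : R -> R[i]) (E : R -> R),
    [/\ 0 < eps0,
        forall eps : R, 0 < eps -> eps < eps0 ->
          [/\ 0 < complex.Im (k eps) < beta / 2,
              is_pole (transmission (q_eps q lambda eps)) (k eps),
              (E eps)%:C = k eps ^+ 2,
              simple_eigenvalue (q_eps q lambda eps) (E eps) &
              exists u : R -> R[i],
                eigenfunction (q_eps q lambda eps) (E eps) u /\
                exists M B : R, forall x : R, M <= `|x| ->
                  Normc.normc (u x) <=
                    B * expR (- (Num.sqrt `|E eps| * `|x|))],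
        exists K : R, forall eps : R, 0 < eps -> eps < eps0 ->
          Normc.normc (k eps - 'i%C * (eps ^+ 2 / 2 * I)%:C) <= K * eps ^+ 3 &
        exists K : R, forall eps : R, 0 < eps -> eps < eps0 ->
          `|E eps + eps ^+ 4 / 4 * I ^+ 2| <= K * eps ^+ 5].
Proof.
move=> I.
have [s [Q [s0 cs HQ Qq]]] := profiles_exist HV.
have I0 : 0 < I by exact: (integral_Lambda_eff_gt0 HV s0 cs HQ Qq q_neq0).
have b0 := hypV_beta HV.
pose D := Cd q lambda theta s; pose T := Ctau theta beta s.
pose A := approx_const2 beta * D ^+ 3.
(* Each pair [(c, r)] is a condition [c * eps < r] of [q_eps_bound_state], in the same order. *)
have [|eps0 e00 small] := @small_parameter R
  [:: (1, 1); ((2 * pi * theta)^-1, 1); (D, 4^-1); (D, beta ^+ 2 / 96); (D, beta / 2);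
      (T, 1); (T, I / 2); (A, I / 4); (wconst beta * D, 2)].
  by rewrite /= ltr01 !divr_gt0 ?exprn_gt0// invr_gt0 !ltr0n.
(* The range of [eps] stands under the existential so that choice yields [kappa] as a total
   function; its value outside the range is arbitrary. *)
have bs eps : exists kappa : R, 0 < eps < eps0 -> [/\ 0 < kappa < beta / 2,
    is_pole (transmission (q_eps q lambda eps)) ('i%C * kappa%:C),
    simple_eigenvalue (q_eps q lambda eps) (- kappa ^+ 2),
    exists (u : R -> R[i]) (B : R), eigenfunction (q_eps q lambda eps) (- kappa ^+ 2) u /\
      forall x, Normc.normc (u x) <= B * expR (- kappa * `|x|) &
    `|2 * kappa - eps ^+ 2 * I| <= (A + T) * eps ^+ 3].
  have [/andP[e0 /(small _ e0)]|_] := boolP (0 < eps < eps0); last by exists 0.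
  rewrite /= mul1r andbT => /and5P[e1 h1 h2 h3 /and5P[h4 h5 h6 h7 h8]].
  have [kappa hk] := q_eps_bound_state HV s0 cs HQ Qq e0 I0 e1 h1 h2 h3 h4 h5 h6 h7 h8.
  by exists kappa.
have [kappa Hk] := choice bs.
have kE eps : 0 < eps -> eps < eps0 ->
    `|kappa eps - eps ^+ 2 / 2 * I| <= (A + T) / 2 * eps ^+ 3.
  move=> e0 e1; have [_ _ _ _ h] := Hk eps (introT andP (conj e0 e1)).
  have -> : kappa eps - eps ^+ 2 / 2 * I = (2 * kappa eps - eps ^+ 2 * I) / 2 by field.
  have -> : (A + T) / 2 * eps ^+ 3 = (A + T) * eps ^+ 3 / 2 by ring.
  by rewrite normrM normfV [`|2|]ger0_norm// ler_pM2r ?invr_gt0.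
exists eps0, (fun eps => 'i%C * (kappa eps)%:C), (fun eps => - kappa eps ^+ 2); split=> //.
- move=> eps e0 e1.
  have [/andP[k0 kb] pole simple [u [B [eu uB]]] _] := Hk eps (introT andP (conj e0 e1)).
  split=> //; first by rewrite /= !(mul0r, mul1r, add0r, mulr0, addr0) k0.
    exact: pure_imaginary_sqr.
  exists u; split=> //; exists 0, B => x _.
  by rewrite normrN ger0_norm ?sqr_ge0// sqrtr_sqr gtr0_norm// -mulNr.
- exists ((A + T) / 2) => eps e0 e1.
  by rewrite -mulrBr -rmorphB normcM normc_i mul1r normc_real; exact: kE.
(* The absolute value supplies the nonnegative constant that [energy_error] asks for. *)
exists (`|(A + T) / 2| * (I + `|(A + T) / 2|)) => eps e0 e1.
have /= := small eps e0 e1; rewrite mul1r => /andP[e1' _].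
apply: energy_error => //; first exact: ltW.
by apply: le_trans (kE eps e0 e1) _; rewrite ler_wpM2r ?exprn_ge0 ?(ltW e0)// ler_norm.
Qed.
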